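(* Let $(V_n,\mathbf r_n)$ be a sequence of finite transitive Markov chains which is uniformly transient, with $|V_n|\to\infty$. Then for every sequence of times $t_n$ with $t_n\to\infty$ and $t_n/t_{\mathrm{meet}}(\mathbf r_n)\to0$, \[\lim_{n\to\infty}\frac{|V_n|t_n}{2t_{\mathrm{meet}}(\mathbf r_n)}P_{t_n}=1\qquad\text{and}\qquad\lim_{n\to\infty}t_n\alpha_{t_n}P_{t_n}=1.\]
   Context: A Markov chain $(V,\mathbf r)$ is a continuous-time irreducible Markov chain on a finite or countable set with symmetric jump rates $r_{x,y}=r_{y,x}\ge0$; $r(x)=\sum_y r_{x,y}$; $p_t(x,y)$ is its transition probability. Transitive: for all $u,v$ there is a permutation $\phi$ with $\phi(u)=v$ and $r_{\phi(x),\phi(y)}=r_{x,y}$; transitive chains are assumed to satisfy $r(x)=1$ for all $x$. $t_{\mathrm{rel}}$ is the inverse spectral gap. A sequence of finite chains $(V_n,\mathbf r_n)$ with $\max_x r_n(x)\asymp1\asymp\min_x r_n(x)$ is uniformly transient if \[\lim_{s\to\infty}\limsup_{n\to\infty}\max_{x,y\in V_n}\int_{s\wedge t_{\mathrm{rel}}(\mathbf r_n)}^{t_{\mathrm{rel}}(\mathbf r_n)}p^{(n)}_t(x,y)\,dt=0.\] Coalescing random walks start with one particle per state; particles move independently and merge upon one jumping onto another; $P_t$ is the probability that a given state is occupied at time $t$. $t_{\mathrm{meet}}$ is the expected meeting time of two independent walks started independently uniformly. With $\nu_x(y)=r_{x,y}/r(x)$, $\alpha_t:=r(x)\mathbb{P}(\tau_{\mathrm{meet}}>t)$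 for walks started at $x$ and at a $\nu_x$-distributed state. *)

(* Defs.v *)
From HB Require Import structures.
From mathcomp Require Import all_boot all_order all_algebra all_fingroup.
From mathcomp Require Import all_classical all_reals all_analysis.

Set Implicit Arguments.
Unset Strict Implicit.
Unset Printing Implicit Defensive.

Import Order.TTheory GRing.Theory Num.Theory.
Local Open Scope classical_set_scope.
Local Open Scope ring_scope.

Section CTMC.
Variable R : realType.

(* [q x y] (x <> y) is the jump rate from x to y; the diagonal of q is
   irrelevant (self-jumps do not change the state). *)
Definition generator (S : finType) (q : S -> S -> R) (x y : S) : R :=
  if x == y then - \sum_(z | z != x) q x z else q x y.

Fixpoint gen_pow (S : finType) (q : S -> S -> R) (k : nat) (x y : S) : R :=
  match k with
  | 0 => (x == y)%:R
  | k'.+1 => \sum_z generator q x z * gen_pow q k' z y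
  end.

Definition ctmc_kernel (S : finType) (q : S -> S -> R) (t : R) (x y : S) : R :=
  limn (fun m => \sum_(k < m) (t ^+ k / (k`!)%:R * gen_pow q k x y)).

Variable N : nat.
Implicit Types (r : 'I_N -> 'I_N -> R).

Definition rate_tot r (x : 'I_N) : R := \sum_y r x y.

Definition p_t r (t : R) (x y : 'I_N) : R := ctmc_kernel r t x y.

Definition symmetric_rates r : Prop :=
  (forall x y, 0 <= r x y) /\ (forall x y, r x y = r y x).

Definition irreducible r : Prop :=
  forall x y : 'I_N, connect (fun a b => 0 < r a b) x y.

Definition transitive_chain r : Prop :=
  (forall u v : 'I_N, exists phi : {perm 'I_N},
      phi u = v /\ forall x y, r (phi x) (phi y) = r x y) /\
  (forall x, rate_tot r x = 1).

Definition laplacian r : 'M[R]_N :=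
  \matrix_(i, j) ((i == j)%:R * rate_tot r i - r i j).

Definition spectral_gap r : R := inf [set l : R | 0 < l /\ eigenvalue (laplacian r) l].
Definition t_rel r : R := (spectral_gap r)^-1.

(* two independent walks (X,Y) on V x V, stopped when they meet
   (the diagonal is absorbing) *)
Definition pair_rates r (u v : 'I_N * 'I_N) : R :=
  if u.1 == u.2 then 0 else
  (if u.2 == v.2 then r u.1 v.1 else 0) + (if u.1 == v.1 then r u.2 v.2 else 0).

Definition P_meet_gt r (t : R) (x y : 'I_N) : R :=
  \sum_(v : 'I_N * 'I_N | v.1 != v.2) ctmc_kernel (pair_rates r) t (x, y) v.

(* t_meet = E[tau_meet] for independent uniform starting points,
   computed as  int_0^oo P(tau_meet > t) dt *)
Definition P_meet_gt_unif r (t : R) : R :=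
  (#|'I_N|%:R ^+ 2)^-1 * \sum_x \sum_y P_meet_gt r t x y.

Definition t_meet r : R :=
  fine (\int[lebesgue_measure]_(t in [set t : R | (0 <= t)%R])
          (P_meet_gt_unif r t)%:E)%E.

Definition alpha r (t : R) (x : 'I_N) : R :=
  rate_tot r x * \sum_y (r x y / rate_tot r x) * P_meet_gt r t x y.

(* coalescing random walks: Markov chain of the set of occupied states;
   a particle at a in A jumps to b at rate r a b, giving b |: (A :\ a) *)
Definition coal_rates r (A B : {set 'I_N}) : R :=
  \sum_(a in A) \sum_b (if B == b |: (A :\ a) then r a b else 0).

Definition P_occ r (t : R) (x : 'I_N) : R :=
  \sum_(B : {set 'I_N} | x \in B) ctmc_kernel (coal_rates r) t [set: 'I_N]%SET B.

End CTMC.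

Definition uniformly_transient (R : realType) (N : nat -> nat)
    (r : forall n, 'I_(N n) -> 'I_(N n) -> R) : Prop :=
  (fun s : R =>
     limn_esup (fun n =>
       (\big[Num.max/0]_(x : 'I_(N n)) \big[Num.max/0]_(y : 'I_(N n))
          (\int[lebesgue_measure]_(t in `[Num.min s (t_rel (r n)), t_rel (r n)])
              p_t (r n) t x y))%:E))
    @ +oo --> 0%E.

(* Main.v *)
(* Proof idea. All processes are driven by one coalescing flow: random maps [f] of
   the state space, whose images are the coalescing walks and whose fibres
   [f^-1(o)] are the clusters of the dual voter model. The state [o] is occupied
   at time [t] iff its cluster is nonempty; the cluster size is a symmetric random
   walk on the integers run at the speed of the cluster boundary, and comparing
   with the cluster a time [d] earlier shows that this speed is
   alpha_d * (cluster size) up to an error controlled by alpha_d - alpha_t. Hence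
   the Laplace transform of the cluster size is close to that of Feller's branching
   diffusion, E[1 - (1 - K/t)^size] ~ (K/t) / (1 + alpha K), and K -> oo gives the
   lower bound t P_t >~ 1/alpha. For the upper bound one must exclude small
   surviving clusters, which reduces to P_t = O(1/t); that crude bound follows by
   following the Green energy of the occupied set, using negative correlation of
   occupation events. Finally the fundamental matrix Z (the integral of p_t - 1/N)
   satisfies t_meet = N Z(o,o) / 2 exactly and alpha_t Z(o,o) -> 1, the latter by
   optional stopping for Z along two walks, and uniform transience with the
   Poincare inequality bounds Z(o,o) and the tails P_s Z. *)
Require Import Defs.
From HB Require Import structures.
From mathcomp Require Import all_boot all_order all_algebra all_fingroup.
From mathcomp Require Import all_classical all_reals all_analysis.
From mathcomp Require Import ring lra.
Import Order.TTheory GRing.Theory Num.Theory numFieldNormedType.Exports.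
Local Open Scope classical_set_scope.
Local Open Scope ring_scope.

Set Implicit Arguments.
Unset Strict Implicit.
Unset Printing Implicit Defensive.

(** No sample path is constructed. An expectation over the flow is a row of a matrix exponential on
    the finite set of self-maps, and each martingale or coupling argument becomes the
    differentiation in time of such an expectation, followed by integration of the sign or size of
    the derivative. One expectation has two time derivatives, by moves applied after the map (walks)
    and by moves applied before it (voter clusters); equating them is the duality.

    Two obstacles shape the estimates. The Laplace transform at K/T does not see clusters much
    smaller than T/K; their contribution is removed by letting the flow run for a further time delta
    T, in which a cluster of k sites survives with probability at most k rho(delta T). And Z changes
    sign, so it gives no one-sided bounds by itself; subtracting the tail P_s Z leaves the
    nonnegative Green function up to s/N, which is negligible for fixed s as N grows. *)

(** * Derivative rules and mean value inequalities on the real line *)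

Section RealDerivatives.
Variable R : realType.
Implicit Types f g : R -> R.

Lemma is_derive_bigsum (I : Type) (s : seq I) (P : pred I) (F : I -> R -> R)
    (dF : I -> R) (t : R) :
  (forall i, is_derive t (1 : R) (F i) (dF i)) ->
  is_derive t (1 : R) (fun u => \sum_(i <- s | P i) F i u) (\sum_(i <- s | P i) dF i).
Proof.
move=> h; elim: s => [|i s IH].
  rewrite big_nil; under eq_fun do rewrite big_nil.
  exact: is_derive_cst.
rewrite big_cons; under eq_fun do rewrite big_cons.
by case: (P i) => //; exact: is_deriveD.
Qed.

Lemma is_derive_const (c t : R) : is_derive t (1 : R) (fun=> c) 0.
Proof. exact: is_derive_cst. Qed.

Lemma is_derive_var (t : R) : is_derive t (1 : R) (fun u => u) 1.
Proof. exact: is_derive_id. Qed.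

Lemma is_derive_add f g (t df dg : R) :
  is_derive t (1 : R) f df -> is_derive t (1 : R) g dg ->
  is_derive t (1 : R) (fun u => f u + g u) (df + dg).
Proof. exact: is_deriveD. Qed.

Lemma is_derive_sub f g (t df dg : R) :
  is_derive t (1 : R) f df -> is_derive t (1 : R) g dg ->
  is_derive t (1 : R) (fun u => f u - g u) (df - dg).
Proof. exact: is_deriveB. Qed.

Lemma is_derive_opp f (t df : R) :
  is_derive t (1 : R) f df -> is_derive t (1 : R) (fun u => - f u) (- df).
Proof. exact: is_deriveN. Qed.

Lemma is_derive_mul f g (t df dg : R) :
  is_derive t (1 : R) f df -> is_derive t (1 : R) g dg ->
  is_derive t (1 : R) (fun u => f u * g u) (df * g t + f t * dg).
Proof.
move=> hf hg; apply: is_derive_eq (is_deriveM hf hg) _.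
by rewrite /GRing.scale /= addrC [g t * _]mulrC.
Qed.

Lemma is_derive_mull (c : R) f (t df : R) :
  is_derive t (1 : R) f df -> is_derive t (1 : R) (fun u => c * f u) (c * df).
Proof.
move=> hf; apply: is_derive_eq (is_derive_mul (is_derive_const c t) hf) _.
by rewrite mul0r add0r.
Qed.

Lemma is_derive_mulr (c : R) f (t df : R) :
  is_derive t (1 : R) f df -> is_derive t (1 : R) (fun u => f u * c) (df * c).
Proof.
move=> hf; apply: is_derive_eq (is_derive_mul hf (is_derive_const c t)) _.
by rewrite mulr0 addr0.
Qed.

Lemma is_derive_exprn f (n : nat) (t df : R) :
  is_derive t (1 : R) f df ->
  is_derive t (1 : R) (fun u => f u ^+ n) (n%:R * f t ^+ n.-1 * df).
Proof.
move=> hf; elim: n => [|n IH].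
  by under eq_fun do rewrite expr0; rewrite !mul0r; exact: is_derive_const.
under eq_fun do rewrite exprS.
apply: is_derive_eq (is_derive_mul hf IH) _; case: n {IH} => [|n] /=.
  by rewrite expr0; ring.
by rewrite exprS -[n.+2%:R]natr1; ring.
Qed.

Lemma is_derive_comp f g (t df dg : R) :
  is_derive t (1 : R) g dg -> is_derive (g t) (1 : R) f df ->
  is_derive t (1 : R) (fun u => f (g u)) (dg * df).
Proof. by move=> hg hf; have := @is_derive1_comp R f g t df dg hf hg; rewrite mulrC. Qed.

Lemma is_derive_affine (a b t : R) :
  is_derive t (1 : R) (fun u => a + b * u) b.
Proof.
apply: is_derive_eq (is_derive_add (is_derive_const a t) (is_derive_mull b (is_derive_var t))) _.
by rewrite add0r mulr1.
Qed.

Lemma is_derive_comp_sub f (a t df : R) :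
  is_derive (a - t) (1 : R) f df ->
  is_derive t (1 : R) (fun u => f (a - u)) (- df).
Proof.
move=> hf; have h1 : is_derive t (1 : R) (fun u => a - u) (-1).
  apply: is_derive_eq (is_derive_sub (is_derive_const a t) (is_derive_var t)) _.
  by rewrite sub0r.
by apply: is_derive_eq (is_derive_comp h1 hf) _; rewrite mulN1r.
Qed.

Lemma is_derive_continuous f (t df : R) :
  is_derive t (1 : R) f df -> {for t, continuous f}.
Proof. by move=> h; apply/differentiable_continuous/derivable1_diffP. Qed.

(** The derivative is required only inside the interval: in [cluster_laplace] the interpolating
    function is controlled only for times in [0, T]. *)
Lemma ler_increment_of_derive f (df : R -> R) (a b c : R) : a <= b ->
  (forall t, a < t < b -> is_derive t (1 : R) f (df t)) ->
  (forall t, a <= t <= b -> {for t, continuous f}) ->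
  (forall t, a < t < b -> df t <= c) -> f b - f a <= c * (b - a).
Proof.
rewrite le_eqVlt => /orP[/eqP <- *|ab hd cf hc]; first by rewrite !subrr mulr0.
have h1 t : t \in `]a, b[%R -> is_derive t (1 : R) f (df t).
  by rewrite in_itv /=; exact: hd.
have h2 : {within `[a, b], continuous f}.
  apply: continuous_in_subspaceT => t; rewrite inE /= => /itvP tab.
  by apply: cf; rewrite !tab.
have [t tab ->] := MVT ab h1 h2; apply: ler_wpM2r; first by rewrite subr_ge0 ltW.
by apply: hc; move: tab; rewrite in_itv.
Qed.

Lemma ler_increment f (df : R -> R) (a b c : R) : a <= b ->
  (forall t, is_derive t (1 : R) f (df t)) ->
  (forall t, a < t < b -> df t <= c) -> f b - f a <= c * (b - a).
Proof.
move=> ab hd; apply: ler_increment_of_derive => //.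
by move=> t _; exact: is_derive_continuous (hd t).
Qed.

Lemma ger_increment f (df : R -> R) (a b c : R) : a <= b ->
  (forall t, is_derive t (1 : R) f (df t)) ->
  (forall t, a < t < b -> c <= df t) -> c * (b - a) <= f b - f a.
Proof.
move=> ab hd hc.
have hc' t : a < t < b -> - df t <= - c by rewrite lerN2; exact: hc.
have := ler_increment ab (fun t => is_derive_opp (hd t)) hc'; lra.
Qed.

End RealDerivatives.

(** * Matrix exponentials over a finite index set *)

Section MatrixExponential.
Variables (R : realType) (S : finType).
Implicit Types (A : S -> S -> R) (x y z : S).

(** Unlike [gen_pow], this allows any matrix: uniformization exponentiates a nonnegative matrix that
    is not a generator. *)
Fixpoint mpow A (k : nat) x y : R :=
  if k is k'.+1 then \sum_z A x z * mpow A k' z y else (x == y)%:R.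

Definition mexp A (t : R) x y : R :=
  limn (fun m => \sum_(k < m) (t ^+ k / (k`!)%:R * mpow A k x y)).

Lemma sum_delta_l x (f : S -> R) : \sum_z (x == z)%:R * f z = f x.
Proof.
rewrite (bigD1 x) //= eqxx mul1r big1 ?addr0 // => z zx.
by rewrite eq_sym (negbTE zx) mul0r.
Qed.

Lemma sum_delta_r x (f : S -> R) : \sum_z f z * (z == x)%:R = f x.
Proof.
rewrite -[RHS](sum_delta_l x f); apply: eq_bigr => z _.
by rewrite mulrC eq_sym.
Qed.

Lemma mpowSr A k x y : mpow A k.+1 x y = \sum_z mpow A k x z * A z y.
Proof.
elim: k x y => [|k IH] x y.
  by rewrite /= sum_delta_r sum_delta_l.
rewrite [LHS]/= ; under eq_bigr => z _ do rewrite -/(mpow A k.+1 z y) IH mulr_sumr.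
rewrite exchange_big /=; apply: eq_bigr => w _.
by rewrite mulr_suml; apply: eq_bigr => z _; rewrite mulrA.
Qed.

Lemma mpow_ge0 A k x y : (forall x y, 0 <= A x y) -> 0 <= mpow A k x y.
Proof.
move=> A0; elim: k x => [|k IH] x /=; first by rewrite ler0n.
by apply: sumr_ge0 => z _; rewrite mulr_ge0.
Qed.

Let bnd A : R := \sum_x \sum_y `|A x y|.

Let bnd_ge0 A : 0 <= bnd A.
Proof. by apply: sumr_ge0 => x _; apply: sumr_ge0. Qed.

Let mpow_bound A k x y : `|mpow A k x y| <= bnd A ^+ k.
Proof.
elim: k x => [|k IH] x /=.
  by rewrite expr0; case: (x == y); rewrite ?normr1 ?normr0.
apply: le_trans (ler_norm_sum _ _ _) _; rewrite exprS.
apply: (@le_trans _ _ (\sum_z `|A x z| * bnd A ^+ k)).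
  by apply: ler_sum => z _; rewrite normrM ler_wpM2l.
rewrite -mulr_suml ler_wpM2r ?exprn_ge0 //.
rewrite [leRHS](bigD1 x) //= lerDl.
by apply: sumr_ge0 => u _; apply: sumr_ge0.
Qed.

(** Taylor coefficients of the j-th derivative. Differentiating the series shifts [j] by one, so
    convergence for all [j] at once supplies every hypothesis of termwise differentiation. *)
Definition mexp_coef A x y j (k : nat) : R := (k`!)%:R^-1 * mpow A (k + j) x y.

Let coef_diffs A x y j :
  pseries_diffs (mexp_coef A x y j) = mexp_coef A x y j.+1.
Proof.
apply/funext => k; rewrite /pseries_diffs /mexp_coef factS natrM invfM addSnnS.
by rewrite !mulrA mulfV ?mul1r // pnatr_eq0.
Qed.

Let coef_cvg A x y j t : cvgn (pseries (mexp_coef A x y j) t).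
Proof.
apply: normed_cvg; rewrite /normed_series_of /=.
have := @is_cvg_series_exp_coeff R (bnd A * `|t|) => h.
have h' : cvgn (series (fun n => bnd A ^+ j * exp_coeff (bnd A * `|t|) n)).
  have -> : series (fun n => bnd A ^+ j * exp_coeff (bnd A * `|t|) n) =
            (fun n => bnd A ^+ j * series (exp_coeff (bnd A * `|t|)) n).
    by apply/funext => n; rewrite /series /= mulr_sumr.
  exact: is_cvgMr.
apply: series_le_cvg h' => [n /=|n /=|n /=] //.
- by rewrite mulr_ge0 ?exprn_ge0 // /exp_coeff divr_ge0 ?exprn_ge0 ?mulr_ge0.
- rewrite /mexp_coef !normrM normfV normr_nat normrX /exp_coeff /= exprMn.
  rewrite [leRHS](_ : _ = n`!%:R^-1 * (bnd A ^+ (n + j)) * `|t| ^+ n); last first.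
    by rewrite exprD; ring.
  by rewrite ler_wpM2r ?exprn_ge0 // ler_wpM2l ?invr_ge0 ?ler0n.
Qed.

Let mexpE A x y t : mexp A t x y = limn (pseries (mexp_coef A x y 0) t).
Proof.
congr (limn _); apply/funext => m; rewrite /pseries /series /= big_mkord.
by apply: eq_bigr => k _; rewrite /mexp_coef addn0; ring.
Qed.

Lemma mexp_cvg A x y t :
  (fun m => \sum_(k < m) (t ^+ k / (k`!)%:R * mpow A k x y)) @ \oo --> mexp A t x y.
Proof.
have -> : (fun m => \sum_(k < m) (t ^+ k / (k`!)%:R * mpow A k x y)) =
   pseries (mexp_coef A x y 0) t.
  apply/funext => m; rewrite /pseries /series /= big_mkord.
  by apply: eq_bigr => k _; rewrite /mexp_coef addn0; ring.
by rewrite mexpE; exact: coef_cvg.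
Qed.

Let mexp_derive_aux A x y t :
  is_derive t (1 : R) (fun u => mexp A u x y)
    (limn (pseries (mexp_coef A x y 1) t)).
Proof.
have -> : (fun u => mexp A u x y) = (fun u => limn (pseries (mexp_coef A x y 0) u)).
  by apply/funext => u; exact: mexpE.
rewrite -coef_diffs; apply: (@pseries_snd_diffs _ _ (`|t| + 1)).
- exact: coef_cvg.
- by rewrite coef_diffs; exact: coef_cvg.
- by rewrite !coef_diffs; exact: coef_cvg.
- by rewrite [ltRHS]ger0_norm ?ltrDl // addr_ge0.
Qed.

Lemma is_cvg_lim_sum (I : finType) (c : I -> R) (u : I -> nat -> R) (l : I -> R) :
  (forall i, u i @ \oo --> l i) ->
  limn (fun n => \sum_i c i * u i n) = \sum_i c i * l i.
Proof.
move=> h; apply/cvg_lim => //.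
elim: (index_enum I) => [|i e IH].
  by rewrite big_nil; under eq_fun do rewrite big_nil; exact: cvg_cst.
rewrite big_cons; under eq_fun do rewrite big_cons.
by apply: cvgD IH; apply: cvgMr; exact: h.
Qed.

Lemma mexp_deriveE_l A x y t :
  is_derive t (1 : R) (fun u => mexp A u x y) (\sum_z A x z * mexp A t z y).
Proof.
apply: is_derive_eq (mexp_derive_aux A x y t) _.
rewrite -(is_cvg_lim_sum _ (fun z => @mexp_cvg A z y t)); congr (limn _).
apply/funext => m; rewrite /pseries /series /= big_mkord.
under [RHS]eq_bigr => z _ do rewrite mulr_sumr.
rewrite exchange_big /=; apply: eq_bigr => k _.
rewrite /mexp_coef addn1 /= mulr_sumr mulr_suml.
by apply: eq_bigr => z _; ring.
Qed.

Lemma mexp_deriveE_r A x y t :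
  is_derive t (1 : R) (fun u => mexp A u x y) (\sum_z mexp A t x z * A z y).
Proof.
apply: is_derive_eq (mexp_derive_aux A x y t) _.
under [RHS]eq_bigr => z _ do rewrite mulrC.
rewrite -(is_cvg_lim_sum _ (fun z => @mexp_cvg A x z t)); congr (limn _).
apply/funext => m; rewrite /pseries /series /= big_mkord.
under [RHS]eq_bigr => z _ do rewrite mulr_sumr.
rewrite exchange_big /=; apply: eq_bigr => k _.
rewrite /mexp_coef addn1 mpowSr mulr_sumr mulr_suml.
by apply: eq_bigr => z _; ring.
Qed.

Lemma mexp0 A x y : mexp A 0 x y = (x == y)%:R.
Proof.
apply/cvg_lim => //; rewrite -(cvg_shiftS _).
apply: cvg_near_cst; near=> m.
rewrite /= big_ord_recl /= expr0 mul1r fact0 invr1 mul1r big1 ?addr0 // => i _.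
by rewrite expr0n /= mul0r mul0r.
Unshelve. all: by end_near. Qed.

Lemma mexp_ge0 A t x y : (forall x y, 0 <= A x y) -> 0 <= t -> 0 <= mexp A t x y.
Proof.
move=> A0 t0; apply: limr_ge; first by apply: cvgP; exact: mexp_cvg.
near=> m; apply: sumr_ge0 => k _.
by rewrite mulr_ge0 ?divr_ge0 ?exprn_ge0 ?mpow_ge0.
Unshelve. all: by end_near. Qed.

(** The sum of [mexp A s x y * w (t - s) y] is constant in [s]. Kernels are identified below by
    exhibiting a solution of the backward equation and quoting this uniqueness. *)
Lemma backward_unique A (w : R -> S -> R) :
  (forall t x, is_derive t (1 : R) (fun u => w u x) (\sum_z A x z * w t z)) ->
  forall t x, w t x = \sum_y mexp A t x y * w 0 y.
Proof.
move=> hw t x.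
pose v s := \sum_y mexp A s x y * w (t - s) y.
have hv s : is_derive s (1 : R) v 0.
  apply: is_derive_eq (is_derive_bigsum _ _ (fun y => is_derive_mul
    (mexp_deriveE_r A x y s) (is_derive_comp_sub (hw (t - s) y)))) _.
  under eq_bigr => y _ do rewrite mulrN mulr_suml mulr_sumr.
  rewrite sumrB [X in X - _]exchange_big /= -sumrB big1 // => y _.
  by rewrite -sumrB big1 // => z _; rewrite mulrA subrr.
have := is_derive_0_is_cst 0 t hv; rewrite /v subrr subr0.
under eq_bigr => y _ do rewrite mexp0.
by rewrite sum_delta_l.
Qed.

Lemma mexpD A s t x y : mexp A (s + t) x y = \sum_z mexp A s x z * mexp A t z y.
Proof.
have hw u z : is_derive u (1 : R) (fun v => mexp A (v + t) z y)
    (\sum_w A z w * mexp A (u + t) w y).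
  have h1 : is_derive u (1 : R) (fun v => v + t) 1.
    apply: is_derive_eq (is_derive_add (is_derive_var u) (is_derive_const t u)) _.
    by rewrite addr0.
  apply: is_derive_eq (is_derive_comp h1 (mexp_deriveE_l A z y (u + t))) _.
  by rewrite mul1r.
rewrite (backward_unique (w := fun u z => mexp A (u + t) z y) hw s x).
by under eq_bigr => z _ do rewrite add0r.
Qed.

Lemma mexp_sym A t x y :
  (forall x y, A x y = A y x) -> mexp A t x y = mexp A t y x.
Proof.
move=> hA; have h k u v : mpow A k u v = mpow A k v u.
  elim: k u v => [|k IH] u v; first by rewrite /= eq_sym.
  by rewrite mpowSr /=; apply: eq_bigr => z _; rewrite IH hA mulrC.
by rewrite /mexp; congr (limn _); apply/funext => m; apply: eq_bigr => k _; rewrite h.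
Qed.

End MatrixExponential.

(** * Transition kernels of finite chains *)

Section Kernel.
Variables (R : realType) (S : finType).
Implicit Types (q : S -> S -> R) (f g : S -> R).

Lemma ctmc_kernelE q : ctmc_kernel q = mexp (generator q).
Proof.
have h k x y : gen_pow q k x y = mpow (generator q) k x y.
  by elim: k x => //= k IH x; apply: eq_bigr => z _; rewrite IH.
apply/funext => t; apply/funext => x; apply/funext => y.
rewrite /ctmc_kernel /mexp; congr (limn _); apply/funext => m.
by apply: eq_bigr => k _; rewrite h.
Qed.

(** Rows of the generator sum to zero, so only increments of [f] survive and the diagonal of [q]
    drops out. *)
Lemma sum_generator q x f :
  \sum_y generator q x y * f y = \sum_y q x y * (f y - f x).
Proof.
rewrite (bigD1 x) //= [RHS](bigD1 x) //= subrr mulr0 add0r {1}/generator eqxx.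
rewrite mulNr mulr_suml addrC -sumrB.
by apply: eq_bigr => y yx; rewrite /generator eq_sym (negbTE yx) mulrBr.
Qed.

(* Uniformization: [Q + c I] has nonnegative entries for [c] large *)
Lemma ctmc_kernel_ge0 q t x y : (forall x y, 0 <= q x y) -> 0 <= t ->
  0 <= ctmc_kernel q t x y.
Proof.
move=> q0 t0; rewrite ctmc_kernelE.
pose c := \sum_a \sum_b q a b.
pose B a b := generator q a b + c * (a == b)%:R.
have B0 a b : 0 <= B a b.
  rewrite /B /generator; have [_|_] := eqVneq a b; last by rewrite mulr0 addr0.
  rewrite mulr1 addrC subr_ge0 /c [leRHS](bigD1 a) //= [X in _ <= X + _](bigD1 a) //=.
  have : 0 <= \sum_(i | i != a) \sum_b q i b.
    by apply: sumr_ge0 => i _; apply: sumr_ge0.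
  have := q0 a a; lra.
(* Multiples of the identity commute with everything, so exp(tQ) = exp(-ct) exp(tB); this is checked
   through the backward equation. *)
pose w u a := expR (- c * u) * mexp B u a y.
have hw u a : is_derive u (1 : R) (fun s => w s a) (\sum_z generator q a z * w u z).
  have h1 : is_derive u (1 : R) (fun s => - c * s) (- c).
    by apply: is_derive_eq (is_derive_mull (- c) (is_derive_var u)) _; rewrite mulr1.
  apply: is_derive_eq (is_derive_mul (is_derive_comp h1 (is_derive_expR _)) (mexp_deriveE_l B a y u)) _.
  have -> : \sum_z B a z * mexp B u z y =
     \sum_z generator q a z * mexp B u z y + c * mexp B u a y.
    rewrite -[in RHS](sum_delta_l a (fun z => mexp B u z y)) mulr_sumr -big_split /=.
    by apply: eq_bigr => z _; rewrite /B; ring.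
  rewrite /w; under [RHS]eq_bigr => z _ do rewrite mulrCA.
  by rewrite -mulr_sumr; ring.
have -> : mexp (generator q) t x y = w t x.
  rewrite (backward_unique hw) /w.
  under eq_bigr => z _ do rewrite mulr0 expR0 mul1r mexp0.
  by rewrite sum_delta_r.
by rewrite mulr_ge0 ?expR_ge0 ?mexp_ge0.
Qed.

Lemma ctmc_kernel_sum1 q t x : \sum_y ctmc_kernel q t x y = 1.
Proof.
have hw (u : R) (z : S) : is_derive u (1 : R) (fun=> 1 : R)
    (\sum_y generator q z y * 1).
  apply: is_derive_eq (is_derive_const 1 u) _.
  by rewrite (sum_generator q z (fun=> 1)) big1 // => y _; rewrite subrr mulr0.
rewrite ctmc_kernelE; have := backward_unique (w := fun _ _ => 1) hw t x.
by under [in RHS]eq_bigr => y _ do rewrite mulr1.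
Qed.

End Kernel.

(** * The coalescing flow on self-maps *)

Section Flow.
Variables (R : realType) (N : nat) (r : 'I_N -> 'I_N -> R).
Local Notation V := 'I_N.
Local Notation M := {ffun 'I_N -> 'I_N}.
Implicit Types (f g h : M) (F G : M -> R) (a b x y z : V).

Definition fmove a b : M := [ffun z => if z == a then b else z].
Definition fcomp f g : M := [ffun z => f (g z)].
Definition fid : M := [ffun z => z].

(* The coalescing flow: a map [f] sends each starting site to the site occupied
   by its particle; at rate [r a b] everything located at [a] moves to [b].
   Post-composition describes the coalescing walks, pre-composition (the dual)
   the voter model. *)
Definition flow_rates f g : R := \sum_a \sum_b r a b * (g == fcomp (fmove a b) f)%:R.

Definition FE (t : R) F : R := \sum_g ctmc_kernel flow_rates t fid g * F g.

Lemma fcompA f g h : fcomp f (fcomp g h) = fcomp (fcomp f g) h.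
Proof. by apply/ffunP => z; rewrite !ffunE. Qed.

Lemma fcompf1 f : fcomp f fid = f.
Proof. by apply/ffunP => z; rewrite !ffunE. Qed.

Lemma fcomp1f f : fcomp fid f = f.
Proof. by apply/ffunP => z; rewrite !ffunE. Qed.

Lemma sum_flow_rates f F :
  \sum_g flow_rates f g * (F g - F f) =
  \sum_a \sum_b r a b * (F (fcomp (fmove a b) f) - F f).
Proof.
rewrite /flow_rates; under eq_bigr => g _ do rewrite mulr_suml.
rewrite exchange_big /=; apply: eq_bigr => a _.
under eq_bigr => g _ do rewrite mulr_suml.
rewrite exchange_big /=; apply: eq_bigr => b _.
rewrite (bigD1 (fcomp (fmove a b) f)) //= eqxx mulr1 big1 ?addr0 // => g.
by move=> /negbTE ->; rewrite mulr0 mul0r.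
Qed.

Local Notation K := (ctmc_kernel flow_rates).

Lemma FE_derive_l t F :
  is_derive t (1 : R) (fun u => FE u F)
    (FE t (fun f => \sum_a \sum_b r a b * (F (fcomp (fmove a b) f) - F f))).
Proof.
rewrite /FE ctmc_kernelE.
apply: is_derive_eq (is_derive_bigsum _ _ (fun g => is_derive_mulr (F g)
  (mexp_deriveE_r (generator flow_rates) fid g t))) _.
under eq_bigr => g _ do rewrite mulr_suml.
rewrite exchange_big /=; apply: eq_bigr => f _.
by rewrite -sum_flow_rates -sum_generator mulr_sumr; apply: eq_bigr => g _; rewrite mulrA.
Qed.

(** The rates act by post-composition only, hence commute with pre-composition by a fixed [f]: the
    flow started from [f] is the flow started from the identity, composed with [f]. *)
Lemma flow_kernel_from f t F :
  \sum_g K t f g * F g = FE t (fun g => F (fcomp g f)).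
Proof.
pose v (u : R) h := \sum_g K u (fcomp h f) g * F g.
have hv u h : is_derive u (1 : R) (fun s => v s h)
    (\sum_(k : M) generator flow_rates h k * v u k).
  rewrite /v ctmc_kernelE.
  apply: is_derive_eq (is_derive_bigsum _ _ (fun g => is_derive_mulr (F g)
    (mexp_deriveE_l (generator flow_rates) (fcomp h f) g u))) _.
  under eq_bigr => g _ do rewrite mulr_suml.
  rewrite exchange_big /=.
  pose W (k : M) := \sum_g mexp (generator flow_rates) u k g * F g.
  transitivity (\sum_k generator flow_rates (fcomp h f) k * W k).
    by apply: eq_bigr => k _; rewrite mulr_sumr; apply: eq_bigr => g _; rewrite mulrA.
  rewrite sum_generator sum_flow_rates.
  rewrite (sum_generator flow_rates h (fun k => W (fcomp k f))).
  rewrite (sum_flow_rates h (fun k => W (fcomp k f))).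
  by under eq_bigr => a _ do under eq_bigr => b _ do rewrite fcompA.
have := backward_unique hv t fid; rewrite /v fcomp1f => ->.
rewrite /FE ctmc_kernelE; apply: eq_bigr => g _; congr (_ * _).
under eq_bigr => h _ do rewrite mexp0.
by rewrite sum_delta_l.
Qed.

(** The backward equation: conditioning on the first move places [fmove a b] innermost. *)
Lemma FE_derive_r t F :
  is_derive t (1 : R) (fun u => FE u F)
    (\sum_a \sum_b r a b * (FE t (fun f => F (fcomp f (fmove a b))) - FE t F)).
Proof.
pose W (k : M) := \sum_g K t k g * F g.
have <- : \sum_(k : M) generator flow_rates fid k * W k =
   \sum_a \sum_b r a b * (FE t (fun f => F (fcomp f (fmove a b))) - FE t F).
  rewrite sum_generator sum_flow_rates; apply: eq_bigr => a _; apply: eq_bigr => b _.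
  by rewrite /W flow_kernel_from fcompf1.
rewrite /W /FE ctmc_kernelE.
apply: is_derive_eq (is_derive_bigsum _ _ (fun g => is_derive_mulr (F g)
  (mexp_deriveE_l (generator flow_rates) fid g t))) _.
under eq_bigr => g _ do rewrite mulr_suml.
rewrite exchange_big /=; apply: eq_bigr => f _.
by rewrite mulr_sumr; apply: eq_bigr => g _; rewrite mulrA.
Qed.

Lemma FE_0 F : FE 0 F = F fid.
Proof.
rewrite /FE ctmc_kernelE; under eq_bigr => g _ do rewrite mexp0.
by rewrite sum_delta_l.
Qed.

Lemma FE_comp s t F : FE (s + t) F = FE s (fun f => FE t (fun g => F (fcomp g f))).
Proof.
rewrite {1 2}/FE ctmc_kernelE.
under eq_bigr => g _ do rewrite mexpD mulr_suml.
rewrite exchange_big /=; apply: eq_bigr => f _.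
by rewrite -flow_kernel_from ctmc_kernelE mulr_sumr; apply: eq_bigr => g _; rewrite mulrA.
Qed.

Lemma eq_FE t F G : F =1 G -> FE t F = FE t G.
Proof. by move=> h; apply: eq_bigr => g _; rewrite h. Qed.

Lemma FE_add t F G : FE t (fun f => F f + G f) = FE t F + FE t G.
Proof. by rewrite /FE -big_split; apply: eq_bigr => g _; rewrite mulrDr. Qed.

Lemma FE_sub t F G : FE t (fun f => F f - G f) = FE t F - FE t G.
Proof. by rewrite /FE -sumrB; apply: eq_bigr => g _; rewrite mulrBr. Qed.

Lemma FE_mull t c F : FE t (fun f => c * F f) = c * FE t F.
Proof. by rewrite /FE mulr_sumr; apply: eq_bigr => g _; rewrite mulrCA. Qed.

Lemma FE_mulr t c F : FE t (fun f => F f * c) = FE t F * c.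
Proof. by rewrite /FE mulr_suml; apply: eq_bigr => g _; rewrite mulrA. Qed.

Lemma FE_opp t F : FE t (fun f => - F f) = - FE t F.
Proof. by rewrite /FE -sumrN; apply: eq_bigr => g _; rewrite mulrN. Qed.

Lemma FE_sum (I : Type) (s : seq I) (P : pred I) t (F : I -> M -> R) :
  FE t (fun f => \sum_(i <- s | P i) F i f) = \sum_(i <- s | P i) FE t (F i).
Proof. by rewrite /FE exchange_big; apply: eq_bigr => g _; rewrite mulr_sumr. Qed.

Lemma FE_cst t (c : R) : FE t (fun=> c) = c.
Proof. by rewrite /FE -mulr_suml ctmc_kernel_sum1 mul1r. Qed.

(** Fubini for two independent flows. Combined with [FE_comp] it lets the last stretch of time be
    averaged first, which is how a cluster is compared with an earlier one. *)
Lemma FE_exchange s t (F : M -> M -> R) :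
  FE s (fun f => FE t (F f)) = FE t (fun g => FE s (F^~ g)).
Proof.
rewrite /FE; under eq_bigr => f _ do rewrite mulr_sumr.
under [RHS]eq_bigr => f _ do rewrite mulr_sumr.
rewrite exchange_big /=; apply: eq_bigr => f _; apply: eq_bigr => g _.
by rewrite mulrCA.
Qed.

(** Both sides are the time derivative of [FE t F], by the forward and the backward equation. A
    drift of the walks is thus exchanged for a drift of the voter clusters. *)
Lemma FE_gen_lr t F :
  FE t (fun f => \sum_a \sum_b r a b * (F (fcomp (fmove a b) f) - F f)) =
  FE t (fun f => \sum_a \sum_b r a b * (F (fcomp f (fmove a b)) - F f)).
Proof.
transitivity (\sum_a \sum_b r a b * (FE t (fun f => F (fcomp f (fmove a b))) - FE t F)).
  rewrite -(@derive_val _ _ _ _ _ _ _ (FE_derive_l t F)).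
  by rewrite (@derive_val _ _ _ _ _ _ _ (FE_derive_r t F)).
rewrite FE_sum; apply: eq_bigr => a _; rewrite FE_sum; apply: eq_bigr => b _.
by rewrite FE_mull FE_sub.
Qed.

Lemma FE_derive_time t (F : R -> M -> R) (dF : M -> R) :
  (forall f, is_derive t (1 : R) (fun u => F u f) (dF f)) ->
  is_derive t (1 : R) (fun u => FE u (F u))
    (FE t (fun f => \sum_a \sum_b r a b * (F t (fcomp (fmove a b) f) - F t f)) + FE t dF).
Proof.
move=> hF; rewrite /FE ctmc_kernelE.
apply: is_derive_eq (is_derive_bigsum _ _ (fun g => is_derive_mul
  (mexp_deriveE_r (generator flow_rates) fid g t) (hF g))) _.
rewrite big_split /=; congr (_ + _).
under eq_bigr => g _ do rewrite mulr_suml.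
rewrite exchange_big /=; apply: eq_bigr => f _.
by rewrite -sum_flow_rates -sum_generator mulr_sumr; apply: eq_bigr => g _; rewrite mulrA.
Qed.

(** The last hypothesis says that the expectation of [F (act f x)] solves the backward equation of
    [q]; so any chain on which the flow acts compatibly has the law of the image of the flow. *)
Lemma push_flow (S : finType) (q : S -> S -> R) (act : M -> S -> S) (F : S -> R) :
  (forall x : S, act fid x = x) ->
  (forall f g (x : S), act (fcomp f g) x = act f (act g x)) ->
  (forall t (x : S), \sum_a \sum_b r a b *
       (FE t (fun f => F (act f (act (fmove a b) x))) - FE t (fun f => F (act f x))) =
     \sum_(y : S) q x y * (FE t (fun f => F (act f y)) - FE t (fun f => F (act f x)))) ->
  forall t (x : S), \sum_(y : S) ctmc_kernel q t x y * F y = FE t (fun f => F (act f x)).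
Proof.
move=> act1 actM hq t x.
pose w (u : R) (y : S) := FE u (fun f => F (act f y)).
have hw (u : R) (y : S) : is_derive u (1 : R) (fun s => w s y) (\sum_(z : S) generator q y z * w u z).
  rewrite sum_generator -hq.
  apply: is_derive_eq (FE_derive_r u _) _.
  apply: eq_bigr => a _; apply: eq_bigr => b _; congr (_ * (_ - _)).
  by apply: eq_FE => f; rewrite actM.
rewrite -/(w t x) (backward_unique hw) ctmc_kernelE.
by apply: eq_bigr => y _; rewrite /w FE_0 act1.
Qed.

Lemma one_point_gen (G : V -> R) x :
  \sum_a \sum_b r a b * (G (fmove a b x) - G x) = \sum_b r x b * (G b - G x).
Proof.
rewrite (bigD1 x) //= [X in _ + X]big1 ?addr0 => [|a ax].
  by apply: eq_bigr => b _; rewrite ffunE eqxx.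
by apply: big1 => b _; rewrite ffunE eq_sym (negbTE ax) subrr mulr0.
Qed.

Lemma two_point_gen (G : V -> V -> R) x y : x != y ->
  \sum_a \sum_b r a b * (G (fmove a b x) (fmove a b y) - G x y) =
  \sum_b r x b * (G b y - G x y) + \sum_b r y b * (G x b - G x y).
Proof.
move=> xy; rewrite (bigD1 x) //= [X in _ + X = _](bigD1 y) 1?eq_sym //= addrA.
rewrite [X in _ + X]big1 ?addr0 => [|a /andP[ax ay]].
  congr (_ + _); apply: eq_bigr => b _; rewrite !ffunE eqxx.
    by rewrite eq_sym (negbTE xy).
  by rewrite (negbTE xy).
apply: big1 => b _.
by rewrite !ffunE eq_sym (negbTE ax) eq_sym (negbTE ay) subrr mulr0.
Qed.

Lemma diag_gen (G : V -> V -> R) x : (forall z, G z z = G x x) ->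
  \sum_a \sum_b r a b * (G (fmove a b x) (fmove a b x) - G x x) = 0.
Proof.
by move=> hG; rewrite big1 // => a _; rewrite big1 // => b _; rewrite hG subrr mulr0.
Qed.

Lemma p_tE t x y : p_t r t x y = FE t (fun f => (f x == y)%:R).
Proof.
have := @push_flow V r (fun f x => f x) (fun z => (z == y)%:R).
move=> /(_ _ _ _ t x) <-; first by rewrite sum_delta_r.
- by move=> z; rewrite ffunE.
- by move=> f g z; rewrite ffunE.
- move=> u z.
  by rewrite (one_point_gen (fun z => FE u (fun f => (f z == y)%:R))).
Qed.

(** The pair chain freezes on the diagonal while the flow keeps moving a merged pair. The observable
    vanishes on the diagonal, so both lead to the same backward equation. *)
Lemma P_meet_gtE t x y : P_meet_gt r t x y = FE t (fun f => (f x != f y)%:R).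
Proof.
have := @push_flow (V * V)%type (pair_rates r) (fun f u => (f u.1, f u.2))
  (fun u => (u.1 != u.2)%:R).
move=> /(_ _ _ _ t (x, y)) <-.
- rewrite /P_meet_gt big_mkcond /=; apply: eq_bigr => v _.
  by case: (v.1 != v.2); rewrite ?mulr1 ?mulr0.
- by case=> *; rewrite /= !ffunE.
- by move=> f g [u v] /=; rewrite !ffunE.
- move=> u [z w] /=; pose G a b := FE u (fun f => (f a != f b)%:R).
  rewrite -/(G z w).
  rewrite [LHS](_ : _ = \sum_a \sum_b r a b * (G (fmove a b z) (fmove a b w) - G z w)) //.
  have Gd a : G a a = 0 by rewrite /G (eq_FE _ (G := fun=> 0)) ?FE_cst // => f; rewrite eqxx.
  have [<-|zw] := eqVneq z w.
    rewrite diag_gen; last by move=> a; rewrite !Gd.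
    by rewrite big1 // => v _; rewrite /pair_rates /= eqxx mul0r.
  rewrite two_point_gen // -(pair_bigA _ (fun a b => pair_rates r (z, w) (a, b) * (G a b - G z w))) /=.
  rewrite /pair_rates /= (negbTE zw).
  transitivity (\sum_a \sum_b ((if w == b then r z a else 0) * (G a b - G z w) +
      (if z == a then r w b else 0) * (G a b - G z w))); last first.
    by apply: eq_bigr => a _; apply: eq_bigr => b _; rewrite mulrDl.
  under [RHS]eq_bigr => a _ do rewrite big_split /=.
  rewrite big_split /=; congr (_ + _).
    apply: eq_bigr => a _; rewrite (bigD1 w) //= eqxx big1 ?addr0 // => b bw.
    by rewrite eq_sym (negbTE bw) mul0r.
  rewrite [RHS](bigD1 z) //= eqxx [X in _ = _ + X]big1 ?addr0 // => a az.
  by apply: big1 => b _; rewrite eq_sym (negbTE az) mul0r.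
Qed.

Lemma fmove_imset a b (A : {set V}) :
  fmove a b @: A = if a \in A then b |: (A :\ a) else A.
Proof.
apply/setP => z; apply/imsetP/idP => [[w wA ->]|].
  rewrite ffunE; case: (eqVneq w a) => [<-|wa]; first by rewrite wA setU11.
  by case: ifP => _ //; rewrite !inE wa wA orbT.
case: ifPn => aA.
  rewrite !inE => /orP[/eqP ->|/andP[za zA]]; first by exists a; rewrite // ffunE eqxx.
  by exists z; rewrite // ffunE (negbTE za).
by move=> zA; exists z; rewrite // ffunE; case: eqP aA => // <-; rewrite zA.
Qed.

Definition Img f : {set V} := f @: [set: V]%SET.

Lemma mem_Img f v : f v \in Img f.
Proof. by apply/imsetP; exists v. Qed.

Lemma P_occE t x : P_occ r t x = FE t (fun f => (x \in Img f)%:R).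
Proof.
have := @push_flow {set V} (coal_rates r) (fun f A => f @: A)
  (fun A => (x \in A)%:R).
move=> /(_ _ _ _ t [set: V]%SET) <-.
- rewrite /P_occ big_mkcond /=; apply: eq_bigr => A _.
  by case: (x \in A); rewrite ?mulr1 ?mulr0.
- by move=> A; rewrite -[RHS]imset_id; apply: eq_imset => z; rewrite ffunE.
- by move=> f g A; rewrite -imset_comp; apply: eq_imset => z; rewrite ffunE.
- move=> u A; pose G (A : {set V}) := FE u (fun f => (x \in f @: A)%:R : R).
  rewrite -/(G A).
  rewrite [LHS](_ : _ = \sum_a \sum_b r a b * (G (fmove a b @: A) - G A)) //.
  rewrite [RHS](_ : _ = \sum_B coal_rates r A B * (G B - G A)) //.
  under eq_bigr => a _ do under eq_bigr => b _ do rewrite fmove_imset.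
  under [RHS]eq_bigr => B _ do rewrite mulr_suml.
  rewrite [RHS]exchange_big /= [RHS]big_mkcond; apply: eq_bigr => a _.
  case: ifPn => aA; last by rewrite big1 // => b _; rewrite subrr mulr0.
  under [RHS]eq_bigr => B _ do rewrite mulr_suml.
  rewrite [RHS]exchange_big /=; apply: eq_bigr => b _.
  rewrite [RHS](bigD1 (b |: A :\ a)) //= eqxx [X in _ = _ + X]big1 ?addr0 // => B.
  by move=> /negbTE ->; rewrite mul0r.
Qed.

Hypothesis r_ge0 : forall x y, 0 <= r x y.

Lemma flow_rates_ge0 f g : 0 <= flow_rates f g.
Proof. by apply: sumr_ge0 => a _; apply: sumr_ge0 => b _; rewrite mulr_ge0. Qed.

Lemma FE_le t F G : 0 <= t -> (forall f, F f <= G f) -> FE t F <= FE t G.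
Proof.
move=> t0 h; apply: ler_sum => g _; apply: ler_wpM2l => //.
by apply: ctmc_kernel_ge0 => // *; exact: flow_rates_ge0.
Qed.

Lemma FE_ge0 t F : 0 <= t -> (forall f, 0 <= F f) -> 0 <= FE t F.
Proof. by move=> t0 h; rewrite -(FE_cst t 0); exact: FE_le. Qed.

Lemma FE_norm t F : 0 <= t -> `|FE t F| <= FE t (fun f => `|F f|).
Proof.
move=> t0; rewrite ler_norml -FE_opp.
by rewrite !FE_le // => f; rewrite ?ler_norm // lerNl ler_normr lexx orbT.
Qed.

End Flow.

(** * Symmetry, heat kernel and Dirichlet form of a transitive chain *)

Section TransitiveChain.
Variables (R : realType) (N : nat) (r : 'I_N -> 'I_N -> R).
Hypothesis hsym : symmetric_rates r.
Hypothesis htrans : transitive_chain r.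
Hypothesis hirr : irreducible r.
Local Notation V := 'I_N.
Local Notation M := {ffun 'I_N -> 'I_N}.
Local Notation E := (FE r).
Local Notation p := (p_t r).
Implicit Types (f g h : M) (a b x y z o : V) (s t : R).

Lemma rates_ge0 x y : 0 <= r x y. Proof. exact: hsym.1. Qed.
Lemma ratesC x y : r x y = r y x. Proof. exact: hsym.2. Qed.
Lemma sum_rates x : \sum_y r x y = 1. Proof. exact: htrans.2. Qed.

Lemma card_pos o : 0 < N%:R :> R.
Proof. by rewrite ltr0n (leq_ltn_trans _ (ltn_ord o)). Qed.

Definition automorphism (phi : {perm V}) := forall x y, r (phi x) (phi y) = r x y.

Definition fconj (phi : {perm V}) f : M := [ffun z => phi (f (phi^-1%g z))].

Lemma fconj_fid phi : fconj phi (fid N) = fid N.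
Proof. by apply/ffunP => z; rewrite !ffunE permKV. Qed.

Lemma fconj_fmove phi f a b :
  fconj phi (fcomp f (fmove a b)) = fcomp (fconj phi f) (fmove (phi a) (phi b)).
Proof.
apply/ffunP => z; rewrite !ffunE; case: (eqVneq z (phi a)) => [->|za].
  by rewrite permK eqxx permK.
case: eqP => // zE; case/eqP: za; rewrite -zE permKV //.
Qed.

(** The flow has the same law after conjugation by an automorphism, since relabelling [a] and [b]
    preserves the rates; again an instance of [backward_unique]. *)
Lemma FE_fconj phi t (F : M -> R) : automorphism phi ->
  E t F = E t (fun f => F (fconj phi f)).
Proof.
move=> hphi.
pose w u k := E u (fun f => F (fcomp (fconj phi f) k)).
have hw u k : is_derive u (1 : R) (fun s => w s k)
    (\sum_(l : M) generator (flow_rates r) k l * w u l).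
  rewrite sum_generator sum_flow_rates.
  apply: is_derive_eq (FE_derive_r r u _) _.
  under eq_bigr => a _ do under eq_bigr => b _ do rewrite -hphi.
  rewrite (reindex_inj (@perm_inj _ phi^-1%g)) /=; apply: eq_bigr => a _.
  rewrite (reindex_inj (@perm_inj _ phi^-1%g)) /=; apply: eq_bigr => b _.
  rewrite !permKV; congr (_ * (_ - _)); apply: eq_FE => f.
  by rewrite fconj_fmove !permKV fcompA.
have := backward_unique hw t (fid N); rewrite /w.
under eq_FE => f do rewrite fcompf1.
move=> ->; rewrite [LHS]/FE ctmc_kernelE; apply: eq_bigr => k _; congr (_ * _).
by rewrite FE_0 fconj_fid fcomp1f.
Qed.

Lemma transitive_invariant (F : V -> R) :
  (forall phi x, automorphism phi -> F (phi x) = F x) -> forall x y, F x = F y.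
Proof. by move=> hF x y; have [phi [<- hphi]] := htrans.1 x y; rewrite hF. Qed.

Lemma FE_invariant (F : V -> M -> R) t :
  (forall phi x f, automorphism phi -> F (phi x) (fconj phi f) = F x f) ->
  forall x y, E t (F x) = E t (F y).
Proof.
move=> hF; apply: transitive_invariant => phi x hphi.
by rewrite (FE_fconj _ _ hphi); apply: eq_FE => f; exact: hF.
Qed.

Lemma sum_cst (c : R) : \sum_(x : V) c = N%:R * c.
Proof. by rewrite sumr_const cardT /= size_enum_ord mulr_natl. Qed.

Lemma sum_const (F : V -> R) o : (forall x y, F x = F y) -> \sum_x F x = N%:R * F o.
Proof.
move=> hF; under eq_bigr => x _ do rewrite (hF x o).
by rewrite sumr_const cardT /= size_enum_ord mulr_natl.
Qed.

Lemma p_sym t x y : p t x y = p t y x.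
Proof.
rewrite /p_t ctmc_kernelE; apply: mexp_sym => a b.
rewrite /generator eq_sym; case: eqVneq => [->|_] //; exact: ratesC.
Qed.

Lemma p_ge0 t x y : 0 <= t -> 0 <= p t x y.
Proof. by move=> t0; exact: ctmc_kernel_ge0 rates_ge0 t0. Qed.

Lemma p_sum t x : \sum_y p t x y = 1.
Proof. exact: ctmc_kernel_sum1. Qed.

Lemma p_0 x y : p 0 x y = (x == y)%:R.
Proof. by rewrite /p_t ctmc_kernelE mexp0. Qed.

Lemma p_add s t x y : p (s + t) x y = \sum_z p s x z * p t z y.
Proof. by rewrite /p_t ctmc_kernelE mexpD. Qed.

Lemma p_diag t x y : p t x x = p t y y.
Proof.
rewrite !p_tE.
apply: (@FE_invariant (fun x f => (f x == x)%:R)) => phi z f _.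
by rewrite !ffunE permK (inj_eq perm_inj).
Qed.

Lemma FE_eval t (F : V -> R) x : E t (fun f => F (f x)) = \sum_y p t x y * F y.
Proof.
under [RHS]eq_bigr => y _ do rewrite p_tE -FE_mulr.
rewrite -FE_sum; apply: eq_FE => f; by rewrite sum_delta_l.
Qed.

(** Splitting time in half writes p_t(x,y) as the inner product of two rows of p_(t/2), whose
    squared norms are the equal diagonal entries; then 2ab <= a^2 + b^2. *)
Lemma p_le_diag t x y z : p t x y <= p t z z.
Proof.
have -> : t = t / 2 + t / 2 by lra.
have h : forall a, p (t / 2 + t / 2) a a = \sum_b p (t / 2) a b ^+ 2.
  by move=> a; rewrite p_add; apply: eq_bigr => b _; rewrite expr2 [p _ b a]p_sym.
have hx := h x; have hy := h y.
rewrite (p_diag _ y x) (p_diag _ x z) in hy; rewrite (p_diag _ x z) in hx.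
have : 2 * p (t / 2 + t / 2) x y <= \sum_b p (t / 2) x b ^+ 2 + \sum_b p (t / 2) y b ^+ 2.
  rewrite p_add mulr_sumr -big_split /=; apply: ler_sum => b _.
  rewrite [p _ b y]p_sym; have := sqr_ge0 (p (t / 2) x b - p (t / 2) y b); lra.
rewrite -hx -hy; lra.
Qed.

Lemma p_derive t x y :
  is_derive t (1 : R) (fun u => p u x y) (\sum_b r x b * (p t b y - p t x y)).
Proof.
rewrite -(sum_generator r x (fun b => p t b y)) /p_t ctmc_kernelE.
exact: mexp_deriveE_l.
Qed.

Lemma p_diag_decr s t x : s <= t -> p t x x <= p s x x.
Proof.
move=> st; rewrite -subr_le0.
rewrite -[leRHS](mul0r (t - s)).
apply: (ler_increment st (fun u => p_derive u x x)) => u _.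
apply: sumr_le0 => b _; rewrite mulr_ge0_le0 ?rates_ge0 // subr_le0.
exact: p_le_diag.
Qed.

Lemma p_diag_ge t x : N%:R^-1 <= p t x x.
Proof.
have N0 := card_pos x; rewrite -[N%:R^-1]mul1r ler_pdivrMr // -[leLHS](p_sum t x).
apply: le_trans (_ : \sum_(y : V) p t x x <= _).
  by apply: ler_sum => y _; exact: p_le_diag.
by rewrite sum_cst mulrC.
Qed.

(** Average the left side with its copy after swapping [x] and [y], which the symmetry of the rates
    permits. *)
Lemma dirichlet (u v : V -> R) :
  \sum_x u x * \sum_y r x y * (v x - v y) =
  2^-1 * \sum_x \sum_y r x y * ((u x - u y) * (v x - v y)).
Proof.
have h : \sum_x u x * \sum_y r x y * (v x - v y) =
         \sum_x \sum_y r x y * (u x * (v x - v y)).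
  by apply: eq_bigr => x _; rewrite mulr_sumr; apply: eq_bigr => y _; rewrite mulrCA.
have h' : \sum_x u x * \sum_y r x y * (v x - v y) =
         - \sum_x \sum_y r x y * (u y * (v x - v y)).
  rewrite h exchange_big /= -sumrN; apply: eq_bigr => x _.
  rewrite -sumrN; apply: eq_bigr => y _; rewrite ratesC; ring.
have h2 : \sum_x \sum_y r x y * ((u x - u y) * (v x - v y)) =
   \sum_x \sum_y r x y * (u x * (v x - v y)) - \sum_x \sum_y r x y * (u y * (v x - v y)).
  rewrite -sumrB; apply: eq_bigr => x _; rewrite -sumrB; apply: eq_bigr => y _; ring.
rewrite h2; lra.
Qed.

Lemma dirichlet_eq0 (u : V -> R) :
  \sum_x \sum_y r x y * (u x - u y) ^+ 2 = 0 -> forall x y, u x = u y.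
Proof.
move=> /eqP h x y.
have step a b : 0 < r a b -> u a = u b.
  move=> rab; move: h.
  rewrite psumr_eq0 => [/allP/(_ a)|c _]; last first.
    by apply: sumr_ge0 => d _; rewrite mulr_ge0 ?sqr_ge0 ?rates_ge0.
  rewrite mem_index_enum => /(_ isT); rewrite implyTb.
  rewrite psumr_eq0 => [/allP/(_ b)|d _]; last by rewrite mulr_ge0 ?sqr_ge0 ?rates_ge0.
  rewrite mem_index_enum => /(_ isT); rewrite implyTb.
  by rewrite mulf_eq0 gt_eqF //= sqrf_eq0 subr_eq0 => /eqP.
have /connectP[q + ->] := hirr x y.
by elim: q x => //= a q IH x /andP[/step -> /IH].
Qed.

Lemma harmonic_eq0 (u : V -> R) :
  (forall x, \sum_y r x y * (u x - u y) = 0) -> \sum_x u x = 0 ->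
  forall x, u x = 0.
Proof.
move=> hu su x.
have uc : forall x y, u x = u y.
  apply: dirichlet_eq0.
  have := dirichlet u u; under eq_bigr => z _ do rewrite hu mulr0.
  rewrite big1 // => h.
  under eq_bigr => z _ do under eq_bigr => w _ do rewrite expr2.
  lra.
move: su; rewrite (sum_const x uc) => /eqP.
by rewrite mulf_eq0 gt_eqF ?(card_pos x) //= => /eqP.
Qed.

(* [Z] is the integral over time of [p_t - 1/N]. *)
Definition fundamental (Z : V -> V -> R) :=
  [/\ forall x z, \sum_y r x y * (Z y z - Z x z) = N%:R^-1 - (x == z)%:R,
      forall x y, Z x y = Z y x &
      forall y, \sum_x Z x y = 0].

(** The Laplacian is singular on constants. Adding 1/N to every entry gives constants the eigenvalue
    1 and changes nothing on mean-zero vectors, so the result is invertible; subtracting 1/N from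
    its inverse gives [Z]. *)
Lemma fundamental_exists : exists Z, fundamental Z.
Proof.
have [N0|Npos] := posnP N.
  by exists (fun _ _ => 0); split => [x||x] //; have := ltn_ord x; rewrite {2}N0.
have Npos' : 0 < N%:R :> R by rewrite ltr0n.
pose A : 'M[R]_N := \matrix_(i, j) ((i == j)%:R - r i j + N%:R^-1).
have mulA (u : 'rV[R]_N) j :
    (u *m A) 0 j = \sum_i r j i * (u 0 j - u 0 i) + N%:R^-1 * \sum_i u 0 i.
  rewrite !mxE mulr_sumr.
  transitivity (\sum_i (u 0 i * (i == j)%:R - u 0 i * r i j + N%:R^-1 * u 0 i)).
    by apply: eq_bigr => i _; rewrite mxE; ring.
  rewrite big_split /= sumrB sum_delta_r; congr (_ + _).
  under [RHS]eq_bigr => i _ do rewrite mulrBr.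
  rewrite sumrB -mulr_suml sum_rates mul1r; congr (_ - _).
  by apply: eq_bigr => i _; rewrite ratesC mulrC.
have AT : A^T = A by apply/matrixP => i j; rewrite !mxE eq_sym ratesC.
have Au : A \in unitmx.
  rewrite -row_free_unit; apply/inj_row_free => u /rowP uA.
  have uAj j : \sum_i r j i * (u 0 j - u 0 i) + N%:R^-1 * \sum_i u 0 i = 0.
    by rewrite -mulA uA mxE.
  have su : \sum_i u 0 i = 0.
    have : \sum_(j : V) (\sum_i r j i * (u 0 j - u 0 i) + N%:R^-1 * \sum_i u 0 i) = 0.
      by apply: big1 => j _; exact: uAj.
    rewrite big_split /= sum_cst mulrA mulfV ?gt_eqF //.
    rewrite mul1r; under eq_bigr => j _ do rewrite -[\sum_i r j i * _]mul1r.
    rewrite (dirichlet (fun=> 1) (fun i => u 0 i)) big1 ?mulr0 ?add0r // => i _.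
    by apply: big1 => k _; rewrite subrr mul0r mulr0.
  apply/rowP => j; rewrite [RHS]mxE; apply: (@harmonic_eq0 (fun i => u 0 i)) => // i.
  by have := uAj i; rewrite su mulr0 addr0.
pose B := invmx A.
have BT : B^T = B by rewrite /B trmx_inv AT.
have BA (x z : V) : \sum_i r z i * (B x z - B x i) + N%:R^-1 * \sum_i B x i = (x == z)%:R.
  have : (B *m A) x z = (x == z)%:R by rewrite mulVmx // mxE.
  have -> : (B *m A) x z = (row x B *m A) 0 z by rewrite -row_mul [RHS]mxE.
  rewrite mulA => <-; congr (_ + _ * _); apply: eq_bigr => i _; rewrite !mxE //.
have sB x : \sum_i B x i = 1.
  have : \sum_z (\sum_i r z i * (B x z - B x i) + N%:R^-1 * \sum_i B x i) = 1.
    under eq_bigr => z _ do rewrite BA -[_%:R]mulr1.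
    by rewrite (sum_delta_l x (fun=> 1)).
  rewrite big_split /= sum_cst mulrA mulfV ?gt_eqF //.
  rewrite mul1r; under eq_bigr => j _ do rewrite -[\sum_i r j i * _]mul1r.
  rewrite (dirichlet (fun=> 1) (fun i => B x i)) big1 ?mulr0 ?add0r // => i _.
  by apply: big1 => k _; rewrite subrr mul0r mulr0.
have Bsym x y : B x y = B y x by rewrite -{1}BT mxE.
exists (fun x y => B x y - N%:R^-1); split => [x z|x y|y].
- have := BA z x; rewrite sB mulr1 eq_sym.
  under [X in _ -> X = _]eq_bigr => y _ do rewrite opprB addrA subrK Bsym [B x z]Bsym -opprB mulrN.
  by rewrite sumrN => <-; ring.
- by rewrite Bsym.
- rewrite sumrB sum_cst mulfV ?gt_eqF //.
  by under eq_bigr => x _ do rewrite Bsym; rewrite sB subrr.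
Qed.

End TransitiveChain.

(** * The fundamental matrix, its tails and the Green function *)

Section Fundamental.
Variables (R : realType) (N : nat) (r : 'I_N -> 'I_N -> R).
Hypothesis hsym : symmetric_rates r.
Hypothesis htrans : transitive_chain r.
Hypothesis hirr : irreducible r.
Variable Z : 'I_N -> 'I_N -> R.
Hypothesis hZ : fundamental r Z.
Local Notation V := 'I_N.
Local Notation M := {ffun 'I_N -> 'I_N}.
Local Notation E := (FE r).
Local Notation p := (p_t r).
Implicit Types (f g h : M) (a b x y z o : V) (s t : R).

Lemma Z_gen x z : \sum_y r x y * (Z y z - Z x z) = N%:R^-1 - (x == z)%:R.
Proof. by case: hZ. Qed.
Lemma Z_sym x y : Z x y = Z y x. Proof. by case: hZ. Qed.
Lemma sum_Z y : \sum_x Z x y = 0. Proof. by case: hZ. Qed.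

Lemma Z_aut phi x y : automorphism r phi -> Z (phi x) (phi y) = Z x y.
Proof.
move=> hphi; apply/eqP; rewrite -subr_eq0; apply/eqP.
pose u z := Z (phi z) (phi y) - Z z y; rewrite -[LHS]/(u x).
apply: (harmonic_eq0 hsym hirr (u := u)).
  move=> z; transitivity (\sum_w r (phi z) w * (Z (phi z) (phi y) - Z w (phi y)) -
                          \sum_w r z w * (Z z y - Z w y)).
    rewrite [X in _ = X - _](reindex_inj (@perm_inj _ phi)) -sumrB.
    by apply: eq_bigr => w _; rewrite hphi /u; ring.
  have hN a c : \sum_w r a w * (Z a c - Z w c) = (a == c)%:R - N%:R^-1.
    rewrite -opprB -Z_gen -sumrN; apply: eq_bigr => w _; ring.
  by rewrite !hN (inj_eq perm_inj) subrr.
rewrite /u sumrB sum_Z subr0 -[RHS](sum_Z (phi y)).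
by rewrite [RHS](reindex_inj (@perm_inj _ phi)).
Qed.

Lemma Z_diag x y : Z x x = Z y y.
Proof.
apply: (transitive_invariant htrans (F := fun x => Z x x)) => phi z hphi.
exact: Z_aut.
Qed.

(** The tail of the integral defining [Z]: the integral over [t, oo) of p_s(x,y) - 1/N. *)
Definition PZ t x y := \sum_z p t x z * Z z y.

Lemma PZE t x y : PZ t x y = E t (fun f => Z (f x) y).
Proof. by rewrite (FE_eval r t (fun z => Z z y)). Qed.

Lemma PZ_0 x y : PZ 0 x y = Z x y.
Proof. by rewrite /PZ; under eq_bigr => z _ do rewrite p_0; rewrite sum_delta_l. Qed.

Lemma PZ_derive t x y : is_derive t (1 : R) (fun s => PZ s x y) (N%:R^-1 - p t x y).
Proof.
under eq_fun do rewrite PZE.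
apply: is_derive_eq (FE_derive_l r t _) _.
under eq_FE => f do under eq_bigr => a _ do under eq_bigr => b _ do rewrite [fcomp _ _ x]ffunE.
under eq_FE => f do rewrite (one_point_gen r (fun z => Z z y)) Z_gen.
by rewrite FE_sub FE_cst p_tE.
Qed.

(** The same time derivative as in [PZ_derive], now with the generator acting on the starting point
    of the smoothed matrix. This form gives the drift of [PZ] along moving walks. *)
Lemma PZ_gen t x y : \sum_b r x b * (PZ t b y - PZ t x y) = N%:R^-1 - p t x y.
Proof.
have h : \sum_b r x b * (PZ t b y - PZ t x y) =
   \sum_z (\sum_b r x b * (p t b z - p t x z)) * Z z y.
  under [RHS]eq_bigr => z _ do rewrite mulr_suml.
  rewrite [RHS]exchange_big /=; apply: eq_bigr => b _.
  by rewrite /PZ -sumrB mulr_sumr; apply: eq_bigr => z _; ring.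
have hd : is_derive t (1 : R) (fun s => PZ s x y) (\sum_b r x b * (PZ t b y - PZ t x y)).
  rewrite h; apply: is_derive_bigsum => z; exact: is_derive_mulr (p_derive r t x z).
by rewrite -(@derive_val _ _ _ _ _ _ _ hd) -(@derive_val _ _ _ _ _ _ _ (PZ_derive t x y)).
Qed.

Lemma gen_self_adjoint (u v : V -> R) :
  \sum_x u x * \sum_y r x y * (v y - v x) = \sum_x v x * \sum_y r x y * (u y - u x).
Proof.
have h (u' v' : V -> R) : \sum_x u' x * \sum_y r x y * (v' y - v' x) =
    - \sum_x u' x * \sum_y r x y * (v' x - v' y).
  rewrite -sumrN; apply: eq_bigr => x _; rewrite -mulrN -sumrN; congr (_ * _).
  by apply: eq_bigr => y _; ring.
rewrite !h !(dirichlet hsym); congr (- (_ * _)).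
by apply: eq_bigr => x _; apply: eq_bigr => y _; ring.
Qed.

Lemma p_sum_l t y : \sum_x p t x y = 1.
Proof. by rewrite -[RHS](p_sum r t y); apply: eq_bigr => x _; rewrite p_sym. Qed.

(** [Z] commutes with the semigroup: by self-adjointness the generator can be moved from [p] onto
    [Z], so the product on the right solves the backward equation with initial value [Z]. *)
Lemma PZ_comm t x y : PZ t x y = \sum_z Z x z * p t z y.
Proof.
pose w s x := \sum_z Z x z * p s z y.
have hw s a : is_derive s (1 : R) (fun u => w u a) (\sum_b generator r a b * w s b).
  rewrite (sum_generator r a (w s)).
  apply: is_derive_eq (is_derive_bigsum _ _ (fun z => is_derive_mull (Z a z) (p_derive r s z y))) _.
  rewrite gen_self_adjoint.
  transitivity (\sum_z (\sum_b r a b * (Z b z - Z a z)) * p s z y).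
    apply: eq_bigr => z _; rewrite mulrC; congr (_ * _).
    under eq_bigr => b _ do rewrite (Z_sym a) (Z_sym a).
    rewrite !Z_gen eq_sym //.
  under [RHS]eq_bigr => b _ do rewrite /w -sumrB mulr_sumr.
  rewrite [RHS]exchange_big /=; apply: eq_bigr => z _.
  by rewrite mulr_suml; apply: eq_bigr => b _; ring.
rewrite -/(w t x) (backward_unique hw) /PZ /p_t ctmc_kernelE.
apply: eq_bigr => z _; congr (_ * _); rewrite /w.
by under eq_bigr => b _ do rewrite p_0; rewrite sum_delta_r.
Qed.

Lemma PZ_sym t x y : PZ t x y = PZ t y x.
Proof.
rewrite PZ_comm; apply: eq_bigr => z _.
by rewrite (p_sym hsym t z) Z_sym mulrC.
Qed.

(** With h = Zu, minus the generator applied to h is u minus its mean, and h sums to zero; hence the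
    form of [Z] at u is the Dirichlet energy of h. In particular [Z] is positive semidefinite. *)
Lemma Z_form_ge0 (u : V -> R) :
  \sum_x u x * \sum_y Z x y * u y =
  2^-1 * \sum_x \sum_y r x y * (\sum_z Z x z * u z - \sum_z Z y z * u z) ^+ 2.
Proof.
pose h x := \sum_z Z x z * u z.
have hgen x : \sum_y r x y * (h x - h y) = u x - N%:R^-1 * \sum_z u z.
  transitivity (- \sum_z (\sum_y r x y * (Z y z - Z x z)) * u z).
    under [in RHS]eq_bigr => z _ do rewrite mulr_suml.
    rewrite [in RHS]exchange_big /= -sumrN; apply: eq_bigr => y _.
    by rewrite /h -sumrB mulr_sumr -sumrN; apply: eq_bigr => z _; ring.
  under eq_bigr => z _ do rewrite Z_gen mulrBl.
  by rewrite sumrB sum_delta_l -mulr_sumr opprB.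
have sh : \sum_x h x = 0.
  rewrite exchange_big /= big1 // => z _; by rewrite -mulr_suml sum_Z mul0r.
have <- : \sum_x h x * \sum_y r x y * (h x - h y) = \sum_x u x * h x.
  under eq_bigr => x _ do rewrite hgen mulrBr.
  rewrite sumrB -mulr_suml sh mul0r subr0.
  by apply: eq_bigr => x _; rewrite mulrC.
by rewrite (dirichlet hsym).
Qed.

Lemma PZ_form t x y :
  PZ t x y = \sum_a p (t / 2) x a * \sum_b Z a b * p (t / 2) y b.
Proof.
have {1}-> : t = t / 2 + t / 2 by lra.
rewrite /PZ; under eq_bigr => z _ do rewrite p_add mulr_suml.
rewrite exchange_big /=; apply: eq_bigr => a _.
under eq_bigr => z _ do rewrite -mulrA.
rewrite -mulr_sumr; congr (_ * _).
rewrite -/(PZ (t / 2) a y) PZ_comm; apply: eq_bigr => b _.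
by rewrite (p_sym hsym _ b).
Qed.

Lemma PZ_diag t x y : PZ t x x = PZ t y y.
Proof.
rewrite !PZE; apply: (FE_invariant htrans (F := fun x f => Z (f x) x)) => phi z f hphi.
by rewrite !ffunE permK Z_aut.
Qed.

Lemma PZ_diag_ge0 t x : 0 <= PZ t x x.
Proof.
rewrite PZ_form Z_form_ge0 mulr_ge0 ?invr_ge0 //.
by do 2 (apply: sumr_ge0 => ? _); rewrite mulr_ge0 ?sqr_ge0 ?(rates_ge0 hsym).
Qed.

(** Cauchy-Schwarz for the positive form [PZ_form]. As the diagonal is constant, testing the vectors
    p(x,.) + c p(y,.) with c = 1 and c = -1 suffices. *)
Lemma PZ_le_diag t x y o : `|PZ t x y| <= PZ t o o.
Proof.
have key c : 0 <= PZ t o o + c ^+ 2 * PZ t o o + c * (2 * PZ t x y).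
  have := Z_form_ge0 (fun a => p (t / 2) x a + c * p (t / 2) y a).
  set S := 2^-1 * _ => hS; have : 0 <= S.
    rewrite mulr_ge0 ?invr_ge0 //.
    by do 2 (apply: sumr_ge0 => ? _); rewrite mulr_ge0 ?sqr_ge0 ?(rates_ge0 hsym).
  rewrite -{}hS => /le_trans; apply; rewrite le_eqVlt; apply/orP; left; apply/eqP.
  have -> : PZ t o o + c ^+ 2 * PZ t o o + c * (2 * PZ t x y) =
    (PZ t x x + c * PZ t x y) + c * (PZ t y x + c * PZ t y y).
    by rewrite (PZ_diag t x o) (PZ_diag t y o) (PZ_sym t y x); ring.
  rewrite !PZ_form.
  transitivity (\sum_a (p (t / 2) x a + c * p (t / 2) y a) *
    (\sum_b Z a b * p (t / 2) x b + c * \sum_b Z a b * p (t / 2) y b)).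
    apply: eq_bigr => a _; congr (_ * _); rewrite mulr_sumr -big_split /=.
    by apply: eq_bigr => b _; ring.
  rewrite !mulr_sumr -!big_split /= mulr_sumr -big_split /=; apply: eq_bigr => a _; ring.
rewrite ler_norml; have := key 1; have := key (-1); lra.
Qed.

(** The derivative 1/N - p_u(x,x) is monotone in u, so the increment lies between the slopes at the
    two ends. *)
Lemma PZ_diag_decr s t x : s <= t ->
  (t - s) * (p t x x - N%:R^-1) <= PZ s x x - PZ t x x <= (t - s) * (p s x x - N%:R^-1).
Proof.
move=> st.
have h1 := ler_increment (c := N%:R^-1 - p t x x) st (fun u => PZ_derive u x x).
have h2 := ger_increment (c := N%:R^-1 - p s x x) st (fun u => PZ_derive u x x).
apply/andP; split.
  have {}h1 : PZ t x x - PZ s x x <= (N%:R^-1 - p t x x) * (t - s).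
    apply: h1 => u /andP[_ ut]; rewrite lerD2l lerN2.
    exact: (p_diag_decr hsym htrans x (ltW ut)).
  lra.
have {}h2 : (N%:R^-1 - p s x x) * (t - s) <= PZ t x x - PZ s x x.
  apply: h2 => u /andP[su _]; rewrite lerD2l lerN2.
  exact: (p_diag_decr hsym htrans x (ltW su)).
lra.
Qed.

(* The Green function: the integral of [p u x y] over [u] in [0, s]. *)
Definition green s x y := Z x y - PZ s x y + s / N%:R.

Lemma green_derive s x y : is_derive s (1 : R) (fun u => green u x y) (p s x y).
Proof.
have h1 : is_derive s (1 : R) (fun u => u / N%:R) N%:R^-1.
  by apply: is_derive_eq (is_derive_mulr _ (is_derive_var s)) _; rewrite mul1r.
apply: is_derive_eq (is_derive_add (is_derive_sub (is_derive_const _ _) (PZ_derive s x y)) h1) _.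
by ring.
Qed.

Lemma green_0 x y : green 0 x y = 0.
Proof. by rewrite /green PZ_0 mul0r subrr addr0. Qed.

Lemma green_ge0 s x y : 0 <= s -> 0 <= green s x y.
Proof.
move=> s0; have := ger_increment (c := 0) s0 (fun u => green_derive u x y).
rewrite green_0 subr0 subr0 mul0r; apply => u /andP[u0 _].
exact: (p_ge0 hsym _ _ (ltW u0)).
Qed.

Lemma green_sym s x y : green s x y = green s y x.
Proof. by rewrite /green Z_sym PZ_sym. Qed.

Lemma green_diag s x y : green s x x = green s y y.
Proof. by rewrite /green (Z_diag x y) (PZ_diag s x y). Qed.

Lemma green_gen s x y :
  \sum_b r x b * (green s b y - green s x y) = p s x y - (x == y)%:R.
Proof.
transitivity (\sum_b r x b * (Z b y - Z x y) - \sum_b r x b * (PZ s b y - PZ s x y)).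
  by rewrite -sumrB; apply: eq_bigr => b _; rewrite /green; ring.
rewrite Z_gen PZ_gen; ring.
Qed.

Lemma sum_green s x : \sum_y green s x y = s.
Proof.
rewrite big_split sumrB /=.
have -> : \sum_y Z x y = 0 by rewrite -[RHS](sum_Z x); apply: eq_bigr => y _; exact: Z_sym.
have -> : \sum_y PZ s x y = 0.
  rewrite exchange_big /= big1 // => z _.
  rewrite -mulr_sumr.
  have -> : \sum_y Z z y = 0 by rewrite -[RHS](sum_Z z); apply: eq_bigr => y _; exact: Z_sym.
  by rewrite mulr0.
by rewrite sum_cst subrr add0r mulrCA divff ?mulr1 // gt_eqF // (card_pos R x).
Qed.

End Fundamental.

(** * Spectral gap and Poincare inequality *)

Section SpectralGap.
Variables (R : realType) (N : nat) (r : 'I_N -> 'I_N -> R).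
Hypothesis hsym : symmetric_rates r.
Hypothesis htrans : transitive_chain r.
Hypothesis hirr : irreducible r.
Hypothesis N_gt1 : (1 < N)%N.
Local Notation V := 'I_N.
Implicit Types (a b x y z o : V) (u v w : 'rV[R]_N).

Let sq u : R := \sum_x u 0 x ^+ 2.
Let tot u : R := \sum_x u 0 x.
Let Lap u x : R := \sum_y r x y * (u 0 x - u 0 y).
Let form u : R := \sum_x u 0 x * Lap u x.

Lemma mulmx_laplacian u x : (u *m laplacian r) 0 x = Lap u x.
Proof.
rewrite !mxE; transitivity (\sum_y (u 0 y * (y == x)%:R - u 0 y * r y x)).
  by apply: eq_bigr => y _; rewrite !mxE /rate_tot (sum_rates htrans); ring.
rewrite sumrB sum_delta_r /Lap; under [RHS]eq_bigr => y _ do rewrite mulrBr.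
rewrite sumrB -mulr_suml (sum_rates htrans) mul1r; congr (_ - _).
by apply: eq_bigr => y _; rewrite (ratesC hsym) mulrC.
Qed.

Let sum_continuous (T : topologicalType) (F : V -> T -> R) :
  (forall x, continuous (F x)) -> continuous (fun t => \sum_x F x t).
Proof.
move=> h; elim: (index_enum V) => [|x e IH].
  by under eq_fun do rewrite big_nil; move=> t; exact: cvg_cst.
under eq_fun do rewrite big_cons; move=> t; apply: cvgD; [exact: h|exact: IH].
Qed.

Let coordC x : continuous (fun u => u 0 x).
Proof. by move=> u; exact: coord_continuous. Qed.

Let sphere : set 'rV[R]_N := [set u | tot u = 0 /\ sq u = 1].

Let sq_continuous : continuous sq.
Proof.
have h x : continuous (fun u => u 0 x * u 0 x).
  by move=> u; apply: (cvgM (@coordC x u) (@coordC x u)).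
exact: sum_continuous h.
Qed.

Let form_continuous : continuous form.
Proof.
apply: sum_continuous => x u; apply: (cvgM (@coordC x u)).
move: u; apply: sum_continuous => y u.
by apply: (cvgM (cvg_cst (r x y)) (cvgB (@coordC x u) (@coordC y u))).
Qed.

Let sphere_compact : compact sphere.
Proof.
have cube : compact [set v : 'rV[R]_N | forall i, v ord0 i \in `[(-1), 1]].
  apply: (@rV_compact _ _ (fun=> `[(-1 : R), 1]%classic)) => i.
  exact: segment_compact.
apply: subclosed_compact cube _.
  apply: closedI; [rewrite -[X in closed X]/(tot @^-1` [set 0])
                  |rewrite -[X in closed X]/(sq @^-1` [set 1])].
    apply: closed_comp; last exact: closed_eq.
    by move=> u _; apply: sum_continuous => x; exact: coordC.
  apply: closed_comp; last exact: closed_eq.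
  by move=> u _; exact: sq_continuous.
move=> u [_ su] i /=; rewrite in_itv /= -ler_norml.
rewrite -(@expr_le1 _ 2) // real_normK ?num_real // -su /sq (bigD1 i) //= lerDl.
by apply: sumr_ge0 => j _; exact: sqr_ge0.
Qed.

Let scale u (c : R) : sq (c *: u) = c ^+ 2 * sq u.
Proof. by rewrite /sq mulr_sumr; apply: eq_bigr => x _; rewrite mxE exprMn. Qed.

Let formE u : form u = 2^-1 * \sum_x \sum_y r x y * (u 0 x - u 0 y) ^+ 2.
Proof. by rewrite /form /Lap (dirichlet hsym). Qed.

Let form_scale u (c : R) : form (c *: u) = c ^+ 2 * form u.
Proof.
rewrite !formE mulrCA; congr (_ * _); rewrite mulr_sumr; apply: eq_bigr => x _.
by rewrite mulr_sumr; apply: eq_bigr => y _; rewrite !mxE; ring.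
Qed.

Let sphere_nonempty : sphere !=set0.
Proof.
pose i0 : V := Ordinal (ltnW N_gt1); pose i1 : V := Ordinal N_gt1.
pose u : 'rV[R]_N := \row_x ((x == i0)%:R - (x == i1)%:R).
have su : 0 < sq u.
  rewrite /sq (bigD1 i0) //= !mxE eqxx /= subr0 expr1n ltr_pwDl //.
  by apply: sumr_ge0 => x _; exact: sqr_ge0.
exists ((Num.sqrt (sq u))^-1 *: u); split.
  rewrite /tot; under eq_bigr => x _ do rewrite !mxE.
  rewrite -mulr_sumr sumrB; under eq_bigr => x _ do rewrite -[_%:R]mul1r.
  rewrite (sum_delta_r i0 (fun=> 1)).
  under eq_bigr => x _ do rewrite -[_%:R]mul1r.
  by rewrite (sum_delta_r i1 (fun=> 1)) subrr mulr0.
by rewrite scale exprVn sqr_sqrtr ?(ltW su) // mulVf // gt_eqF.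
Qed.

Let tot_Lap u : \sum_x Lap u x = 0.
Proof.
under eq_bigr => x _ do rewrite -[Lap _ _]mul1r.
rewrite (dirichlet hsym (fun=> 1)) big1 ?mulr0 // => x _.
by rewrite big1 // => y _; rewrite subrr mul0r mulr0.
Qed.

(** The gap is defined as an infimum of positive eigenvalues, so the variational characterization
    has to be proved: the Dirichlet form attains its minimum on the compact set of mean-zero unit
    vectors, the minimiser is an eigenvector, and no positive eigenvalue is smaller. *)
Lemma poincare_row : 0 < spectral_gap r /\
  forall u, tot u = 0 -> spectral_gap r * sq u <= form u.
Proof.
have [u0 + u0min] := EVT_min_rV sphere_nonempty sphere_compact
  (continuous_subspaceT form_continuous).
rewrite inE => -[tu0 su0]; pose lam := form u0.
have low u : tot u = 0 -> lam * sq u <= form u.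
  move=> tu; have [su|su] := eqVneq (sq u) 0.
    rewrite su mulr0 formE mulr_ge0 ?invr_ge0 //.
    by do 2 (apply: sumr_ge0 => ? _); rewrite mulr_ge0 ?sqr_ge0 ?(rates_ge0 hsym).
  have su' : 0 < sq u by rewrite lt_def su; apply: sumr_ge0 => x _; exact: sqr_ge0.
  have /u0min : ((Num.sqrt (sq u))^-1 *: u) \in sphere.
    rewrite inE; split.
      rewrite /tot; under eq_bigr => x _ do rewrite mxE.
      by rewrite -mulr_sumr -/(tot u) tu mulr0.
    by rewrite scale exprVn sqr_sqrtr ?(ltW su') // mulVf // gt_eqF.
  by rewrite form_scale exprVn sqr_sqrtr ?(ltW su') // mulrC ler_pdivlMr.
have lam_gt0 : 0 < lam.
  have : 0 <= lam.
    rewrite /lam formE mulr_ge0 ?invr_ge0 //.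
    by do 2 (apply: sumr_ge0 => ? _); rewrite mulr_ge0 ?sqr_ge0 ?(rates_ge0 hsym).
  rewrite le_eqVlt => /orP[/eqP lam0|//].
  have cst : forall x y, u0 0 x = u0 0 y.
    apply: (dirichlet_eq0 hsym hirr); move: lam0; rewrite /lam formE => h; lra.
  pose o : V := Ordinal (ltnW N_gt1).
  have u0o x : u0 0 x = 0.
    have := tu0; rewrite /tot (sum_const x cst) => /eqP.
    by rewrite mulf_eq0 gt_eqF ?(card_pos R x) //= => /eqP.
  move: su0; rewrite /sq big1 => [|x _]; last by rewrite u0o expr0n.
  by move=> /esym/eqP; rewrite oner_eq0.
(* The residual of the eigenvalue equation at the minimiser; it is mean-zero, hence an admissible
   direction of variation. *)
pose w : 'rV[R]_N := \row_x (Lap u0 x - lam * u0 0 x).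
have tw : tot w = 0.
  rewrite /tot; under eq_bigr => x _ do rewrite mxE.
  by rewrite sumrB tot_Lap -mulr_sumr -/(tot u0) tu0 mulr0 subrr.
have cross (c : R) : 0 <= 2 * c * sq w + c ^+ 2 * (form w - lam * sq w).
  have tcw : tot (u0 + c *: w) = 0.
    rewrite /tot; under eq_bigr => x _ do rewrite !mxE.
    rewrite big_split /= -/(tot u0) tu0 add0r -mulr_sumr.
    by have := tw; rewrite /tot; under eq_bigr => x _ do rewrite mxE; move=> ->; rewrite mulr0.
  have := low _ tcw; rewrite -subr_ge0 => /le_trans; apply.
  have wE x : (u0 + c *: w) 0 x = u0 0 x + c * w 0 x.
    by rewrite mxE [X in _ + X = _]mxE.
  have hs : sq (u0 + c *: w) = sq u0 + 2 * c * (\sum_x u0 0 x * w 0 x) + c ^+ 2 * sq w.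
    rewrite /sq !mulr_sumr -!big_split /=; apply: eq_bigr => x _; rewrite !mxE; ring.
  have hf : form (u0 + c *: w) = lam + 2 * c * (\sum_x w 0 x * Lap u0 x) + c ^+ 2 * form w.
    have -> : \sum_x w 0 x * Lap u0 x =
       2^-1 * \sum_x \sum_y r x y * ((w 0 x - w 0 y) * (u0 0 x - u0 0 y)).
      by rewrite -(dirichlet hsym (fun x => w 0 x) (fun x => u0 0 x)).
    rewrite /lam !formE !mulr_sumr -!big_split /=; apply: eq_bigr => x _.
    rewrite !mulr_sumr -!big_split /=; apply: eq_bigr => y _.
    by rewrite !wE; field.
  have hw : \sum_x w 0 x * Lap u0 x - lam * \sum_x u0 0 x * w 0 x = sq w.
    rewrite mulr_sumr -sumrB /sq; apply: eq_bigr => x _; rewrite !mxE; ring.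
  rewrite hs hf su0 -hw; lra.
have sw : sq w = 0.
  have sw0 : 0 <= sq w by apply: sumr_ge0 => x _; exact: sqr_ge0.
  have [//|swp] := eqVneq (sq w) 0.
  have {}swp : 0 < sq w by rewrite lt_def swp.
  set D := form w - lam * sq w in cross.
  have hD : 0 < 1 + `|D| by rewrite ltr_pwDl.
  (* Small enough for the negative linear term to beat the quadratic one: with c = -k the expression
     is at most -2k^2 (1 + |D|) + k^2 |D| < 0. *)
  have := cross (- sq w / (1 + `|D|)); set k := sq w / (1 + `|D|).
  have k0 : 0 < k by rewrite divr_gt0.
  rewrite mulNr sqrrN -/k.
  have kE : sq w = k * (1 + `|D|) by rewrite mulrC mulrA mulrAC mulfV ?mul1r // gt_eqF.
  have := ler_norm D; nra.
have weq x : Lap u0 x = lam * u0 0 x.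
  have : w 0 x ^+ 2 <= 0.
    rewrite -sw /sq (bigD1 x) //= lerDl; apply: sumr_ge0 => y _; exact: sqr_ge0.
  move=> h; have /eqP : w 0 x ^+ 2 == 0 by rewrite eq_le h sqr_ge0.
  by move/eqP; rewrite sqrf_eq0 mxE subr_eq0 => /eqP.
have gapE : spectral_gap r = lam.
  rewrite /spectral_gap; set A := [set l : R | _].
  have Alam : A lam.
    split => //; apply/eigenvalueP; exists u0.
      by apply/rowP => x; rewrite mulmx_laplacian weq !mxE.
    apply/eqP => u00; move: su0; rewrite u00 /sq big1 => [|x _]; last by rewrite mxE expr0n.
    by move=> /esym/eqP; rewrite oner_eq0.
  have lbA : lbound A lam.
    move=> l [l0 /eigenvalueP[v vl v0]].
    have vL x : Lap v x = l * v 0 x by rewrite -mulmx_laplacian vl mxE.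
    have tv : tot v = 0.
      have := tot_Lap v; under eq_bigr => x _ do rewrite vL.
      by rewrite -mulr_sumr => /eqP; rewrite mulf_eq0 gt_eqF //= => /eqP.
    have := low _ tv; rewrite /form; under eq_bigr => x _ do rewrite vL mulrCA -expr2.
    rewrite -mulr_sumr -/(sq v) ler_pM2r // lt_def.
    apply/andP; split; last by apply: sumr_ge0 => x _; exact: sqr_ge0.
    apply: contra v0; rewrite psumr_eq0 => [/allP h|x _]; last exact: sqr_ge0.
    apply/eqP/rowP => x; rewrite mxE; have := h x; rewrite mem_index_enum => /(_ isT).
    by rewrite implyTb sqrf_eq0 => /eqP.
  apply/eqP; rewrite eq_le; apply/andP; split.
    by apply: ge_inf => //; exists lam.
  by apply: lb_le_inf => //; exists lam.
by rewrite gapE; split.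
Qed.

Lemma spectral_gap_gt0 : 0 < spectral_gap r.
Proof. exact: poincare_row.1. Qed.

Lemma poincare (u : V -> R) : \sum_x u x = 0 ->
  spectral_gap r * \sum_x u x ^+ 2 <= \sum_x u x * \sum_y r x y * (u x - u y).
Proof.
move=> hu; have := poincare_row.2 (\row_x u x).
rewrite /tot /sq /form /Lap.
under eq_bigr => x _ do rewrite mxE.
move=> /(_ hu).
under eq_bigr => x _ do rewrite mxE.
by under [X in _ <= X -> _]eq_bigr => x _ do
  (under eq_bigr => y _ do rewrite !mxE; rewrite mxE).
Qed.

Lemma t_rel_gt0 : 0 < t_rel r.
Proof. by rewrite /t_rel invr_gt0 spectral_gap_gt0. Qed.

Variable Z : V -> V -> R.
Hypothesis hZ : fundamental r Z.

(** With u = p_(t/2)(o,.) - 1/N and h = Zu, the left side is the inner product of u and h, and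
    Poincare bounds gap |h|^2 by it. Weighted AM-GM then leaves |u|^2 / gap, where |u|^2 = p_t(o,o)
    - 1/N. *)
Lemma PZ_le_t_rel t o : PZ r Z t o o <= t_rel r * (p_t r t o o - N%:R^-1).
Proof.
have gap := spectral_gap_gt0.
have N0 := card_pos R o.
pose u x := p_t r (t / 2) o x - N%:R^-1.
pose h x := \sum_y Z x y * u y.
have Zc x (c : R) : \sum_y Z x y * c = 0.
  rewrite -mulr_suml; have -> : \sum_y Z x y = 0.
    by rewrite -[RHS](sum_Z hZ x); apply: eq_bigr => y _; exact: (Z_sym hZ).
  by rewrite mul0r.
have hE x : h x = \sum_y Z x y * p_t r (t / 2) o y.
  rewrite /h; under eq_bigr => y _ do rewrite mulrBr.
  by rewrite sumrB Zc subr0.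
have sh : \sum_x h x = 0.
  rewrite exchange_big big1 // => y _; by rewrite -mulr_suml (sum_Z hZ) mul0r.
set b := PZ r Z t o o.
have bE : b = \sum_x u x * h x.
  rewrite /b (PZ_form hsym hZ) /u; under [RHS]eq_bigr => x _ do rewrite mulrBl.
  by rewrite sumrB -mulr_sumr sh mulr0 subr0; apply: eq_bigr => x _; rewrite hE.
have hb : spectral_gap r * \sum_x h x ^+ 2 <= b.
  rewrite bE (Z_form_ge0 hsym hZ).
  apply: le_trans (poincare sh) _.
  by rewrite (dirichlet hsym).
have su : \sum_x u x ^+ 2 = p_t r t o o - N%:R^-1.
  have {1}-> : t = t / 2 + t / 2 by lra.
  rewrite p_add.
  transitivity (\sum_x (p_t r (t / 2) o x * p_t r (t / 2) x o
     - 2 * N%:R^-1 * p_t r (t / 2) o x + N%:R^-1 ^+ 2)).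
    apply: eq_bigr => x _; rewrite (p_sym hsym _ x) /u; ring.
  rewrite big_split sumrB /= -mulr_sumr p_sum sum_cst; field.
  by rewrite gt_eqF.
rewrite -su /t_rel; set g := spectral_gap r in gap hb *.
have : 2 * b <= g * \sum_x h x ^+ 2 + g^-1 * \sum_x u x ^+ 2.
  rewrite bE !mulr_sumr -big_split /=; apply: ler_sum => x _.
  have := sqr_ge0 (g * h x - u x); rewrite -(pmulr_rge0 _ (_ : 0 < g^-1)) ?invr_gt0 //.
  have -> : g^-1 * (g * h x - u x) ^+ 2 = g * h x ^+ 2 + g^-1 * u x ^+ 2 - 2 * (u x * h x).
    by field; rewrite gt_eqF.
  by rewrite subr_ge0.
lra.
Qed.

End SpectralGap.

(** * Meeting probabilities, [alpha] and the mean meeting time *)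

Section Meeting.
Variables (R : realType) (N : nat) (r : 'I_N -> 'I_N -> R).
Hypothesis hsym : symmetric_rates r.
Hypothesis htrans : transitive_chain r.
Hypothesis hirr : irreducible r.
Variable Z : 'I_N -> 'I_N -> R.
Hypothesis hZ : fundamental r Z.
Local Notation V := 'I_N.
Local Notation M := {ffun 'I_N -> 'I_N}.
Local Notation E := (FE r).
Local Notation p := (p_t r).
Local Notation q := (P_meet_gt r).
Local Notation PZ := (PZ r Z).
Local Notation alpha := (alpha r).
Implicit Types (f g h : M) (a b x y z o : V) (s t : R).

Let r0 := rates_ge0 hsym.
Let diagZ x y : Z x x = Z y y := Z_diag hsym htrans hirr hZ x y.

Lemma alphaE t x : alpha t x = \sum_y r x y * q t x y.
Proof.
rewrite /Defs.alpha /rate_tot (sum_rates htrans) mul1r.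
by apply: eq_bigr => y _; rewrite divr1.
Qed.

Lemma q_ge0 t x y : 0 <= t -> 0 <= q t x y.
Proof. by move=> t0; rewrite P_meet_gtE; apply: FE_ge0 => // f; rewrite ler0n. Qed.

Lemma q_le1 t x y : 0 <= t -> q t x y <= 1.
Proof.
move=> t0; rewrite P_meet_gtE -[leRHS](FE_cst r t 1); apply: FE_le => // f.
by case: (_ != _); rewrite ?ler01.
Qed.

Lemma q_decr s t x y : 0 <= s -> s <= t -> q t x y <= q s x y.
Proof.
move=> s0 st; rewrite !P_meet_gtE; have -> : t = s + (t - s) by lra.
rewrite FE_comp; apply: FE_le => // f.
rewrite -[leRHS](FE_cst r (t - s)); apply: FE_le; rewrite ?subr_ge0 // => g.
by rewrite !ffunE ler_nat; case: (eqVneq (f x) (f y)) => [->|_]; rewrite ?eqxx ?leq_b1.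
Qed.

Lemma alpha_diag t x y : alpha t x = alpha t y.
Proof.
rewrite !alphaE; apply: (transitive_invariant htrans
  (F := fun x => \sum_y r x y * q t x y)) => phi z hphi.
rewrite (reindex_inj (@perm_inj _ phi)); apply: eq_bigr => w _; rewrite hphi.
congr (_ * _); rewrite !P_meet_gtE (FE_fconj _ _ hphi).
by apply: eq_FE => f; rewrite !ffunE !permK (inj_eq perm_inj).
Qed.

Lemma alpha_ge0 t x : 0 <= t -> 0 <= alpha t x.
Proof. by move=> t0; rewrite alphaE; apply: sumr_ge0 => y _; rewrite mulr_ge0 ?r0 ?q_ge0. Qed.

Lemma alpha_le1 t x : 0 <= t -> alpha t x <= 1.
Proof.
move=> t0; rewrite alphaE -[leRHS](sum_rates htrans x); apply: ler_sum => y _.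
by rewrite ler_piMr ?r0 ?q_le1.
Qed.

Lemma alpha_decr s t x : 0 <= s -> s <= t -> alpha t x <= alpha s x.
Proof.
by move=> s0 st; rewrite !alphaE; apply: ler_sum => y _; rewrite ler_wpM2l ?r0 ?q_decr.
Qed.

Definition WZ t x y := E t (fun f => Z (f x) (f y)).

Lemma WZ_0 x y : WZ 0 x y = Z x y.
Proof. by rewrite /WZ FE_0 !ffunE. Qed.

(** Before meeting, each walk contributes drift 1/N; after meeting, [Z] is evaluated on its constant
    diagonal and stays fixed. The drift therefore integrates the non-meeting probability. *)
Lemma WZ_derive t x y : is_derive t (1 : R) (fun u => WZ u x y) (2 * N%:R^-1 * q t x y).
Proof.
apply: is_derive_eq (FE_derive_l r t _) _.
rewrite P_meet_gtE -FE_mull; apply: eq_FE => f.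
under eq_bigr => a _ do under eq_bigr => b _ do rewrite [fcomp _ _ x]ffunE [fcomp _ _ y]ffunE.
have [->|fxy] := eqVneq (f x) (f y).
  by rewrite mulr0 diag_gen // => z; exact: diagZ.
rewrite mulr1 two_point_gen // (Z_gen hZ) (negbTE fxy) subr0.
under [X in _ + X]eq_bigr => b _ do rewrite (Z_sym hZ (f x)) (Z_sym hZ (f x)).
by rewrite (Z_gen hZ) eq_sym (negbTE fxy) subr0; ring.
Qed.

Lemma WZ_bounds t x y : 0 <= t -> Z x y <= WZ t x y <= Z x y + 2 * t / N%:R.
Proof.
move=> t0; have N0 : 0 <= N%:R^-1 :> R by rewrite invr_ge0.
have h1 := ger_increment (c := 0) t0 (fun u => WZ_derive u x y).
have h2 := ler_increment (c := 2 * N%:R^-1) t0 (fun u => WZ_derive u x y).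
rewrite !WZ_0 subr0 in h1 h2; apply/andP; split.
  rewrite -subr_ge0 -[X in X <= _](mul0r t); apply: h1 => u /andP[u0 _].
  by rewrite !mulr_ge0 // q_ge0 // ltW.
have : WZ t x y - Z x y <= 2 * N%:R^-1 * t.
  apply: h2 => u /andP[u0 _]; rewrite ler_piMr ?mulr_ge0 ?q_le1 //; exact: ltW.
lra.
Qed.

Lemma sum_rZ o : \sum_b r o b * (Z o o - Z o b) = 1 - N%:R^-1.
Proof.
have := Z_gen hZ o o; rewrite eqxx => h.
rewrite -opprB -h -sumrN; apply: eq_bigr => b _; rewrite (Z_sym hZ b o); ring.
Qed.

(** Nonnegativity of the Green function bounds the negative part of [Z] by its tail. *)
Lemma Z_ge s x y o : 0 <= s -> - (s / N%:R + PZ s o o) <= Z x y.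
Proof.
move=> s0; have := green_ge0 hsym hZ x y s0; rewrite /green.
have := PZ_le_diag hsym htrans hirr hZ s x y o; rewrite ler_norml => /andP[].
lra.
Qed.

Lemma Z_le_diag x y o : `|Z x y| <= Z o o.
Proof. by rewrite -!(PZ_0 r Z); exact: PZ_le_diag. Qed.

(** Optional stopping for the deficit Z(o,o) - Z: averaged over one jump from [o] it starts at 1 -
    1/N, the drift lowers it by at most 2t/N, and at time [t] it lives on the event of not having
    met, where [Z_ge] bounds it. *)
Lemma alpha_lower s t o : 0 <= s -> 0 <= t ->
  1 - N%:R^-1 - 2 * t / N%:R <= alpha t o * (Z o o + s / N%:R + PZ s o o).
Proof.
move=> s0 t0.
have h1 : \sum_b r o b * (Z o o - WZ t o b) <=
          \sum_b r o b * (q t o b * (Z o o + s / N%:R + PZ s o o)).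
  apply: ler_sum => b _; rewrite ler_wpM2l ?r0 //.
  rewrite P_meet_gtE -FE_mulr -[Z o o in leLHS](FE_cst r t) -FE_sub.
  apply: FE_le => // f; have [->|fob] := eqVneq (f o) (f b).
    by rewrite mul0r (diagZ (f b) o) subrr.
  by rewrite mul1r -addrA lerD2l lerNl; exact: Z_ge.
have h2 : \sum_b r o b * (Z o o - (Z o b + 2 * t / N%:R)) <=
          \sum_b r o b * (Z o o - WZ t o b).
  apply: ler_sum => b _; rewrite ler_wpM2l ?r0 // lerD2l lerN2.
  by have /andP[] := WZ_bounds o b t0.
have h3 : \sum_b r o b * (Z o o - (Z o b + 2 * t / N%:R)) = 1 - N%:R^-1 - 2 * t / N%:R.
  rewrite -(sum_rZ o) -[X in _ - X]mul1r -(sum_rates htrans o) mulr_suml -sumrB.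
  by apply: eq_bigr => b _; ring.
rewrite -h3; apply: le_trans h2 _; apply: le_trans h1 _.
rewrite alphaE mulr_suml le_eqVlt; apply/orP; left; apply/eqP.
by apply: eq_bigr => b _; rewrite mulrA.
Qed.

(* [u |-> PZ (2T - 2u)] killed at the meeting time is a supermartingale of the
   two-particle motion: the drifts of the two coordinates cancel the time derivative. *)
Lemma WZ_off_le T x y o : 0 <= T ->
  E T (fun f => Z (f x) (f y) * (f x != f y)%:R) <= PZ (2 * T) o o.
Proof.
move=> T0.
pose G u a b := PZ (2 * T - 2 * u) a b.
pose F u f := G u (f x) (f y) * (f x != f y)%:R.
have hG u a b : is_derive u (1 : R) (fun v => G v a b)
    (- 2 * (N%:R^-1 - p (2 * T - 2 * u) a b)).
  have h1 : is_derive u (1 : R) (fun v => 2 * T - 2 * v) (- 2).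
    apply: is_derive_eq (is_derive_sub (is_derive_const (2 * T) u)
      (is_derive_mull 2 (is_derive_var u))) _; ring.
  exact: (is_derive_comp h1 (PZ_derive hZ _ a b)).
have hF u f : is_derive u (1 : R) (fun v => F v f)
    (- 2 * (N%:R^-1 - p (2 * T - 2 * u) (f x) (f y)) * (f x != f y)%:R).
  exact: (is_derive_mulr _ (hG u (f x) (f y))).
have hD u := FE_derive_time r (hF u).
have := ler_increment (c := 0) T0 hD.
rewrite mul0r => hle.
have {}hle : E T (F T) - E 0 (F 0) <= 0.
  apply: hle => u /andP[u0 _]; rewrite -FE_add -[leRHS](FE_cst r u 0).
  apply: FE_le => //; first exact: ltW.
  move=> f; rewrite /F; set D := 2 * T - 2 * u.
  under eq_bigr => a _ do under eq_bigr => b _ do rewrite [fcomp _ _ x]ffunE [fcomp _ _ y]ffunE.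
  pose H a b := G u a b * (a != b)%:R.
  rewrite -/(H (f x) (f y)).
  rewrite [X in X + _](_ : _ = \sum_a \sum_b r a b *
    (H (fmove a b (f x)) (fmove a b (f y)) - H (f x) (f y))) //.
  have [->|fxy] := eqVneq (f x) (f y).
    by rewrite mulr0 addr0 diag_gen // => z; rewrite /H !eqxx !mulr0.
  rewrite two_point_gen // mulr1.
  (* Killing at the diagonal can only lower the value there, as [PZ] is nonnegative on the
     diagonal. *)
  have HG a b : H a b <= G u a b.
    rewrite /H; case: (eqVneq a b) => [->|_]; last by rewrite mulr1.
    by rewrite mulr0 /G; exact: PZ_diag_ge0.
  have HE : H (f x) (f y) = G u (f x) (f y) by rewrite /H fxy mulr1.
  have le1 : \sum_b r (f x) b * (H b (f y) - H (f x) (f y)) <= N%:R^-1 - p D (f x) (f y).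
    rewrite -(PZ_gen hZ D); apply: ler_sum => b _.
    by rewrite ler_wpM2l ?r0 // HE lerD2r; exact: HG.
  have le2 : \sum_b r (f y) b * (H (f x) b - H (f x) (f y)) <= N%:R^-1 - p D (f x) (f y).
    rewrite [X in _ <= _ - X](p_sym hsym) -(PZ_gen hZ D); apply: ler_sum => b _.
    rewrite ler_wpM2l ?r0 // HE -/(G u b (f x)) /G -/D.
    rewrite (PZ_sym hsym hZ D b) (PZ_sym hsym hZ D (f y)) lerD2r; exact: HG.
  lra.
have -> : E T (fun f => Z (f x) (f y) * (f x != f y)%:R) = E T (F T).
  by apply: eq_FE => f; rewrite /F /G subrr PZ_0.
move: hle; rewrite subr_le0 => /le_trans; apply.
rewrite FE_0 /F /G !ffunE mulr0 subr0.
apply: le_trans (PZ_le_diag hsym htrans hirr hZ (2 * T) x y o).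
case: (x != y); first by rewrite mulr1 ler_norm.
by rewrite mulr0.
Qed.

(** The same stopping identity read the other way. The drift has a favourable sign, and the
    remaining term, [Z] on the event of not having met, is bounded by [WZ_off_le]. *)
Lemma alpha_upper t o : 0 <= t -> alpha t o * Z o o <= 1 + PZ (2 * t) o o.
Proof.
move=> t0.
have h1 b : Z o o * q t o b - PZ (2 * t) o o <= Z o o - Z o b.
  have := WZ_off_le o b o t0.
  have /andP[+ _] := WZ_bounds o b t0.
  have -> : WZ t o b = E t (fun f => Z (f o) (f b) * (f o != f b)%:R) +
                       Z o o * (1 - q t o b).
    rewrite P_meet_gtE -[X in Z o o * (X - _)](FE_cst r t 1) -FE_sub -FE_mull -FE_add.
    apply: eq_FE => f; have [->|_] := eqVneq (f o) (f b).
      by rewrite mulr0 add0r subr0 mulr1; exact: diagZ.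
    by rewrite mulr1 subrr mulr0 addr0.
  lra.
have h2 : \sum_b r o b * (Z o o * q t o b - PZ (2 * t) o o) <=
          \sum_b r o b * (Z o o - Z o b).
  by apply: ler_sum => b _; rewrite ler_wpM2l ?r0.
have h3 : \sum_b r o b * (Z o o * q t o b - PZ (2 * t) o o) =
          alpha t o * Z o o - PZ (2 * t) o o.
  rewrite alphaE -[X in _ - X]mul1r -(sum_rates htrans o) !mulr_suml -sumrB.
  by apply: eq_bigr => b _; ring.
have : 0 <= N%:R^-1 :> R by rewrite invr_ge0.
move: h2; rewrite h3 sum_rZ; lra.
Qed.

(* [A] is a primitive of [P_meet_gt_unif r]. *)
Let A t := 2^-1 * N%:R^-1 * \sum_x \sum_y WZ t x y.

Let N0 o : N%:R != 0 :> R. Proof. by rewrite gt_eqF // (card_pos R o). Qed.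

Let A_derive o t : is_derive t (1 : R) A (P_meet_gt_unif r t).
Proof.
apply: is_derive_eq (is_derive_mull _ (is_derive_bigsum _ _ (fun x =>
  is_derive_bigsum _ _ (fun y => WZ_derive t x y)))) _.
rewrite /P_meet_gt_unif card_ord !mulr_sumr; apply: eq_bigr => x _.
by rewrite !mulr_sumr; apply: eq_bigr => y _; field; exact: (N0 o).
Qed.

Let unif_ge0 t : 0 <= t -> 0 <= P_meet_gt_unif r t.
Proof.
move=> t0; rewrite mulr_ge0 ?invr_ge0 ?exprn_ge0 //.
by apply: sumr_ge0 => x _; apply: sumr_ge0 => y _; exact: q_ge0.
Qed.

Let unif_decr s t : 0 <= s -> s <= t -> P_meet_gt_unif r t <= P_meet_gt_unif r s.
Proof.
move=> s0 st; rewrite ler_wpM2l ?invr_ge0 ?exprn_ge0 //.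
by apply: ler_sum => x _; apply: ler_sum => y _; exact: q_decr.
Qed.

Let A_0 : A 0 = 0.
Proof.
rewrite /A exchange_big big1 ?mulr0 // => y _.
by under eq_bigr => x _ do rewrite WZ_0; exact: (sum_Z hZ).
Qed.

(** The difference is half of N^-1 times the sum over starting pairs of the mean of Z(o,o) - Z(f x,
    f y), which is zero once the walks have met and at most 2 Z(o,o) before. *)
Let A_gap o t : 0 <= t ->
  0 <= N%:R * Z o o / 2 - A t <= N%:R * Z o o * P_meet_gt_unif r t.
Proof.
move=> t0.
have -> : N%:R * Z o o / 2 - A t =
   2^-1 * N%:R^-1 * \sum_x \sum_y E t (fun f => Z o o - Z (f x) (f y)).
  under [in RHS]eq_bigr => x _ do under eq_bigr => y _ do rewrite FE_sub FE_cst.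
  under [in RHS]eq_bigr => x _ do rewrite sumrB sum_cst.
  rewrite sumrB sum_cst mulrBr /A; congr (_ - _); field; exact: (N0 o).
apply/andP; split.
  rewrite !mulr_ge0 ?invr_ge0 //; apply: sumr_ge0 => x _; apply: sumr_ge0 => y _.
  by apply: FE_ge0 => // f; rewrite subr_ge0 (le_trans (ler_norm _)) // Z_le_diag.
rewrite /P_meet_gt_unif card_ord.
have -> (S : R) : N%:R * Z o o * ((N%:R ^+ 2)^-1 * S) = 2^-1 * N%:R^-1 * (2 * Z o o * S).
  by field; exact: (N0 o).
rewrite ler_wpM2l ?mulr_ge0 ?invr_ge0 // !mulr_sumr; apply: ler_sum => x _.
rewrite mulr_sumr; apply: ler_sum => y _.
rewrite P_meet_gtE -FE_mull; apply: FE_le => // f.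
have [->|_] := eqVneq (f x) (f y); first by rewrite mulr0 (diagZ _ o) subrr.
rewrite mulr1; have := Z_le_diag (f x) (f y) o; rewrite ler_norml => /andP[]; lra.
Qed.

Lemma t_meetE o : t_meet r = N%:R * Z o o / 2.
Proof.
have Z0 : 0 <= Z o o by apply: le_trans (Z_le_diag o o o).
have Ncst := card_pos R o.
pose C := N%:R * Z o o.
have C0 : 0 <= C by rewrite mulr_ge0 // ltW.
(* [A] is bounded by C/2 and increases at a nonincreasing rate, so that rate at time t is at most
   C/(2t). Through [A_gap] this gives convergence of [A] itself. *)
have unif_le t : 0 < t -> P_meet_gt_unif r t <= C / 2 / t.
  move=> t0; rewrite ler_pdivlMr //.
  have := ger_increment (c := P_meet_gt_unif r t) (ltW t0) (A_derive o).
  rewrite A_0 !subr0 => h; apply: le_trans (h _) _.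
    by move=> u /andP[u0 ut]; apply: unif_decr; exact: ltW.
  by have /andP[] := A_gap o (ltW t0); rewrite subr_ge0.
have Alim : A t @[t --> +oo] --> N%:R * Z o o / 2.
  apply/cvgrPdist_le => e e0; near=> t.
  have t0 : 0 < t by near: t; exact: nbhs_pinfty_gt.
  have ht : C * (C / 2) / e <= t.
    by near: t; apply: nbhs_pinfty_ge; rewrite num_real.
  have /andP[h1 h2] := A_gap o (ltW t0).
  rewrite ger0_norm //; apply: le_trans h2 _.
  apply: le_trans (_ : C * (C / 2 / t) <= _); first by rewrite ler_wpM2l // unif_le.
  rewrite mulrA ler_pdivrMr // [leRHS]mulrC -ler_pdivrMr //.
rewrite /t_meet [X in integral _ X _](_ : _ = `[0, +oo[%classic); last first.
  by apply/seteqP; split => x /=; rewrite in_itv /= andbT.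
have Uc t : {for t, continuous (P_meet_gt_unif r)}.
  apply: is_derive_continuous.
  apply: is_derive_mull; apply: is_derive_bigsum => x; apply: is_derive_bigsum => y.
  under eq_fun do rewrite P_meet_gtE.
  exact: FE_derive_l.
rewrite (@ge0_continuous_FTC2y _ _ A 0 (N%:R * Z o o / 2)).
- by rewrite A_0 sube0.
- by move=> t t0; exact: unif_ge0.
- by apply: continuous_subspaceT => t; exact: Uc.
- exact: Alim.
- by move=> t _; have [] := A_derive o t.
- by apply: cvg_at_right_filter; exact: (is_derive_continuous (A_derive o 0)).
- by move=> t _; rewrite derive1E (@derive_val _ _ _ _ _ _ _ (A_derive o t)).
Unshelve. all: by end_near. Qed.

End Meeting.

(** * Negative correlation and the crude bound on occupation *)

Section Occupation.
Variables (R : realType) (N : nat) (r : 'I_N -> 'I_N -> R).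
Hypothesis hsym : symmetric_rates r.
Hypothesis htrans : transitive_chain r.
Hypothesis hirr : irreducible r.
Variable Z : 'I_N -> 'I_N -> R.
Hypothesis hZ : fundamental r Z.
Local Notation V := 'I_N.
Local Notation M := {ffun 'I_N -> 'I_N}.
Local Notation E := (FE r).
Local Notation p := (p_t r).
Local Notation green := (green r Z).
Implicit Types (f g h k c : M) (a b x y z o : V) (s t : R) (X Y : {set V}).

Let r0 := rates_ge0 hsym.

Definition ind f x : R := (x \in Img f)%:R.

Lemma ind_ge0 f x : 0 <= ind f x. Proof. by rewrite /ind ler0n. Qed.
Lemma indxx f x : ind f x * ind f x = ind f x.
Proof. by rewrite /ind; case: (_ \in _); rewrite ?mulr1 ?mulr0. Qed.

Let ler_sum2 (A B C D : V -> V -> R) (x y : R) :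
  (forall a b, D a b <= A a b * y + x * B a b - C a b) ->
  \sum_a \sum_b D a b <=
  (\sum_a \sum_b A a b) * y + x * (\sum_a \sum_b B a b) - \sum_a \sum_b C a b.
Proof.
move=> h; rewrite mulr_suml mulr_sumr -big_split -sumrB; apply: ler_sum => a _ /=.
by rewrite mulr_suml mulr_sumr -big_split -sumrB; apply: ler_sum => b _; exact: h.
Qed.

(** Probability that all colours in [X] are present at time [t] when site z carries colour [c z].
    Keeping [c] general closes the evolution: a last move of the flow is a recolouring of [c]. *)
Let cover X t c := E t (fun f => (X \subset Img (fcomp c f))%:R : R).

Lemma cover_derive X t c :
  is_derive t (1 : R) (fun u => cover X u c)
    (\sum_a \sum_b r a b * (cover X t (fcomp c (fmove a b)) - cover X t c)).
Proof.
apply: is_derive_eq (FE_derive_l r t _) _.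
rewrite FE_sum; apply: eq_bigr => a _; rewrite FE_sum; apply: eq_bigr => b _.
by rewrite FE_mull FE_sub; under [in LHS]eq_FE => f do rewrite fcompA.
Qed.

Lemma cover_le_b X t c a b : 0 <= t -> c b \notin X ->
  cover X t (fcomp c (fmove a b)) <= cover X t c.
Proof.
move=> t0 cb; apply: FE_le => // f; rewrite ler_nat.
case: (boolP (X \subset Img (fcomp (fcomp c (fmove a b)) f))) => // /fintype.subsetP h.
suff -> : X \subset Img (fcomp c f) by [].
apply/fintype.subsetP => x xX; have /imsetP[v _ xE] := h x xX.
apply/imsetP; exists v => //; move: xE; rewrite !ffunE.
by case: (eqVneq (f v) a) => // _ xE; move: cb; rewrite -xE xX.
Qed.

Lemma cover_le_a X t c a b : 0 <= t -> c a \notin X ->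
  cover X t c <= cover X t (fcomp c (fmove a b)).
Proof.
move=> t0 ca; apply: FE_le => // f; rewrite ler_nat.
case: (boolP (X \subset Img (fcomp c f))) => // /fintype.subsetP h.
suff -> : X \subset Img (fcomp (fcomp c (fmove a b)) f) by [].
apply/fintype.subsetP => x xX; have /imsetP[v _ xE] := h x xX.
apply/imsetP; exists v => //; move: xE; rewrite !ffunE.
by case: (eqVneq (f v) a) => // -> xE; move: ca; rewrite -xE xX.
Qed.

(* Moving [a] onto [b] recolours [a] by the colour of [b]; as [X] and [Y] are
   disjoint, this cannot help both of them. *)
Lemma cover_opposite X Y t c a b : 0 <= t -> (forall z, ~~ ((z \in X) && (z \in Y))) ->
  (cover X t (fcomp c (fmove a b)) - cover X t c) *
  (cover Y t (fcomp c (fmove a b)) - cover Y t c) <= 0.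
Proof.
move=> t0 dis.
have Xb := @cover_le_b X t c a b t0; have Xa := @cover_le_a X t c a b t0.
have Yb := @cover_le_b Y t c a b t0; have Ya := @cover_le_a Y t c a b t0.
have := dis (c a); have := dis (c b); move: Xa Xb Ya Yb.
(* If both colours lie in one of the sets, the other probability does not change; in the remaining
   cases the two changes have opposite signs or one vanishes. *)
case: (c a \in X); case: (c b \in X); case: (c a \in Y); case: (c b \in Y) => //=.
all: move=> Xa Xb Ya Yb _ _; try (have {}Xa := Xa isT); try (have {}Xb := Xb isT);
  try (have {}Ya := Ya isT); try (have {}Yb := Yb isT);
  by first [ apply: mulr_ge0_le0; lra | apply: mulr_le0_ge0; lra
    | (suff -> : cover X t (fcomp c (fmove a b)) - cover X t c = 0 by rewrite mul0r); lra
    | (suff -> : cover Y t (fcomp c (fmove a b)) - cover Y t c = 0 by rewrite mulr0); lra ].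
Qed.

(* Generator comparison: the defect [D] solves [D' = L D + (nonnegative)] with
   [D 0 = 0]. *)
Lemma negative_correlation X Y t c : 0 <= t -> (forall z, ~~ ((z \in X) && (z \in Y))) ->
  cover (X :|: Y) t c <= cover X t c * cover Y t c.
Proof.
move=> t0 XY.
pose D s c := cover X s c * cover Y s c - cover (X :|: Y) s c.
pose gen s (F : M -> R) c := \sum_a \sum_b r a b * (F (fcomp c (fmove a b)) - F c).
have hD s c' : is_derive s (1 : R) (fun u => D u c')
    (gen s (cover X s) c' * cover Y s c' + cover X s c' * gen s (cover Y s) c' -
     gen s (cover (X :|: Y) s) c').
  exact: (is_derive_sub (is_derive_mul (cover_derive X s c') (cover_derive Y s c'))
    (cover_derive (X :|: Y) s c')).
have hv s : is_derive s (1 : R) (fun u => E u (fun k => D (t - u) (fcomp c k))) _ :=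
  FE_derive_time r (fun k => is_derive_comp_sub (hD (t - s) (fcomp c k))).
have := ler_increment (c := 0) t0 hv; rewrite mul0r => hle.
have {}hle : E t (fun k => D (t - t) (fcomp c k)) - E 0 (fun k => D (t - 0) (fcomp c k)) <= 0.
  apply: hle => s /andP[s0 st]; set u := t - s.
  have u0 : 0 <= u by rewrite subr_ge0 ltW.
  (* The time derivative of [D] moves [c] from inside, that of the expectation from outside; the
     exchange makes them cancel. What remains is the rate-weighted sum of products of the two
     changes, controlled by [cover_opposite]. *)
  rewrite (FE_gen_lr r s (fun k => D u (fcomp c k))) -FE_add -[leRHS](FE_cst r s 0).
  apply: FE_le => // [|k]; first exact: ltW.
  under eq_bigr => a _ do under eq_bigr => b _ do rewrite fcompA.
  set d := fcomp c k; rewrite subr_le0; apply: ler_sum2 => a b.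
  have := cover_opposite d a b u0 XY; have := r0 a b; rewrite /D.
  set x := cover X u (fcomp _ _); set y := cover Y u (fcomp _ _).
  set z := cover (_ :|: _) u (fcomp _ _); set x' := cover X u d; set y' := cover Y u d.
  move=> rab hxy; rewrite -subr_ge0.
  rewrite [leRHS](_ : _ = - (r a b * ((x - x') * (y - y')))); last by ring.
  by rewrite oppr_ge0 mulr_ge0_le0.
rewrite FE_0 subr0 subrr fcompf1 in hle.
have D0 c' : D 0 c' = 0.
  rewrite /D /cover !FE_0 !fcompf1 finset.subUset.
  by case: (X \subset _); case: (Y \subset _); rewrite /= ?mulr1 ?mulr0 ?mul0r subrr.
rewrite (eq_FE r t (G := fun=> 0)) ?FE_cst // in hle.
by rewrite -subr_ge0 -/(D t c) -oppr_le0; rewrite sub0r in hle.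
Qed.

Definition rho t o := P_occ r t o.

Lemma rhoE t o : rho t o = E t (fun f => ind f o).
Proof. exact: P_occE. Qed.

Lemma rho_diag t x y : rho t x = rho t y.
Proof.
rewrite !rhoE; apply: (FE_invariant htrans (F := fun x f => ind f x)) => phi z f hphi.
rewrite /ind; congr (_%:R); congr (nat_of_bool _).
apply/imsetP/imsetP => -[v _ vE]; first exists (phi^-1%g v) => //.
  by apply: (@perm_inj _ phi); rewrite vE ffunE.
by exists (phi v) => //; rewrite ffunE permK vE.
Qed.

Lemma ind_prod_cover t X : E t (fun f => (X \subset Img f)%:R : R) = cover X t (fid N).
Proof. by apply: eq_FE => f; rewrite fcomp1f. Qed.

Lemma ind2E f x y : ind f x * ind f y = ([set x; y]%SET \subset Img f)%:R.
Proof. by rewrite /ind finset.subUset !finset.sub1set -mulnb natrM. Qed.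

Lemma pair_occ_le t x y o : 0 <= t -> x != y ->
  E t (fun f => ind f x * ind f y) <= rho t o ^+ 2.
Proof.
move=> t0 xy; under eq_FE => f do rewrite ind2E.
rewrite ind_prod_cover; apply: le_trans (negative_correlation _ t0 _) _.
  by move=> z; rewrite !finset.in_set1; case: eqP => //= ->; exact: xy.
rewrite -!ind_prod_cover expr2 {1}(rho_diag t o x) (rho_diag t o y) !rhoE /ind.
by under eq_FE => f do rewrite finset.sub1set; under [X in _ * X <= _]eq_FE => f do rewrite finset.sub1set.
Qed.

Lemma triple_occ_le t x y z o : 0 <= t -> z != x -> z != y ->
  E t (fun f => ind f x * ind f y * ind f z) <= E t (fun f => ind f x * ind f y) * rho t o.
Proof.
move=> t0 zx zy.
under eq_FE => f do rewrite ind2E /ind -natrM mulnb -finset.sub1set -finset.subUset.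
under [X in _ <= X * _]eq_FE => f do rewrite ind2E.
rewrite !ind_prod_cover; apply: le_trans (negative_correlation _ t0 _) _.
  by move=> w; rewrite !inE andbC; case: eqP => //= ->; rewrite negb_or zx.
rewrite (rho_diag t o z) rhoE -(ind_prod_cover t [set z]%SET) /ind.
by under [X in _ * X <= _]eq_FE => f do rewrite finset.sub1set.
Qed.

Definition coal_rate t := \sum_a \sum_(b | b != a) r a b * E t (fun f => ind f a * ind f b).

Lemma coal_rate_ge0 t : 0 <= t -> 0 <= coal_rate t.
Proof.
move=> t0; apply: sumr_ge0 => a _; apply: sumr_ge0 => b _.
by rewrite mulr_ge0 ?r0 // FE_ge0 // => f; rewrite mulr_ge0 ?ind_ge0.
Qed.

Let rest f a x : R := if x == a then 0 else ind f x.

Lemma ind_rest f a x : ind f x = rest f a x + ind f a * (x == a)%:R.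
Proof.
by rewrite /rest; case: eqVneq => [->|_]; rewrite ?mulr1 ?mulr0 ?add0r ?addr0.
Qed.

Lemma ind_fmove f a b x : a != b ->
  ind (fcomp (fmove a b) f) x =
  rest f a x + ind f a * (1 - rest f a b) * (x == b)%:R.
Proof.
move=> ab; have -> : ind (fcomp (fmove a b) f) x = (x \in fmove a b @: Img f)%:R.
  congr (nat_of_bool _)%:R; rewrite /Img -imset_comp.
  by apply/imsetP/imsetP => -[v _ ->]; exists v => //; rewrite [fcomp _ _ v]ffunE.
rewrite fmove_imset /rest [b == a]eq_sym (negbTE ab) /ind.
case: (boolP (a \in Img f)) => aI; rewrite ?mul1r ?mul0r.
  rewrite !inE; case: (eqVneq x b) => [->|xb] /=.
    by rewrite [b == a]eq_sym (negbTE ab) mulr1; ring.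
  by rewrite mulr0 addr0; case: (x == a).
by rewrite addr0; case: (eqVneq x a) => [->|//]; rewrite (negbTE aI).
Qed.

Lemma sum_ind_fmove f a b :
  \sum_x ind (fcomp (fmove a b) f) x - \sum_x ind f x =
  - (if b != a then ind f a * ind f b else 0).
Proof.
have [->|ba] := eqVneq b a.
  rewrite oppr0 -sumrB big1 // => x _; apply/eqP; rewrite subr_eq0; apply/eqP.
  congr (ind _ _); apply/ffunP => v; rewrite !ffunE; by case: eqP.
have ab : a != b by rewrite eq_sym.
under eq_bigr => x _ do rewrite (ind_fmove _ _ ab).
under [X in _ - X]eq_bigr => x _ do rewrite (ind_rest f a x).
rewrite !big_split /= -!mulr_sumr.
have s1 z : \sum_x (x == z)%:R = 1 :> R.
  under eq_bigr => x _ do rewrite -[_%:R]mul1r.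
  by rewrite (sum_delta_r z (fun=> 1)).
rewrite !s1 [rest f a b]/rest (negbTE ba) /=; ring.
Qed.

Lemma rho_derive t o : is_derive t (1 : R) (fun u => N%:R * rho u o) (- coal_rate t).
Proof.
have -> : (fun u => N%:R * rho u o) = (fun u => E u (fun f => \sum_x ind f x)).
  apply/funext => u; rewrite FE_sum; under eq_bigr => x _ do rewrite -rhoE.
  by rewrite (sum_const o (fun x y => rho_diag u x y)).
apply: is_derive_eq (FE_derive_l r t _) _.
under eq_FE => f do under eq_bigr => a _ do under eq_bigr => b _ do rewrite sum_ind_fmove mulrN.
rewrite FE_sum -sumrN; apply: eq_bigr => a _.
rewrite FE_sum -sumrN [RHS]big_mkcond; apply: eq_bigr => b _.
case: (b != a); first by rewrite FE_opp FE_mull.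
by rewrite mulr0 oppr0 FE_cst.
Qed.

Lemma rho_ge0 t o : 0 <= t -> 0 <= rho t o.
Proof. by move=> t0; rewrite rhoE FE_ge0 // => f; exact: ind_ge0. Qed.

Lemma rho_decr s t o : 0 <= s -> s <= t -> rho t o <= rho s o.
Proof.
move=> s0 st; have N0 := card_pos R o.
rewrite -(ler_pM2l N0) -subr_le0 -[leRHS](mul0r (t - s)).
apply: (ler_increment st (fun u => rho_derive u o)) => u /andP[su _].
by rewrite oppr_le0 coal_rate_ge0 // (le_trans s0) // ltW.
Qed.

(** * Green energy of the occupied set *)

Section Energy.
Variables (tau : R) (tau_ge0 : 0 <= tau).
Local Notation gt := (green tau).

Definition energy f := \sum_x \sum_y ind f x * ind f y * gt x y.

Let quad (j : V -> R) := \sum_x \sum_y j x * j y * gt x y.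

Lemma quad_delta (j : V -> R) (c : R) b :
  quad (fun x => j x + c * (x == b)%:R) =
  quad j + 2 * c * (\sum_y j y * gt b y) + c ^+ 2 * gt b b.
Proof.
rewrite /quad; transitivity (\sum_x (\sum_y j x * j y * gt x y + c * (j x * gt x b)
    + c * (x == b)%:R * (\sum_y j y * gt x y) + c ^+ 2 * ((x == b)%:R * gt x b))).
  apply: eq_bigr => x _; rewrite -[X in _ + X + _ + _](sum_delta_r b (fun y => c * (j x * gt x y))).
  rewrite -[gt x b in RHS](sum_delta_r b (fun y => gt x y)) !mulr_sumr -!big_split /=.
  by apply: eq_bigr => y _; ring.
rewrite !big_split /=.
have -> : \sum_x c * (x == b)%:R * (\sum_y j y * gt x y) = c * \sum_y j y * gt b y.
  rewrite -(sum_delta_r b (fun x => \sum_y j y * gt x y)) mulr_sumr.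
  by apply: eq_bigr => x _; ring.
have -> : \sum_x c ^+ 2 * ((x == b)%:R * gt x b) = c ^+ 2 * gt b b.
  rewrite -(sum_delta_r b (fun x => gt x b)) mulr_sumr.
  by apply: eq_bigr => x _; ring.
have -> : \sum_x c * (j x * gt x b) = c * \sum_y j y * gt b y.
  by rewrite mulr_sumr; apply: eq_bigr => y _; rewrite (green_sym hsym hZ).
ring.
Qed.

Lemma energy_fmove f a b : a != b ->
  energy (fcomp (fmove a b) f) - energy f =
  ind f a * (2 * \sum_(y | y != a) ind f y * (gt b y - gt a y)
    - ind f b * (2 * \sum_(y | y != a) ind f y * gt b y + gt b b)).
Proof.
move=> ab.
have restE (F : V -> R) : \sum_y rest f a y * F y = \sum_(y | y != a) ind f y * F y.
  rewrite [RHS]big_mkcond; apply: eq_bigr => y _; rewrite /rest.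
  by case: (y == a); rewrite //= mul0r.
have rb : rest f a b = ind f b by rewrite /rest eq_sym (negbTE ab).
have e1 : energy (fcomp (fmove a b) f) = quad (rest f a) +
    2 * (ind f a * (1 - ind f b)) * (\sum_(y | y != a) ind f y * gt b y) +
    (ind f a * (1 - ind f b)) ^+ 2 * gt b b.
  rewrite -(restE (gt b)) -quad_delta.
  by apply: eq_bigr => x _; apply: eq_bigr => y _; rewrite !(ind_fmove _ _ ab) rb.
have e2 : energy f = quad (rest f a) +
    2 * ind f a * (\sum_(y | y != a) ind f y * gt a y) + ind f a ^+ 2 * gt b b.
  rewrite (green_diag hsym htrans hirr hZ tau b a) -(restE (gt a)) -quad_delta.
  by apply: eq_bigr => x _; apply: eq_bigr => y _; rewrite -!ind_rest.
rewrite e1 e2.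
have -> : \sum_(y | y != a) ind f y * (gt b y - gt a y) =
   \sum_(y | y != a) ind f y * gt b y - \sum_(y | y != a) ind f y * gt a y.
  by rewrite -sumrB; apply: eq_bigr => y _; rewrite mulrBr.
have c2 : (ind f a * (1 - ind f b)) ^+ 2 = ind f a * (1 - ind f b).
  by rewrite /ind; case: (a \in _); case: (b \in _); rewrite /=; ring.
by rewrite c2 expr2 indxx; ring.
Qed.

(** The generator sends the Green function to p_tau minus the identity, and the identity drops out
    as y differs from a. Free motion thus feeds the energy with p_tau over occupied pairs; the
    subtracted sum is what coalescence destroys. *)
Lemma energy_gen f :
  \sum_a \sum_b r a b * (energy (fcomp (fmove a b) f) - energy f) =
  2 * \sum_a \sum_(y | y != a) ind f a * ind f y * p tau a y -
  \sum_a \sum_(b | b != a) r a b * (ind f a * ind f b *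
     (2 * \sum_(y | y != a) ind f y * gt b y + gt b b)).
Proof.
rewrite mulr_sumr -sumrB; apply: eq_bigr => a _.
have h b : r a b * (energy (fcomp (fmove a b) f) - energy f) =
    2 * (ind f a * \sum_(y | y != a) ind f y * (r a b * (gt b y - gt a y)))
    - (if b != a then r a b * (ind f a * ind f b *
     (2 * \sum_(y | y != a) ind f y * gt b y + gt b b)) else 0).
  have [->|ba] := eqVneq b a.
    have -> : fcomp (fmove a a) f = f by apply/ffunP => v; rewrite !ffunE; case: eqP.
    rewrite subrr mulr0 subr0 big1 ?mulr0 ?mulr0 // => y _; by rewrite subrr !mulr0.
  have ab : a != b by rewrite eq_sym.
  rewrite (energy_fmove _ ab).
  have -> : \sum_(y | y != a) ind f y * (r a b * (gt b y - gt a y)) =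
     r a b * \sum_(y | y != a) ind f y * (gt b y - gt a y).
    by rewrite mulr_sumr; apply: eq_bigr => y _; rewrite mulrCA.
  rewrite /=; ring.
under eq_bigr => b _ do rewrite h.
rewrite sumrB -big_mkcond /=; congr (_ - _).
rewrite -mulr_sumr -mulr_sumr; congr (_ * _).
rewrite exchange_big mulr_sumr /=; apply: eq_bigr => y ya.
rewrite -mulr_sumr (green_gen hZ) [a == y]eq_sym (negbTE ya) subr0; ring.
Qed.

(** Including the diagonal, the right side is the sum of w(z)^2, with w the occupied set smoothed
    for time tau/2. Using w^2 >= 2cw - c^2 instead of Cauchy-Schwarz keeps the bound linear in the
    occupation, so its mean can be taken and [c] set to [rho] afterwards. *)
Lemma pair_kernel_lower f (c : R) o :
  2 * c * \sum_x ind f x - c ^+ 2 * N%:R - p tau o o * \sum_x ind f x <=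
  \sum_a \sum_(y | y != a) ind f a * ind f y * p tau a y.
Proof.
pose w z := \sum_a ind f a * p (tau / 2) a z.
have h1 : \sum_a \sum_y ind f a * ind f y * p tau a y = \sum_z w z ^+ 2.
  transitivity (\sum_z \sum_a \sum_y (ind f a * p (tau / 2) a z) * (ind f y * p (tau / 2) y z)).
    rewrite [RHS]exchange_big /=; apply: eq_bigr => a _.
    rewrite [RHS]exchange_big /=; apply: eq_bigr => y _.
    have -> : p tau a y = \sum_z p (tau / 2) a z * p (tau / 2) z y.
      by rewrite -p_add; congr (p _ a y); lra.
    rewrite mulr_sumr; apply: eq_bigr => z _; rewrite (p_sym hsym _ z); ring.
  apply: eq_bigr => z _; rewrite expr2 {1}/w mulr_suml.
  by apply: eq_bigr => a _; rewrite mulr_sumr.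
have h2 : \sum_z w z = \sum_x ind f x.
  rewrite exchange_big /=; apply: eq_bigr => a _.
  by rewrite -mulr_sumr p_sum mulr1.
have h3 : \sum_a \sum_(y | y != a) ind f a * ind f y * p tau a y =
   \sum_a \sum_y ind f a * ind f y * p tau a y - p tau o o * \sum_x ind f x.
  rewrite mulr_sumr -sumrB; apply: eq_bigr => a _.
  by rewrite [in RHS](bigD1 a) //= indxx (p_diag htrans tau a o); ring.
rewrite h3 h1 lerD2r -h2 mulr_sumr.
have -> : c ^+ 2 * N%:R = \sum_(z : V) c ^+ 2 by rewrite sum_cst mulrC.
rewrite -sumrB; apply: ler_sum => z _.
have := sqr_ge0 (w z - c); rewrite sqrrB => h; lra.
Qed.

(** Given an occupied pair a, b, a third site y costs a factor [rho] by negative correlation, and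
    the Green function from b has total mass [tau]. The site y = b gives twice the diagonal value
    and the self term once more: hence 3. *)
Lemma energy_loss t o : 0 <= t ->
  E t (fun f => \sum_a \sum_(b | b != a) r a b * (ind f a * ind f b *
     (2 * \sum_(y | y != a) ind f y * gt b y + gt b b))) <=
  (3 * gt o o + 2 * rho t o * tau) * coal_rate t.
Proof.
move=> t0; rewrite FE_sum mulr_sumr; apply: ler_sum => a _.
rewrite FE_sum mulr_sumr; apply: ler_sum => b ba.
rewrite FE_mull mulrCA ler_wpM2l ?r0 //.
set P := E t (fun f => ind f a * ind f b).
have P0 : 0 <= P by rewrite FE_ge0 // => f; rewrite mulr_ge0 ?ind_ge0.
have g0 x y : 0 <= gt x y by exact: green_ge0.
have -> : E t (fun f => ind f a * ind f b *
     (2 * \sum_(y | y != a) ind f y * gt b y + gt b b)) =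
   2 * \sum_(y | y != a) E t (fun f => ind f a * ind f b * ind f y) * gt b y + gt b b * P.
  rewrite -FE_mull; under [X in 2 * X + _]eq_bigr => y _ do rewrite -FE_mulr.
  rewrite -FE_sum -FE_mull -FE_add; apply: eq_FE => f.
  rewrite mulrDr [_ * gt b b]mulrC; congr (_ + _).
  by rewrite mulrCA; congr (_ * _); rewrite mulr_sumr; apply: eq_bigr => y _; ring.
rewrite (bigD1 b) //= (green_diag hsym htrans hirr hZ tau b o).
have -> : E t (fun f => ind f a * ind f b * ind f b) = P.
  by apply: eq_FE => f; rewrite -mulrA indxx.
have : \sum_(y | (y != a) && (y != b)) E t (fun f => ind f a * ind f b * ind f y) * gt b y
    <= P * rho t o * tau.
  rewrite -[X in _ <= _ * X](sum_green hZ tau b) mulr_sumr [leRHS](bigID (fun y => (y != a) && (y != b))) /=.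
  rewrite -[leLHS]addr0; apply: lerD.
    apply: ler_sum => y /andP[ya yb]; rewrite ler_wpM2r //.
    exact: triple_occ_le.
  by apply: sumr_ge0 => y _; rewrite !mulr_ge0 // rho_ge0.
lra.
Qed.

Lemma energy_upper t o : 0 <= t ->
  E t energy <= N%:R * (gt o o * rho t o + rho t o ^+ 2 * tau).
Proof.
move=> t0; have g0 x y : 0 <= gt x y by exact: green_ge0.
rewrite FE_sum -(sum_cst N (gt o o * rho t o + _)); apply: ler_sum => x _.
rewrite FE_sum (bigD1 x) //=; under eq_FE => f do rewrite indxx.
rewrite FE_mulr -rhoE (green_diag hsym htrans hirr hZ tau x o) (rho_diag t x o) mulrC lerD2l.
rewrite -[X in _ <= _ * X](sum_green hZ tau x) mulr_sumr [leRHS](bigD1 x) //=.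
rewrite -[leLHS]add0r; apply: lerD; first by rewrite mulr_ge0 ?sqr_ge0.
apply: ler_sum => y yx; rewrite FE_mulr ler_wpM2r //.
by apply: pair_occ_le; rewrite // eq_sym.
Qed.

(** [Psi] subtracts from the energy enough multiples of the particle number for each coalescence to
    pay for the energy it destroys. It then grows at least at the rate of the free gain, while
    [energy_upper] limits its final value. *)
Lemma rho_decay s t o : 0 <= s -> s <= t ->
  2 * (t - s) * (rho t o ^+ 2 - rho s o * p tau o o) <=
  (3 * gt o o + 2 * rho s o * tau) * (rho s o - rho t o) +
  gt o o * rho t o + rho t o ^+ 2 * tau.
Proof.
move=> s0 st; have N0 := card_pos R o.
set kap := 3 * gt o o + 2 * rho s o * tau.
pose Psi u := E u energy - kap * (N%:R * rho u o).
have hPsi u : is_derive u (1 : R) Psi _ :=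
  is_derive_sub (FE_derive_l r u energy) (is_derive_mull kap (rho_derive u o)).
have := ger_increment (c := 2 * N%:R * (rho t o ^+ 2 - rho s o * p tau o o)) st hPsi.
move=> hle; have {}hle : 2 * N%:R * (rho t o ^+ 2 - rho s o * p tau o o) * (t - s) <=
    Psi t - Psi s.
  apply: hle => u /andP[su ut]; have u0 : 0 <= u by rewrite (le_trans s0) // ltW.
  under eq_FE => f do rewrite energy_gen.
  rewrite FE_sub FE_mull.
  have h1 := energy_loss o u0.
  have h2 : N%:R * (rho u o ^+ 2 - rho u o * p tau o o) <=
     E u (fun f => \sum_a \sum_(y | y != a) ind f a * ind f y * p tau a y).
    have := FE_le hsym.1 u0 (fun f => pair_kernel_lower f (rho u o) o).
    rewrite !FE_sub !FE_mull FE_cst FE_sum.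
    under eq_bigr => x _ do rewrite -rhoE.
    rewrite (sum_const o (fun x y => rho_diag u x y)) => /(le_trans _); apply.
    by rewrite le_eqVlt; apply/orP; left; apply/eqP; ring.
  have us := rho_decr o s0 (ltW su); have tu := rho_decr o u0 (ltW ut).
  have t0 : 0 <= t by rewrite (le_trans s0).
  have rt := rho_ge0 o t0.
  have c0 := coal_rate_ge0 u0.
  have p0 := p_ge0 hsym o o tau_ge0.
  have h3 : (3 * gt o o + 2 * rho u o * tau) * coal_rate u <= kap * coal_rate u.
    rewrite ler_wpM2r // lerD2l ler_wpM2r // ler_wpM2l //.
  have h4 : N%:R * (rho t o ^+ 2 - rho s o * p tau o o) <=
            N%:R * (rho u o ^+ 2 - rho u o * p tau o o).
    rewrite ler_wpM2l ?(ltW N0) // lerB // ?ler_wpM2r //.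
    by rewrite lerXn2r // nnegrE (le_trans rt).
  rewrite -mulrA mulrN opprK; lra.
have t0 : 0 <= t by rewrite (le_trans s0).
have h1 := energy_upper o t0.
have h2 : 0 <= E s energy.
  apply: FE_ge0 => // f; apply: sumr_ge0 => x _; apply: sumr_ge0 => y _.
  by rewrite !mulr_ge0 ?ind_ge0 // green_ge0.
rewrite -(ler_pM2l N0).
move: hle h1 h2; rewrite /Psi; lra.
Qed.

End Energy.

Lemma green_incr s t o : 0 <= s -> s <= t -> green s o o <= green t o o.
Proof.
move=> s0 st; rewrite -subr_ge0 -[leLHS](mul0r (t - s)).
apply: (ger_increment st (fun u => green_derive hZ u o o)) => u /andP[su _].
by apply: (p_ge0 hsym); rewrite (le_trans s0) // ltW.
Qed.

Lemma green_ge_p t o : 0 <= t -> t * p t o o <= green t o o.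
Proof.
move=> t0; have := ger_increment (c := p t o o) t0 (fun u => green_derive hZ u o o).
rewrite green_0 subr0 subr0 mulrC; apply => u /andP[_ ut].
exact: (p_diag_decr hsym htrans o (ltW ut)).
Qed.

(* Apply [rho_decay] on [t/2, t] with [tau = t/10], at a maximiser [t] of [t * rho t]. *)
Lemma rho_crude T o : 0 <= T -> T * rho T o <= 48 * green T o o.
Proof.
move=> T0; have N0 := card_pos R o.
have rd u : is_derive u (1 : R) (fun s => rho s o) (N%:R^-1 * - coal_rate u).
  have -> : (fun s => rho s o) = (fun s => N%:R^-1 * (N%:R * rho s o)).
    by apply/funext => s; rewrite mulrA mulVf ?mul1r // gt_eqF.
  exact: is_derive_mull (rho_derive u o).
have cont : {within `[0, T], continuous (fun s => s * rho s o)}.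
  apply: continuous_subspaceT => u.
  exact: is_derive_continuous (is_derive_mul (is_derive_var u) (rd u)).
have [t] := EVT_max T0 cont; rewrite in_itv /= => /andP[t0 tT] tmax.
have Tmax := tmax T; rewrite in_itv /= T0 lexx in Tmax.
apply: le_trans (Tmax isT) _.
have rt := rho_ge0 o t0.
have gT := green_ge0 hsym hZ o o T0.
have [tr0|trp] := leP (t * rho t o) 0; first by rewrite (le_trans tr0) // mulr_ge0.
have tpos : 0 < t by rewrite lt_def t0 andbT; apply: contraTneq trp => ->; rewrite mul0r ltxx.
have rpos : 0 < rho t o by move: trp; rewrite pmulr_rgt0.
have t2 : 0 <= t / 2 by lra.
(* This is what the maximiser is for: u * rho(u) is no larger at u = t/2 than at t, so going back
   half the time at most doubles [rho]. *)
have half := tmax (t / 2); rewrite in_itv /= t2 in half.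
have {}half : rho (t / 2) o <= 2 * rho t o.
  have : t / 2 * rho (t / 2) o <= t * rho t o by apply: half; lra.
  move=> h; rewrite -(ler_pM2l tpos); lra.
have tau0 : 0 <= t / 10 by lra.
have t2t : t / 2 <= t by lra.
have := rho_decay tau0 o t2 t2t.
have := green_ge_p o tau0.
have tauT : t / 10 <= T by lra.
have := green_incr o tau0 tauT.
set g := green (t / 10) o o; set G := green T o o; set P := p _ o o.
have g0 : 0 <= g by exact: green_ge0.
have P0 : 0 <= P by exact: p_ge0.
move=> gG Pg.
set x := rho t o in rt rpos half *; set x0 := rho (t / 2) o in half *.
move=> h.
have h1 : (3 * g + 2 * x0 * (t / 10)) * (x0 - x) <= (3 * g + 4 * x * (t / 10)) * x.
  apply: le_trans (_ : (3 * g + 2 * x0 * (t / 10)) * x <= _).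
    apply: ler_wpM2l; last by lra.
    by rewrite addr_ge0 ?mulr_ge0 // rho_ge0.
  by rewrite ler_wpM2r // lerD2l ler_wpM2r //; lra.
have h2 : t * (x ^+ 2 - 2 * x * P) <= 2 * (t - t / 2) * (x ^+ 2 - x0 * P).
  have -> : 2 * (t - t / 2) = t by lra.
  by rewrite ler_wpM2l // lerD2l lerN2 ler_wpM2r.
have h3 : t * (x ^+ 2 - 2 * x * P) <= (3 * g + 4 * x * (t / 10)) * x + g * x + x ^+ 2 * (t / 10).
  lra.
have h4 : x * (t * x - 2 * t * P) <= x * (4 * g + 5 * x * (t / 10)).
  move: h3; lra.
(* Half of t x is absorbed on the left, and t P <= 10 g because tau = t/10; so t x <= 8 g + 40 g,
   the origin of 48. *)
rewrite ler_pM2l // in h4; lra.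
Qed.

End Occupation.

(** * Size and boundary of voter clusters *)

Section VoterCluster.
Variables (R : realType) (N : nat) (r : 'I_N -> 'I_N -> R).
Hypothesis hsym : symmetric_rates r.
Hypothesis htrans : transitive_chain r.
Local Notation V := 'I_N.
Local Notation M := {ffun 'I_N -> 'I_N}.
Local Notation E := (FE r).
Local Notation alpha := (alpha r).
Implicit Types (f g h : M) (a b x y z o : V) (s t lam : R).

Let r0 := rates_ge0 hsym.

Definition cluster_size o f : nat := #|[pred v | f v == o]|.
Definition mass o f : R := \sum_v (f v == o)%:R.
Definition boundary o f : R := \sum_a \sum_b r a b * ((f a == o) && (f b != o))%:R.

Lemma massE o f : mass o f = (cluster_size o f)%:R.
Proof.
rewrite /mass /cluster_size -sum1_card natr_sum [RHS]big_mkcond; apply: eq_bigr => v _ /=.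
by rewrite inE; case: (f v == o).
Qed.

Lemma mass_ge0 o f : 0 <= mass o f.
Proof. by rewrite massE ler0n. Qed.

Lemma boundary_ge0 o f : 0 <= boundary o f.
Proof. by apply: sumr_ge0 => a _; apply: sumr_ge0 => b _; rewrite mulr_ge0 ?r0. Qed.

Lemma boundary_le_mass o f : boundary o f <= mass o f.
Proof.
apply: ler_sum => a _.
rewrite -[leRHS]mul1r -[X in _ <= X * _](sum_rates htrans a) mulr_suml; apply: ler_sum => b _.
by rewrite ler_wpM2l ?r0 // ler_nat; case: (f a == o); case: (f b == o).
Qed.

Lemma cluster_fid o : cluster_size o (fid N) = 1%N.
Proof.
rewrite /cluster_size -(card1 o); apply: eq_card => v.
by rewrite !inE ffunE.
Qed.

Lemma cluster_fmove o f a b :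
  (cluster_size o (fcomp f (fmove a b)) + (f a == o) = cluster_size o f + (f b == o))%N.
Proof.
have h (g : M) : cluster_size o g = ((g a == o) + #|[pred v | (v != a) && (g v == o)]|)%N.
  by rewrite /cluster_size (cardD1 a) inE.
rewrite (h f) (h (fcomp f _)) !ffunE eqxx.
have -> : #|[pred v | (v != a) && (fcomp f (fmove a b) v == o)]| =
          #|[pred v | (v != a) && (f v == o)]|.
  by apply: eq_card => v; rewrite !inE !ffunE; case: eqP.
by rewrite addnAC [RHS]addnAC [((f b == o) + _)%N]addnC.
Qed.

(* The size of the voter cluster is a symmetric random walk run at speed [boundary] *)
Lemma cluster_gen o f (F : nat -> R) :
  \sum_a \sum_b r a b * (F (cluster_size o (fcomp f (fmove a b))) - F (cluster_size o f)) =
  boundary o f * (F (cluster_size o f).+1 + F (cluster_size o f).-1 - 2 * F (cluster_size o f)).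
Proof.
have bsym : boundary o f = \sum_a \sum_b r a b * ((f a != o) && (f b == o))%:R.
  rewrite /boundary exchange_big /=; apply: eq_bigr => a _; apply: eq_bigr => b _.
  by rewrite (ratesC hsym) andbC.
have -> : boundary o f * (F (cluster_size o f).+1 + F (cluster_size o f).-1 - 2 * F (cluster_size o f)) =
   boundary o f * (F (cluster_size o f).-1 - F (cluster_size o f)) +
   boundary o f * (F (cluster_size o f).+1 - F (cluster_size o f)) by ring.
rewrite {1}/boundary bsym !mulr_suml -big_split /=; apply: eq_bigr => a _.
rewrite !mulr_suml -big_split /=; apply: eq_bigr => b _.
have := cluster_fmove o f a b.
case: (f a == o); case: (f b == o); rewrite /= ?addn0 ?addn1 => hk.
- by case: hk => ->; ring.
- by rewrite -hk /=; ring.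
- by rewrite hk; ring.
- by rewrite hk; ring.
Qed.

Lemma mass_mean t o : E t (mass o) = 1.
Proof.
rewrite FE_sum; under eq_bigr => v _ do rewrite -p_tE.
exact: (p_sum_l hsym).
Qed.

Lemma mass_mean_comp t o f : E t (fun g => mass o (fcomp f g)) = mass o f.
Proof.
rewrite /mass FE_sum.
transitivity (\sum_v \sum_w p_t r t v w * (f w == o)%:R).
  apply: eq_bigr => v _; rewrite -(FE_eval r t (fun w => (f w == o)%:R)).
  by apply: eq_FE => g; rewrite ffunE.
rewrite exchange_big /=; apply: eq_bigr => w _.
by rewrite -mulr_suml (p_sum_l hsym) mul1r.
Qed.

(** Mass transport: by transitivity it suffices to sum over [o], and an ordered pair a, b with
    distinct images is then counted exactly once, in the cluster f a. *)
Lemma boundary_mean t o : E t (boundary o) = alpha t o.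
Proof.
have cst x y : E t (boundary x) = E t (boundary y).
  apply: (FE_invariant htrans) => phi z f hphi.
  rewrite /boundary (reindex_inj (@perm_inj _ phi)); apply: eq_bigr => a _.
  rewrite (reindex_inj (@perm_inj _ phi)); apply: eq_bigr => b _.
  by rewrite hphi !ffunE !permK !(inj_eq perm_inj).
have N0 := card_pos R o.
apply: (mulfI (lt0r_neq0 N0)); rewrite -(sum_const o cst).
rewrite -(sum_const o (alpha_diag htrans t)) -FE_sum.
under [RHS]eq_bigr => a _ do rewrite (alphaE htrans).
under [RHS]eq_bigr => a _ do under eq_bigr => b _ do rewrite P_meet_gtE -FE_mull.
under [RHS]eq_bigr => a _ do rewrite -FE_sum.
rewrite -FE_sum; apply: eq_FE => f; rewrite exchange_big /=; apply: eq_bigr => a _.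
rewrite exchange_big /=; apply: eq_bigr => b _; rewrite -mulr_sumr; congr (_ * _).
rewrite (bigD1 (f a)) //= eqxx big1 ?addr0 => [|x xa]; last by rewrite eq_sym (negbTE xa).
by rewrite eq_sym.
Qed.

(* Edges whose two walks both land in the cluster [f^-1(o)] without having met:
   this is what [alpha t o * mass o f] overcounts. *)
Definition internal t o f : R := \sum_a \sum_b r a b *
  E t (fun g => [&& f (g a) == o, f (g b) == o & g a != g b]%:R).

Lemma internal_ge0 t o f : 0 <= t -> 0 <= internal t o f.
Proof.
move=> t0; apply: sumr_ge0 => a _; apply: sumr_ge0 => b _.
by rewrite mulr_ge0 ?r0 // FE_ge0.
Qed.

Lemma boundary_mean_comp t o f :
  E t (fun g => boundary o (fcomp f g)) = alpha t o * mass o f - internal t o f.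
Proof.
have -> : alpha t o * mass o f =
    E t (fun g => \sum_a \sum_b r a b * ((f (g a) == o) && (g a != g b))%:R).
  rewrite mulr_sumr.
  transitivity (E t (fun g => \sum_z (f z == o)%:R * boundary z g)).
    rewrite FE_sum; apply: eq_bigr => z _.
    by rewrite FE_mull boundary_mean (alpha_diag htrans t z o) mulrC.
  apply: eq_FE => g; under eq_bigr => z _ do rewrite mulr_sumr.
  rewrite exchange_big /=; apply: eq_bigr => a _.
  under eq_bigr => z _ do rewrite mulr_sumr.
  rewrite exchange_big /=; apply: eq_bigr => b _.
  rewrite (bigD1 (g a)) //= eqxx [X in _ + X]big1 ?addr0 => [|z za]; last first.
    by rewrite [g a == z]eq_sym (negbTE za) !mulr0.
  by rewrite /= mulrCA -natrM mulnb [g b == _]eq_sym.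
rewrite /internal.
under [X in _ = _ - X]eq_bigr => a _ do under eq_bigr => b _ do rewrite -FE_mull.
under [X in _ = _ - X]eq_bigr => a _ do rewrite -FE_sum.
rewrite -FE_sum -FE_sub; apply: eq_FE => g.
rewrite -sumrB; apply: eq_bigr => a _; rewrite -sumrB; apply: eq_bigr => b _.
rewrite !ffunE -mulrBr; congr (_ * _).
have [->|_] := eqVneq (g a) (g b).
  by rewrite !andbF andbN subrr.
by rewrite !andbT; case: (f (g a) == o); case: (f (g b) == o); rewrite /= ?subrr ?subr0.
Qed.

(** Take means in [boundary_mean_comp], the mean mass being 1. The overcount is thus small as soon
    as [alpha] has nearly settled by time [d]. *)
Lemma internal_mean s d o : E s (internal d o) = alpha d o - alpha (d + s) o.
Proof.
rewrite -(boundary_mean (d + s)) FE_comp FE_exchange.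
under [in RHS]eq_FE => g do rewrite boundary_mean_comp.
by rewrite FE_sub FE_mull mass_mean mulr1 opprB addrC subrK.
Qed.

Lemma mass2_derive t o :
  is_derive t (1 : R) (fun u => E u (fun f => mass o f ^+ 2)) (E t (fun f => 2 * boundary o f)).
Proof.
apply: is_derive_eq (FE_derive_l r t _) _; rewrite FE_gen_lr; apply: eq_FE => f.
under eq_bigr => a _ do under eq_bigr => b _ do rewrite !massE.
rewrite (cluster_gen o f (fun k => k%:R ^+ 2)).
(* For an empty cluster the predecessor is truncated to 0 and the second difference is wrong, but
   the boundary is then zero. *)
case hk: (cluster_size o f) => [|k] /=; last by rewrite -!natr1; ring.
have : boundary o f <= 0 by rewrite (le_trans (boundary_le_mass o f)) // massE hk.
by move=> h; have -> : boundary o f = 0 by [apply/eqP; rewrite eq_le h boundary_ge0]; ring.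
Qed.

Lemma mass2_increment s t o : 0 <= s -> s <= t ->
  E t (fun f => mass o f ^+ 2) - E s (fun f => mass o f ^+ 2) <= 2 * (t - s).
Proof.
move=> s0 st; apply: (ler_increment st (fun u => mass2_derive u o)) => u /andP[su _].
rewrite FE_mull ler_piMr // -[leRHS](mass_mean u o); apply: FE_le => // [|f].
  by rewrite (le_trans s0) // ltW.
exact: boundary_le_mass.
Qed.

Lemma mass2_le t o : 0 <= t -> E t (fun f => mass o f ^+ 2) <= 1 + 2 * t.
Proof.
move=> t0; have := mass2_increment o (lexx 0) t0.
by rewrite FE_0 massE cluster_fid expr1n; lra.
Qed.

Lemma expr_pred_lipschitz (x : R) (i j : nat) : 0 <= x <= 1 ->
  `|x ^+ i.-1 - x ^+ j.-1| <= (1 - x) * `|i%:R - j%:R|.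
Proof.
move=> /andP[x0 x1].
have h (m n : nat) : (m <= n)%N -> `|x ^+ m - x ^+ n| <= (1 - x) * (n - m)%:R.
  move=> mn; rewrite -{1}(subnKC mn); elim: (n - m)%N => [|l IH].
    by rewrite addn0 subrr normr0 mulr0.
  apply: le_trans (ler_distD (x ^+ (m + l)) _ _) _.
  rewrite -natr1 mulrDr mulr1 lerD // addnS exprS.
  have -> : x ^+ (m + l) - x * x ^+ (m + l) = (1 - x) * x ^+ (m + l) by ring.
  rewrite normrM !ger0_norm ?exprn_ge0 ?subr_ge0 //.
  by rewrite ler_piMr ?subr_ge0 ?exprn_ile1.
have h' (m n : nat) : (m <= n)%N -> `|x ^+ m.-1 - x ^+ n.-1| <= (1 - x) * `|m%:R - n%:R|.
  move=> mn; apply: le_trans (h _ _ (_ : (m.-1 <= n.-1)%N)) _; first by case: m n mn => [|m] [|n].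
  rewrite ler_wpM2l ?subr_ge0 // distrC ger0_norm ?subr_ge0 ?ler_nat //.
  by rewrite -natrB // ler_nat; case: m n mn => [|m] [|n] //= _; rewrite subn0.
have [ij|/ltnW ji] := leqP i j; first exact: h'.
by rewrite distrC [X in _ * X]distrC; exact: h'.
Qed.

(* Going back a time [d], the boundary of the cluster is compared with the size
   of the cluster [d] earlier; the size itself moves little during that time. *)
Lemma boundary_defect lam d s o (theta : R) :
  0 <= lam <= 1 -> 0 <= d -> 0 <= s -> 0 < theta ->
  `|E (d + s) (fun f => (1 - lam) ^+ (cluster_size o f).-1 *
      (boundary o f - alpha d o * mass o f))| <=
  (alpha d o - alpha (d + s) o) +
  lam / 2 * (theta * (1 + 2 * (d + s)) + theta^-1 * (2 * d)).
Proof.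
move=> /andP[l0 l1] d0 s0 th0; set al := alpha d o.
have al0 : 0 <= al by exact: alpha_ge0.
have al1 : al <= 1 by exact: alpha_le1.
have ds0 : 0 <= d + s by rewrite addr_ge0.
pose psi f := (1 - lam) ^+ (cluster_size o f).-1.
have psi01 f : 0 <= psi f <= 1.
  by rewrite /psi exprn_ge0 ?subr_ge0 // exprn_ile1 ?subr_ge0 // lerBlDr lerDl.
pose W f := boundary o f - al * mass o f.
have WM f : `|W f| <= mass o f.
  have := boundary_ge0 o f; have := boundary_le_mass o f; have := mass_ge0 o f.
  move=> m0 bm b0; rewrite ler_norml /W.
  have : al * mass o f <= mass o f by rewrite ler_piMl.
  have : 0 <= al * mass o f by rewrite mulr_ge0.
  lra.
(* Here [g] describes the cluster a time [d] earlier. The weight is frozen at [g], under which the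
   mean of [W] is exactly minus [internal]; the change of the weight is treated separately. *)
have -> : E (d + s) (fun f => psi f * W f) =
   E s (fun g => E d (fun h => (psi (fcomp g h) - psi g) * W (fcomp g h))) -
   E s (fun g => psi g * internal d o g).
  rewrite FE_comp FE_exchange -FE_sub; apply: eq_FE => g.
  have -> : psi g * internal d o g = - (psi g * E d (fun h => W (fcomp g h))).
    by rewrite FE_sub FE_mull mass_mean_comp boundary_mean_comp -/al; ring.
  rewrite opprK -FE_mull -FE_add; apply: eq_FE => h; ring.
rewrite [leRHS]addrC; apply: le_trans (ler_normB _ _) _; apply: lerD; last first.
  rewrite -internal_mean; apply: le_trans (FE_norm r0 _ s0) _.
  apply: (FE_le r0) => // g; have i0 := internal_ge0 o g d0.
  by have /andP[p0 p1] := psi01 g; rewrite normrM !ger0_norm // ler_piMl.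
(* AM-GM with weight [theta] splits the change of size times the size into a second moment, of order
   the total time, and a squared increment, of order [d]. *)
pose Q g h := lam / 2 * (theta * mass o (fcomp g h) ^+ 2 +
   theta^-1 * (mass o (fcomp g h) - mass o g) ^+ 2).
apply: le_trans (_ : E s (fun g => E d (Q g)) <= _).
  apply: le_trans (FE_norm r0 _ s0) _; apply: (FE_le r0) => // g.
  apply: le_trans (FE_norm r0 _ d0) _; apply: (FE_le r0) => // h.
  rewrite normrM; set m := mass o (fcomp g h); set m' := mass o g.
  apply: le_trans (_ : lam * `|m - m'| * m <= _).
    apply: ler_pM => //.
    rewrite /psi /m /m' !massE; apply: le_trans (expr_pred_lipschitz _ _ _) _.
      by rewrite subr_ge0 l1 lerBlDr lerDl.
    by rewrite opprB addrC subrK.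
  rewrite /Q -/m -/m' -mulrA -mulrA ler_wpM2l //.
  rewrite -[X in _ + _ * X]real_normK ?num_real //.
  set D := `|m - m'|.
  have := sqr_ge0 (theta * m - D); rewrite -(pmulr_rge0 _ (_ : 0 < theta^-1)) ?invr_gt0 //.
  have -> : theta^-1 * (theta * m - D) ^+ 2 = theta * m ^+ 2 + theta^-1 * D ^+ 2 - 2 * (D * m).
    by field; rewrite gt_eqF.
  lra.
have hQ g : E d (Q g) = lam / 2 * (theta * E d (fun h => mass o (fcomp g h) ^+ 2) +
    theta^-1 * (E d (fun h => mass o (fcomp g h) ^+ 2) - mass o g ^+ 2)).
  rewrite /Q FE_mull FE_add !FE_mull; congr (_ * (_ + _ * _)).
  transitivity (E d (fun h => mass o (fcomp g h) ^+ 2 -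
     (2 * mass o g * mass o (fcomp g h) - mass o g ^+ 2))).
    by apply: eq_FE => h; ring.
  rewrite !FE_sub FE_mull FE_cst mass_mean_comp; ring.
under eq_FE => g do rewrite hQ.
rewrite FE_mull FE_add !FE_mull FE_sub -(FE_exchange r d s (fun h g => mass o (fcomp g h) ^+ 2)).
rewrite -(FE_comp r d s (fun f => mass o f ^+ 2)).
apply: ler_wpM2l; first by lra.
apply: lerD; apply: ler_wpM2l; rewrite ?invr_ge0 ?(ltW th0) //; first exact: mass2_le.
have := mass2_increment o s0 (_ : s <= d + s); rewrite lerDr => /(_ d0).
by rewrite addrK.
Qed.

(* [lam] solves [lam' = - al lam^2], the equation of the log-Laplace exponent of
   Feller's diffusion with branching rate [al]. *)
Let lamf (al l0 u : R) := l0 / (1 + al * l0 * u).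

Let lamf_derive (al l0 u : R) : 0 < 1 + al * l0 * u ->
  is_derive u (1 : R) (lamf al l0) (- al * lamf al l0 u ^+ 2).
Proof.
move=> h.
have h1 := is_derive_affine 1 (al * l0) u.
have h2 := @is_deriveV R (fun v => 1 + al * l0 * v) u (al * l0) 1 (lt0r_neq0 h) h1.
apply: is_derive_eq (is_derive_mull l0 h2) _.
rewrite /lamf /GRing.scale /=; field.
by rewrite gt_eqF.
Qed.

(** Run the exponent backwards along [lamf] while the cluster evolves. If the boundary were exactly
    [alpha d o] times the mass, [G] would be constant; its derivative is the quantity of
    [boundary_defect] times the squared exponent. *)
Lemma cluster_laplace (l0 d T : R) o (theta : R) :
  0 <= l0 <= 1 -> 0 <= d -> d <= T -> 0 < theta ->
  `|E T (fun f => 1 - (1 - l0) ^+ cluster_size o f) - l0 / (1 + alpha d o * l0 * T)| <=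
  l0 ^+ 2 * (d + T * ((alpha d o - alpha T o) +
    l0 / 2 * (theta * (1 + 2 * T) + theta^-1 * (2 * d)))).
Proof.
move=> /andP[l0ge l0le] d0 dT th0; set al := alpha d o.
have T0 : 0 <= T by rewrite (le_trans d0).
have al0 : 0 <= al by exact: alpha_ge0.
have al1 : al <= 1 by exact: alpha_le1.
pose L u := lamf al l0 (T - u).
have pos u : 0 <= u <= T -> 0 < 1 + al * l0 * (T - u).
  by move=> /andP[_ uT]; rewrite ltr_pwDl // mulr_ge0 ?subr_ge0 //; exact: mulr_ge0.
have L01 u : 0 <= u <= T -> 0 <= L u <= l0.
  move=> uT; have h := pos u uT; rewrite /L /lamf divr_ge0 ?(ltW h) //= ler_pdivrMr //.
  have /andP[_ uT'] := uT; by rewrite ler_peMr // lerDl mulr_ge0 ?subr_ge0 //; exact: mulr_ge0.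
pose G u := E u (fun f => (1 - L u) ^+ cluster_size o f).
pose dG u := L u ^+ 2 * E u (fun f => (1 - L u) ^+ (cluster_size o f).-1 *
   (boundary o f - al * mass o f)).
have hG u : 0 <= u <= T -> is_derive u (1 : R) G (dG u).
  move=> uT.
  have hL : is_derive u (1 : R) (fun v => 1 - L v) (- (al * L u ^+ 2)).
    have h1 := is_derive_comp_sub (lamf_derive (pos u uT)).
    apply: is_derive_eq (is_derive_sub (is_derive_const 1 u) h1) _.
    by rewrite -/(L u); ring.
  have hX f : is_derive u (1 : R) (fun v => (1 - L v) ^+ cluster_size o f)
     (- (al * L u ^+ 2) * (mass o f * (1 - L u) ^+ (cluster_size o f).-1)).
    apply: is_derive_eq (is_derive_exprn (cluster_size o f) hL) _.
    by rewrite massE mulrC.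
  apply: is_derive_eq (FE_derive_time r hX) _.
  rewrite (FE_gen_lr r u (fun f => (1 - L u) ^+ cluster_size o f)) -FE_add /dG -FE_mull.
  apply: eq_FE => f; rewrite (cluster_gen o f (fun k => (1 - L u) ^+ k)) massE.
  (* With x = 1 - lam the second difference x^(k+1) + x^(k-1) - 2x^k equals lam^2 x^(k-1), which
     explains the predecessor in the exponent of [dG]. *)
  case hk : (cluster_size o f) => [|k] /=; last by rewrite !exprS; ring.
  have : boundary o f <= 0 by rewrite (le_trans (boundary_le_mass o f)) // massE hk.
  move=> h; have -> : boundary o f = 0 by apply/eqP; rewrite eq_le h boundary_ge0.
  ring.
pose eps := (al - alpha T o) + l0 / 2 * (theta * (1 + 2 * T) + theta^-1 * (2 * d)).
have dG1 u : 0 <= u <= T -> `|dG u| <= l0 ^+ 2.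
  move=> uT; have /andP[L0 Ll] := L01 u uT; have /andP[u0 _] := uT.
  rewrite normrM ger0_norm ?sqr_ge0 // -[leRHS]mulr1; apply: ler_pM => //.
    exact: sqr_ge0.
    by rewrite lerXn2r // nnegrE.
  rewrite -[leRHS](mass_mean u o); apply: le_trans (FE_norm r0 _ u0) _.
  apply: (FE_le r0) => // f; rewrite normrM.
  have L1 : L u <= 1 by rewrite (le_trans Ll).
  rewrite ger0_norm ?exprn_ge0 ?subr_ge0 //.
  have b0 := boundary_ge0 o f; have bm := boundary_le_mass o f.
  have m0 := mass_ge0 o f.
  apply: le_trans (_ : `|boundary o f - al * mass o f| <= _).
    by rewrite ler_piMl // exprn_ile1 ?subr_ge0 // lerBlDr lerDl.
  have : al * mass o f <= mass o f by rewrite ler_piMl.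
  have : 0 <= al * mass o f by rewrite mulr_ge0.
  rewrite ler_norml; lra.
have dG2 u : d <= u <= T -> `|dG u| <= l0 ^+ 2 * eps.
  move=> /andP[du uT]; have u0 : 0 <= u by rewrite (le_trans d0).
  have uT' : 0 <= u <= T by rewrite u0.
  have /andP[L0 Ll] := L01 u uT'.
  rewrite normrM ger0_norm ?sqr_ge0 //; apply: ler_pM => //; first exact: sqr_ge0.
    by rewrite lerXn2r // nnegrE.
  have ud0 : 0 <= u - d by rewrite subr_ge0.
  have L1 : 0 <= L u <= 1 by rewrite L0 (le_trans Ll).
  have := boundary_defect o L1 d0 ud0 th0; rewrite [d + _]addrC subrK -/al => /le_trans; apply.
  rewrite /eps; apply: lerD; first by rewrite lerD2l lerN2; apply: alpha_decr.
  have ti : 0 <= theta^-1 by rewrite invr_ge0 ltW.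
  apply: ler_pM; [lra| |lra|].
    by rewrite addr_ge0 // mulr_ge0 ?(ltW th0) //; lra.
  by rewrite lerD2r ler_wpM2l ?(ltW th0) //; lra.
have Gc u : 0 <= u <= T -> {for u, continuous G}.
  by move=> uT; exact: is_derive_continuous (hG u uT).
have bnd (a b c : R) : 0 <= a -> a <= b -> b <= T ->
    (forall u, a <= u <= b -> `|dG u| <= c) -> `|G b - G a| <= c * (b - a).
  move=> a0 ab bT hc.
  have in1 u : a <= u <= b -> 0 <= u <= T.
    by move=> /andP[au ub]; rewrite (le_trans a0 au) (le_trans ub bT).
  have in2 u : a < u < b -> a <= u <= b by move=> /andP[/ltW -> /ltW ->].
  rewrite ler_norml; apply/andP; split.
    have := @ler_increment_of_derive R (fun u => - G u) (fun u => - dG u) a b c ab.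
    move=> H; suff : - G b - - G a <= c * (b - a) by lra.
    apply: H => u hu.
    - by apply: is_derive_opp; apply: hG; exact: in1 (in2 _ hu).
    - by apply: continuousN; apply: Gc; exact: in1.
    - by have := hc u (in2 _ hu); rewrite ler_norml => /andP[]; lra.
  apply: (@ler_increment_of_derive R G dG) => // u hu.
  - by apply: hG; exact: in1 (in2 _ hu).
  - by apply: Gc; exact: in1.
  - by have := hc u (in2 _ hu); rewrite ler_norml => /andP[].
(* Before time [d] there is no cluster a time [d] earlier to compare with, so only the trivial bound
   on [dG] is used. *)
have h1 := bnd 0 d (l0 ^+ 2) (lexx 0) d0 dT.
have {}h1 : `|G d - G 0| <= l0 ^+ 2 * d.
  rewrite -[X in _ <= _ * X]subr0; apply: h1 => u /andP[u0 ud].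
  by apply: dG1; rewrite u0 (le_trans ud).
have {}h2 : `|G T - G d| <= l0 ^+ 2 * eps * (T - d) by apply: bnd.
have eps0 : 0 <= eps.
  rewrite addr_ge0 //; first by rewrite subr_ge0; apply: alpha_decr.
  rewrite mulr_ge0 ?divr_ge0 // addr_ge0 ?mulr_ge0 ?invr_ge0 ?(ltW th0) //; lra.
have h3 : l0 ^+ 2 * eps * (T - d) <= l0 ^+ 2 * eps * T.
  by rewrite ler_wpM2l ?mulr_ge0 ?sqr_ge0 // lerBlDr lerDl.
have GT : G T = E T (fun f => (1 - l0) ^+ cluster_size o f).
  by rewrite /G /L /lamf subrr mulr0 addr0 divr1.
have G0 : G 0 = 1 - l0 / (1 + al * l0 * T).
  by rewrite /G FE_0 cluster_fid expr1 /L /lamf subr0.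
rewrite FE_sub FE_cst -GT.
have -> : 1 - G T - l0 / (1 + al * l0 * T) = - ((G T - G d) + (G d - G 0)).
  by rewrite G0; ring.
rewrite normrN; apply: le_trans (ler_normD _ _) _.
rewrite -/eps; lra.
Qed.

Lemma ind_cluster f o : ind R f o = (cluster_size o f != 0%N)%:R.
Proof.
rewrite /ind; congr (nat_of_bool _)%:R; apply/imsetP/idP => [[v _ vE]|].
  by rewrite -lt0n; apply/card_gt0P; exists v; rewrite inE vE.
by rewrite -lt0n => /card_gt0P[v]; rewrite inE => /eqP vE; exists v.
Qed.

Lemma rho_lower (l0 T : R) o : 0 <= l0 <= 1 -> 0 <= T ->
  E T (fun f => 1 - (1 - l0) ^+ cluster_size o f) <= rho r T o.
Proof.
move=> /andP[l0ge l1] T0; rewrite rhoE; apply: (FE_le r0) => // f; rewrite ind_cluster.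
case: (cluster_size o f) => [|k] /=; first by rewrite expr0 subrr.
by rewrite lerBlDr lerDl exprn_ge0 ?subr_ge0.
Qed.

(** 1 - (1-x)^k is x times the sum of (1-x)^i over i < k, and every term is at least (1-x)^k. It
    yields k (1-x)^k <= 1/x, uniformly in k. *)
Lemma geometric_bound (x : R) (k : nat) : 0 <= x <= 1 ->
  k%:R * x * (1 - x) ^+ k <= 1 - (1 - x) ^+ k.
Proof.
move=> /andP[x0 x1]; elim: k => [|k IH]; first by rewrite !mul0r expr0 subrr.
have y0 : 0 <= (1 - x) ^+ k by rewrite exprn_ge0 ?subr_ge0.
have y1 : (1 - x) ^+ k <= 1 by rewrite exprn_ile1 ?subr_ge0 // lerBlDr lerDl.
rewrite exprS -natr1; set y := (1 - x) ^+ k in IH y0 y1 *.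
have x1' : 0 <= 1 - x by rewrite subr_ge0.
have -> : (k%:R + 1) * x * ((1 - x) * y) = (1 - x) * (k%:R * x * y + x * y) by ring.
apply: le_trans (_ : (1 - x) * (1 - y + x * y) <= _).
  by rewrite ler_wpM2l // lerD2r.
have -> : 1 - y + x * y = 1 - (1 - x) * y by ring.
rewrite ler_piMl // ?lerBlDr ?lerDl // subr_ge0.
by rewrite mulr_ile1 //; lra.
Qed.

(** After a further time [u], a nonempty cluster of size k survives with probability X at most 1 and
    at most k [rho r u o]. With y = (1-l0)^k, use the first bound in (1-y)X and the second in yX,
    where k y <= 1/l0. *)
Lemma rho_upper (l0 T u : R) o : 0 < l0 <= 1 -> 0 <= T -> 0 <= u ->
  rho r (u + T) o <= E T (fun f => 1 - (1 - l0) ^+ cluster_size o f) +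
    rho r T o * rho r u o / l0.
Proof.
move=> /andP[l0p l1] T0 u0; have l01 : 0 <= l0 <= 1 by rewrite ltW.
rewrite [leLHS]rhoE FE_comp FE_exchange.
rewrite [rho r T o]rhoE -mulrA -FE_mulr -FE_add; apply: (FE_le r0) => // g.
set X := E u _.
have X1 : X <= ind R g o.
  rewrite -[leRHS](FE_cst r u); apply: (FE_le r0) => // h; rewrite /ind ler_nat.
  case: (boolP (o \in Img (fcomp g h))) => // /imsetP[v _ ->].
  by rewrite ffunE mem_Img.
have Xm : X <= (cluster_size o g)%:R * rho r u o.
  rewrite -massE mulr_suml; under eq_bigr => w _ do rewrite (rho_diag htrans u o w) rhoE -FE_mull.
  rewrite -FE_sum; apply: (FE_le r0) => // h.
  rewrite {1}/ind; case: (boolP (o \in Img (fcomp g h))) => [/imsetP[v _]|_].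
    rewrite ffunE => oE; rewrite (bigD1 (h v)) //= -oE eqxx mul1r /ind mem_Img lerDl.
    by apply: sumr_ge0 => w _; rewrite mulr_ge0.
  by apply: sumr_ge0 => w _; rewrite mulr_ge0 // ind_ge0.
have ru := rho_ge0 hsym o u0.
move: X1 Xm; rewrite ind_cluster; case hk : (cluster_size o g) => [|k] /= X1 Xm.
  by rewrite expr0 subrr mul0r addr0.
have := geometric_bound k.+1 l01; set y := (1 - l0) ^+ k.+1 => hy.
have y0 : 0 <= y by rewrite exprn_ge0 // subr_ge0.
have y1 : y <= 1 by rewrite exprn_ile1 ?subr_ge0 // lerBlDr lerDl ltW.
have hy2 : k.+1%:R * y <= l0^-1.
  by rewrite -[leRHS]mul1r ler_pdivlMr //; lra.
have -> : X = (1 - y) * X + y * X by ring.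
rewrite mul1r; apply: lerD; first by rewrite ler_piMr // subr_ge0.
apply: le_trans (ler_wpM2l y0 Xm) _.
have -> : y * (k.+1%:R * rho r u o) = rho r u o * (k.+1%:R * y) by ring.
by rewrite ler_wpM2l.
Qed.

End VoterCluster.

(** * Quantitative estimates for one chain *)

Section SingleChainEstimates.
Variables (R : realType) (N : nat) (r : 'I_N -> 'I_N -> R).
Hypothesis hsym : symmetric_rates r.
Hypothesis htrans : transitive_chain r.
Hypothesis hirr : irreducible r.
Variable Z : 'I_N -> 'I_N -> R.
Hypothesis hZ : fundamental r Z.
Variable o : 'I_N.
Local Notation p := (p_t r).
Local Notation PZ := (PZ r Z).
Local Notation gr := (green r Z).
Local Notation alpha := (alpha r).
Local Notation E := (FE r).

Lemma green_integral (a b : R) : a < b ->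
  (\int[lebesgue_measure]_(t in `[a, b]) p t o o)%R = gr b o o - gr a o o.
Proof.
move=> ab; have d t := green_derive hZ t o o.
rewrite /Rintegral (@continuous_FTC2 _ _ (fun t => gr t o o)) //.
- by apply: continuous_subspaceT => t; exact: is_derive_continuous (p_derive r t o o).
- split.
  + by move=> t _; have [] := d t.
  + by apply: cvg_at_right_filter; exact: is_derive_continuous (d a).
  + by apply: cvg_at_left_filter; exact: is_derive_continuous (d b).
- by move=> t _; rewrite derive1E (@derive_val _ _ _ _ _ _ _ (d t)).
Qed.

Lemma PZ_nonincr (u v : R) : u <= v -> PZ v o o <= PZ u o o.
Proof.
move=> uv; have /andP[h _] := PZ_diag_decr hsym htrans hZ o uv.
have := p_diag_ge hsym htrans v o; rewrite -subr_ge0 => h'.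
by rewrite -subr_ge0; apply: le_trans h; rewrite mulr_ge0 // subr_ge0.
Qed.

(* If [t_rel] is large compared with [s] this is the transience integral;
   otherwise the spectral gap makes the tail small. *)
Lemma PZ_tail_bound (s e : R) : (1 < N)%N -> 1 <= s ->
  (\int[lebesgue_measure]_(t in `[Num.min s (t_rel r), t_rel r]) p t o o)%R <= e ->
  0 <= e -> PZ (4 * s ^+ 3) o o <= 3 * e + s^-1.
Proof.
move=> N1 s1 he e0; have trel0 := t_rel_gt0 hsym htrans hirr N1.
set tr := t_rel r in he trel0 *.
have s0 : 0 < s by rewrite (lt_le_trans ltr01).
have Ni : 0 <= N%:R^-1 :> R by rewrite invr_ge0.
have si : 0 <= s^-1 by rewrite invr_ge0 ltW.
have s3 : 2 * s <= 4 * s ^+ 3.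
  have : 1 <= s ^+ 2 by rewrite exprn_ege1.
  rewrite exprS; nra.
have [trs|trs] := leP (2 * s) tr.
  have str : s < tr by lra.
  move: he; rewrite minElt str green_integral // => he.
  apply: le_trans (PZ_nonincr s3) _.
  have g1 : gr s o o <= gr (2 * s) o o.
    by apply: (green_incr hsym hZ); lra.
  have g2 : gr s o o <= gr (tr / 2) o o.
    by apply: (green_incr hsym hZ); lra.
  (* The second half of the transience window forces tr p_tr(o,o) <= 2e, and [PZ_le_t_rel] turns
     this into a tail of at most 2e beyond t_rel; with the window itself, 3e. *)
  have g3 : (tr / 2) * p tr o o <= gr tr o o - gr (tr / 2) o o.
    have tr2 : tr / 2 <= tr by lra.
    have := ger_increment (c := p tr o o) tr2 (fun u => green_derive hZ u o o).
    rewrite (_ : tr - tr / 2 = tr / 2); last by lra.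
    move=> h; rewrite mulrC; apply: h => u /andP[_ ut].
    exact: (p_diag_decr hsym htrans o (ltW ut)).
  have h4 := PZ_le_t_rel hsym htrans hirr N1 hZ tr o.
  have h5 : tr * (p tr o o - N%:R^-1) <= tr * p tr o o.
    by rewrite ler_wpM2l ?(ltW trel0) // lerBlDr lerDl.
  have h6 : (2 * s) / N%:R <= tr / N%:R by rewrite ler_wpM2r.
  have h7 : PZ (2 * s) o o = gr tr o o - gr (2 * s) o o + PZ tr o o
      - (tr / N%:R - 2 * s / N%:R) by rewrite /green; ring.
  rewrite h7 -/tr in h4 *; lra.
(* Now t_rel <= 2s, and applying [PZ_le_t_rel] at times 0 and t gives t PZ(t) <= t_rel^2 <= 4 s^2.
   The time 4 s^3 is chosen to make this 1/s. *)
have t0 : 0 < 4 * s ^+ 3 by rewrite mulr_gt0 // exprn_gt0.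
set t := 4 * s ^+ 3 in t0 *.
have h1 := PZ_le_t_rel hsym htrans hirr N1 hZ t o.
have h2 := PZ_le_t_rel hsym htrans hirr N1 hZ 0 o.
have /andP[h3 _] := PZ_diag_decr hsym htrans hZ o (ltW t0).
have h4 := PZ_diag_ge0 hsym hZ t o.
rewrite p_0 eqxx -[true%:R]/(1 : R) -/tr in h2; rewrite -/tr in h1; rewrite subr0 in h3.
have h5 : tr * (1 - N%:R^-1) <= tr by rewrite ler_piMr ?(ltW trel0) // lerBlDr lerDl.
have h6 : t * (p t o o - N%:R^-1) <= tr by lra.
have h7 : t * PZ t o o <= (2 * s) * (2 * s).
  apply: le_trans (_ : tr * tr <= _); last by rewrite ler_pM // ltW.
  apply: le_trans (_ : t * (tr * (p t o o - N%:R^-1)) <= _).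
    by rewrite ler_wpM2l // ltW.
  by rewrite mulrCA ler_wpM2l // ltW.
have h8 : PZ t o o <= s^-1.
  rewrite -(ler_pM2l t0); apply: le_trans h7 _; rewrite /t.
  rewrite (_ : 4 * s ^+ 3 / s = 2 * s * (2 * s)) //; field; by rewrite gt_eqF.
lra.
Qed.

Lemma green_le s : 0 <= s -> gr s o o <= Z o o + s / N%:R.
Proof.
by move=> s0; have := PZ_diag_ge0 hsym hZ s o; rewrite /green; lra.
Qed.

Lemma Z_diag_le s : 0 <= s -> Z o o <= s + PZ s o o.
Proof.
move=> s0.
have : gr s o o <= s.
  rewrite -[leRHS](sum_green hZ s o) (bigD1 o) //= lerDl.
  by apply: sumr_ge0 => y _; exact: green_ge0.
have : 0 <= s / N%:R by rewrite divr_ge0.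
rewrite /green; lra.
Qed.

(** * Occupation bounds at a fixed scale *)

Section Scale.
Variables (w K C eta : R).
Hypotheses (w0 : 0 < w) (w1 : w <= 1) (K1 : 1 <= K).
(* With [w] small, [d = sqrt T] is an intermediate time scale, and [w] also
   serves as the weight [theta] of [cluster_laplace]. *)
Let T := (w ^+ 4)^-1.
Let d := (w ^+ 2)^-1.
Hypotheses (KT : K <= T) (Zge : 2^-1 <= Z o o) (Zle : Z o o <= C).
Hypotheses (eta0 : 0 <= eta) (eta1 : 2 * eta <= 1).
Hypotheses (alpha_d : `|alpha d o * Z o o - 1| <= eta)
           (alpha_T : `|alpha T o * Z o o - 1| <= eta).

Let T0 : 0 < T. Proof. by rewrite invr_gt0 exprn_gt0. Qed.
Let d0 : 0 < d. Proof. by rewrite invr_gt0 exprn_gt0. Qed.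
Let dT : d <= T.
Proof.
rewrite lef_pV2 ?posrE ?exprn_gt0 // -[4%N]/(2 + 2)%N exprD ler_piMl ?exprn_ge0 ?(ltW w0) //.
by rewrite exprn_ile1 // ltW.
Qed.
Let K0 : 0 < K. Proof. by rewrite (lt_le_trans ltr01). Qed.
Let z0 : 0 < Z o o. Proof. by rewrite (lt_le_trans _ Zge) // invr_gt0. Qed.

Let lap := E T (fun f => 1 - (1 - K / T) ^+ cluster_size o f).

Let l01 : 0 <= K / T <= 1.
Proof. by rewrite divr_ge0 ?(ltW T0) ?(ltW K0) //= ler_pdivrMr // mul1r. Qed.

Lemma laplace_scaled :
  `|T * lap - K / (1 + alpha d o * K)| <= 4 * K ^+ 3 * (eta + w).
Proof.
have := cluster_laplace hsym htrans o l01 (ltW d0) dT w0; rewrite -/lap.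
have al0 : 0 <= alpha d o by apply: alpha_ge0 => //; exact: ltW.
have hpos : 0 < 1 + alpha d o * K by rewrite ltr_pwDl // mulr_ge0 // ltW.
set X := `|lap - _| => hX.
have -> : `|T * lap - K / (1 + alpha d o * K)| = T * X.
  have e1 : alpha d o * (K / T) * T = alpha d o * K.
    by rewrite -mulrA divfK ?gt_eqF.
  have e2 : T * (K / T / (1 + alpha d o * K)) = K / (1 + alpha d o * K).
    by rewrite mulrA [T * _]mulrC divfK ?gt_eqF.
  transitivity (`|T| * X); last by rewrite ger0_norm ?(ltW T0).
  by rewrite /X e1 -normrM mulrBr e2.
apply: le_trans (ler_wpM2l (ltW T0) hX) _.
have diff : alpha d o - alpha T o <= 4 * eta.
  move: alpha_d alpha_T; rewrite !ler_norml => /andP[h1 h2] /andP[h3 h4].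
  have h5 : (alpha d o - alpha T o) * Z o o <= 2 * eta by lra.
  have [neg|pos] := leP (alpha d o - alpha T o) 0; first by rewrite (le_trans neg) // mulr_ge0.
  have : (alpha d o - alpha T o) * 2^-1 <= (alpha d o - alpha T o) * Z o o.
    by rewrite ler_wpM2l // ltW.
  lra.
(* The choice of scales balances the errors: theta T and d/theta are both w^-3, and after the
   normalization by T every error not involving [alpha] is a positive power of w. *)
have -> : T * ((K / T) ^+ 2 * (d + T * (alpha d o - alpha T o +
     K / T / 2 * (w * (1 + 2 * T) + w^-1 * (2 * d))))) =
   K ^+ 2 * (w ^+ 2) + K ^+ 2 * (alpha d o - alpha T o) + K ^+ 3 * (w ^+ 5 / 2 + 2 * w).
  by rewrite /T /d; field; rewrite gt_eqF.
have K2 : K ^+ 2 <= K ^+ 3 by rewrite [leRHS]exprS ler_peMl // exprn_ge0 // ltW.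
have k2 : 0 <= K ^+ 2 by rewrite exprn_ge0 // ltW.
have k3 : 0 <= K ^+ 3 by rewrite exprn_ge0 // ltW.
have w2 : w ^+ 2 <= w by rewrite expr2 ler_piMl // ltW.
have w5 : w ^+ 5 <= w by rewrite exprS ler_piMr ?(ltW w0) // exprn_ile1 // ltW.
have w20 : 0 <= w ^+ 2 by rewrite exprn_ge0 // ltW.
have a1 : K ^+ 2 * w ^+ 2 <= K ^+ 3 * w by apply: ler_pM.
have a2 : K ^+ 2 * (alpha d o - alpha T o) <= K ^+ 3 * (4 * eta).
  apply: le_trans (_ : K ^+ 2 * (4 * eta) <= _); first by rewrite ler_wpM2l.
  by rewrite ler_wpM2r // mulr_ge0.
have a3 : K ^+ 3 * (w ^+ 5 / 2 + 2 * w) <= K ^+ 3 * (3 * w).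
  by rewrite ler_wpM2l //; lra.
lra.
Qed.

(** The quotient is K / (Z + alpha Z K). As alpha Z is close to 1 and Z <= C, it is close to 1 once
    K is large compared with C. *)
Let mean_field_bounds :
  1 - C / K - eta <= K / (1 + alpha d o * K) / Z o o <= 1 + 2 * eta.
Proof.
move: alpha_d; rewrite ler_norml => /andP[h1 h2].
have al0 : 0 <= alpha d o by apply: alpha_ge0 => //; exact: ltW.
have hpos : 0 < 1 + alpha d o * K by rewrite ltr_pwDl // mulr_ge0 // ltW.
have q0 : 0 < (1 + alpha d o * K) * Z o o by rewrite mulr_gt0.
have -> : K / (1 + alpha d o * K) / Z o o = K / ((1 + alpha d o * K) * Z o o).
  by rewrite -mulrA -invfM.
have C0 : 0 <= C by rewrite (le_trans (ltW z0)).
rewrite ler_pdivlMr // ler_pdivrMr //; apply/andP; split.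
  have hk : (1 + alpha d o * K) * Z o o <= C + (1 + eta) * K.
    have -> : (1 + alpha d o * K) * Z o o = Z o o + (alpha d o * Z o o) * K by ring.
    by rewrite lerD // ler_wpM2r ?(ltW K0) //; lra.
  have [neg|pos] := leP (1 - C / K - eta) 0.
    by apply: le_trans (ltW K0); rewrite mulr_le0_ge0 // ltW.
  apply: le_trans (ler_wpM2l (ltW pos) hk) _.
  set x := C / K + eta.
  have -> : (1 - C / K - eta) * (C + (1 + eta) * K) = K * ((1 - x) * (1 + x)).
    by rewrite /x; field; rewrite gt_eqF.
  by rewrite ler_piMr ?(ltW K0) //; have := sqr_ge0 x; rewrite expr2; lra.
have hk : (1 - eta) * K <= (1 + alpha d o * K) * Z o o.
  have -> : (1 + alpha d o * K) * Z o o = Z o o + (alpha d o * Z o o) * K by ring.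
  rewrite -[leLHS]add0r lerD ?(ltW z0) // ler_wpM2r ?(ltW K0) //; lra.
have e2 : 0 <= 1 + 2 * eta by lra.
apply: le_trans (ler_wpM2l e2 hk).
have e3 : 0 <= eta * (1 - 2 * eta) by rewrite mulr_ge0 // subr_ge0.
rewrite mulrA ler_peMl ?(ltW K0) //; lra.
Qed.

Let lap_bounds :
  1 - C / K - eta - 8 * K ^+ 3 * (eta + w) <= T * lap / Z o o <=
  1 + 2 * eta + 8 * K ^+ 3 * (eta + w).
Proof.
have /andP[h1 h2] := mean_field_bounds.
have := laplace_scaled; set X := 4 * K ^+ 3 * _; rewrite ler_norml => /andP[h3 h4].
have X0 : 0 <= X by rewrite !mulr_ge0 ?exprn_ge0 ?addr_ge0 ?(ltW K0) ?(ltW w0).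
have zi : (Z o o)^-1 <= 2 by rewrite -[leRHS]invrK lef_pV2 ?posrE ?invr_gt0.
have zi0 : 0 <= (Z o o)^-1 by rewrite invr_ge0 ltW.
have XE : 8 * K ^+ 3 * (eta + w) = 2 * X by rewrite /X; ring.
have Xz : X * (Z o o)^-1 <= 2 * X by rewrite mulrC ler_wpM2r.
rewrite XE; set B := K / _ in h1 h2 h3 h4.
have h5 : (T * lap - B) * (Z o o)^-1 <= X * (Z o o)^-1 by rewrite ler_wpM2r //; lra.
have h6 : - X * (Z o o)^-1 <= (T * lap - B) * (Z o o)^-1 by rewrite ler_wpM2r //; lra.
apply/andP; split; lra.
Qed.

Lemma occupation_lower :
  1 - C / K - eta - 8 * K ^+ 3 * (eta + w) <= T * rho r T o / Z o o.
Proof.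
have /andP[h _] := lap_bounds; apply: le_trans h _.
rewrite ler_wpM2r ?invr_ge0 ?(ltW z0) // ler_wpM2l ?(ltW T0) //.
by apply: (rho_lower hsym) => //; exact: ltW.
Qed.

(** [rho_upper] with u = delta T and l0 = K/T. The crude bound makes T rho(T) and delta T rho(delta
    T) both at most 48(C + 1), so the small clusters contribute O(1/(delta K)), which vanishes as K
    grows. *)
Lemma occupation_upper (delta : R) : 0 < delta ->
  (1 + delta) * T / N%:R <= 1 ->
  (1 + delta) * T * rho r ((1 + delta) * T) o / Z o o <=
  (1 + delta) * (1 + 2 * eta + 8 * K ^+ 3 * (eta + w) +
                 2 * (48 * (C + 1)) ^+ 2 / (delta * K)).
Proof.
move=> de0 tN.
have de1 : 0 <= 1 + delta by rewrite addr_ge0 // ltW.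
have u0 : 0 <= delta * T by rewrite mulr_ge0 // ltW.
have t0 : 0 <= (1 + delta) * T by rewrite mulr_ge0 // ltW.
have C0 : 0 <= C + 1 by rewrite addr_ge0 // (le_trans (ltW z0)).
have gle s : 0 <= s -> s <= (1 + delta) * T -> s * rho r s o <= 48 * (C + 1).
  move=> s0 st; apply: le_trans (rho_crude hsym htrans hirr hZ o s0) _.
  rewrite ler_wpM2l //; apply: le_trans (green_le s0) _; rewrite lerD //.
  by apply: le_trans tN; rewrite ler_wpM2r ?invr_ge0.
have hT : T * rho r T o <= 48 * (C + 1).
  by apply: gle; [exact: ltW|rewrite mulrDl mul1r lerDl].
have hu : delta * T * rho r (delta * T) o <= 48 * (C + 1).
  by apply: gle => //; rewrite mulrDl mul1r lerDr ltW.
have l0p : 0 < K / T <= 1 by rewrite divr_gt0 //; case/andP: l01.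
have := rho_upper hsym htrans o l0p (ltW T0) u0.
have -> : delta * T + T = (1 + delta) * T by ring.
rewrite -/lap => h.
have /andP[_ hl] := lap_bounds.
have rT := rho_ge0 hsym o (ltW T0); have ru := rho_ge0 hsym o u0.
have hprod : T * (rho r T o * rho r (delta * T) o / (K / T)) <=
   (48 * (C + 1)) ^+ 2 / (delta * K).
  have -> : T * (rho r T o * rho r (delta * T) o / (K / T)) =
     (T * rho r T o) * (delta * T * rho r (delta * T) o) / (delta * K).
    by field; rewrite !gt_eqF.
  rewrite ler_wpM2r ?invr_ge0 ?mulr_ge0 ?(ltW de0) ?(ltW K0) // expr2 ler_pM //.
    by rewrite mulr_ge0 // ltW.
  by rewrite mulr_ge0.
have zi : (Z o o)^-1 <= 2 by rewrite -[leRHS]invrK lef_pV2 ?posrE ?invr_gt0.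
have zi0 : 0 <= (Z o o)^-1 by rewrite invr_ge0 ltW.
rewrite -(mulrA (1 + delta) T) -(mulrA (1 + delta)) ler_wpM2l //.
set Q := (48 * (C + 1)) ^+ 2 / (delta * K) in hprod.
have Q0 : 0 <= Q by rewrite divr_ge0 ?sqr_ge0 // mulr_ge0 // ltW.
have h2 : T * rho r ((1 + delta) * T) o <= T * lap + Q.
  by apply: le_trans (ler_wpM2l (ltW T0) h) _; rewrite mulrDr lerD2l.
have h3 : T * rho r ((1 + delta) * T) o / Z o o <= (T * lap + Q) / Z o o.
  by rewrite ler_wpM2r.
have h4 : Q / Z o o <= 2 * Q by rewrite mulrC ler_wpM2r.
apply: le_trans h3 _; rewrite mulrDl.
have -> : 2 * (48 * (C + 1)) ^+ 2 / (delta * K) = 2 * Q by rewrite /Q mulrA.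
move: hl h4; lra.
Qed.

End Scale.
End SingleChainEstimates.

(** * Passage to the limit along the sequence *)

Section Limits.
Variables (R : realType) (N : nat -> nat).
Variable r : forall n, 'I_(N n) -> 'I_(N n) -> R.
Arguments r : clear implicits.
Hypothesis hsym : forall n, symmetric_rates (r n).
Hypothesis hirr : forall n, irreducible (r n).
Arguments hirr : clear implicits.
Hypothesis htrans : forall n, transitive_chain (r n).
Hypothesis hUT : uniformly_transient r.
Hypothesis hN : (fun n => (N n)%:R : R) @ \oo --> +oo.
Variable Z : forall n, 'I_(N n) -> 'I_(N n) -> R.
Arguments Z : clear implicits.
Hypothesis hZ : forall n, fundamental (r n) (Z n).
Variable x : forall n, 'I_(N n).
Variable tn : nat -> R.
Hypothesis htn : tn @ \oo --> +oo.
Hypothesis htm : (fun n => tn n / t_meet (r n)) @ \oo --> (0 : R).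

Let z n := Z n (x n) (x n).
Let tail n s := PZ (r n) (Z n) s (x n) (x n).
Let al n s := alpha (r n) s (x n).

Lemma near_N_ge (A : R) : \forall n \near \oo, A <= (N n)%:R.
Proof. by move/cvgryPge: hN; apply. Qed.

Lemma near_N_gt1 : \forall n \near \oo, (1 < N n)%N.
Proof.
by apply: filterS (near_N_ge 2) => n; rewrite (ler_nat R 2).
Qed.

Lemma near_tn_ge (A : R) : \forall n \near \oo, A <= tn n.
Proof. by move/cvgryPge: htn; apply. Qed.

Lemma transience_integral (M e : R) : 0 < e -> exists2 s, M <= s &
  \forall n \near \oo, (\int[lebesgue_measure]_(t in
     `[Num.min s (t_rel (r n)), t_rel (r n)]) p_t (r n) t (x n) (x n))%R <= e.
Proof.
move=> e0.
pose u s n : \bar R := (\big[Num.max/0]_(x : 'I_(N n)) \big[Num.max/0]_(y : 'I_(N n))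
   (\int[lebesgue_measure]_(t in `[Num.min s (t_rel (r n)), t_rel (r n)])
      p_t (r n) t x y)%R)%:E.
have [s Ms] : exists2 s, M <= s & (limn_esup (u s) < e%:E)%E.
  have h : \forall s \near +oo, (limn_esup (u s) < e%:E)%E.
    have h0 : nbhs (0%E : \bar R) [set y : \bar R | (y < e%:E)%E].
      apply: open_nbhs_nbhs; split; first exact: open_ereal_lt_ereal.
      by rewrite /= lte_fin.
    exact: (hUT h0).
  have h' : \forall s \near +oo, M <= s by apply: nbhs_pinfty_ge; rewrite num_real.
  have [s [hs Ms]] := filter_ex (filterI h h').
  by exists s.
(* The limsup is an infimum, over sets of the filter, of suprema; the strict bound selects one such
   set. *)
rewrite /limn_esup /limf_esup => /ereal_inf_lt[_ [V V_oo <-] Ve].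
exists s => //; apply: filterS V_oo => n Vn.
have : (u s n <= e%:E)%E.
  by apply: le_trans (ltW Ve); apply: ereal_sup_ubound; exists n.
rewrite lee_fin; apply: le_trans.
pose I a b := (\int[lebesgue_measure]_(t in
  `[Num.min s (t_rel (r n)), t_rel (r n)]) p_t (r n) t a b)%R.
have h1 := le_bigmax 0 (I (x n)) (x n).
apply: le_trans h1 _.
exact: (le_bigmax 0 (fun a => \big[Num.max/0]_b I a b) (x n)).
Qed.

Lemma tail_small (e : R) : 0 < e -> exists2 S, 0 <= S &
  \forall n \near \oo, tail n S <= e.
Proof.
(* [PZ_tail_bound] gives 3(e/6) + 1/s, and s >= 2/e makes 1/s at most e/2. *)
move=> e0; have e6 : 0 < e / 6 by rewrite divr_gt0.
have [s] := transience_integral (Num.max 1 (2 / e)) e6.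
rewrite ge_max => /andP[s1 se] hs.
have s0 : 0 < s by rewrite (lt_le_trans ltr01).
exists (4 * s ^+ 3); first by rewrite mulr_ge0 // exprn_ge0 // ltW.
apply: filterS2 hs near_N_gt1 => n hn N1.
have := PZ_tail_bound (hsym n) (htrans n) (hirr n) (hZ n) N1 s1 hn (ltW e6).
move=> /le_trans; apply.
have : s^-1 <= e / 2.
  by rewrite -[leRHS]invrK lef_pV2 ?posrE ?invr_gt0 ?divr_gt0 // invf_div.
lra.
Qed.

(** [alpha_lower] at s = t = 0 reads 1 - 1/N <= 2 alpha_0 Z(o,o), which excludes a nonpositive
    diagonal. *)
Lemma near_z_gt0 : \forall n \near \oo, 0 < z n.
Proof.
apply: filterS near_N_gt1 => n N1.
have := alpha_lower (hsym n) (htrans n) (hirr n) (hZ n) (x n) (lexx 0) (lexx 0).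
rewrite !(mulr0, mul0r, addr0, subr0) PZ_0 -/(z n) => h.
have a0 := alpha_ge0 (hsym n) (htrans n) (x n) (lexx 0).
have : 0 < alpha (r n) 0 (x n) * (z n + z n).
  by apply: lt_le_trans h; rewrite subr_gt0 invf_lt1 ?ltr1n // ltr0n ltnW.
move=> /[dup] h'; rewrite pmulr_rgt0; first by lra.
by rewrite lt_def a0 andbT; apply: contraTneq h' => ->; rewrite mul0r ltxx.
Qed.

Lemma near_z_le : exists2 C, 1 <= C & \forall n \near \oo, z n <= C.
Proof.
have [S S0 hS] := tail_small ltr01.
exists (S + 1); first by rewrite lerDr.
apply: filterS hS => n hn.
apply: le_trans (Z_diag_le (hsym n) (hZ n) (x n) S0) _.
by rewrite lerD2l.
Qed.

(** Converts the hypothesis on t_n / t_meet: since t_meet = N z / 2 with z bounded, t_n is also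
    negligible against N. *)
Lemma near_tn_N (e : R) : 0 < e -> \forall n \near \oo, tn n / (N n)%:R <= e.
Proof.
move=> e0; have [C C1 hC] := near_z_le.
have C0 : 0 < C by rewrite (lt_le_trans ltr01).
have hm : \forall n \near \oo, `|0 - tn n / t_meet (r n)| <= e / C.
  by move/cvgrPdist_le: htm; apply; rewrite divr_gt0.
apply: filterS2 (filterI near_z_gt0 hC) (filterI hm near_N_gt1) => n [z0 zC] [+ N1].
rewrite sub0r normrN => /(le_trans (ler_norm _)).
rewrite (t_meetE (hsym n) (htrans n) (hirr n) (hZ n) (x n)) -/(z n) => h.
have N0 : 0 < (N n)%:R :> R by rewrite ltr0n ltnW.
have -> : tn n / (N n)%:R = tn n / ((N n)%:R * z n / 2) * (z n / 2).
  by field; rewrite !gt_eqF.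
apply: le_trans (_ : e / C * (z n / 2) <= _).
  by rewrite ler_wpM2r // divr_ge0 // ltW.
rewrite mulrAC ler_pdivrMr // ler_wpM2l ?(ltW e0) //; lra.
Qed.

(** Uniformity in [d] up to [tn n] matters, because the estimate is applied both at the observation
    time and at its square root, which moves with n. *)
Lemma near_alpha (eta : R) : 0 < eta -> exists2 D, 1 <= D &
  \forall n \near \oo, forall d, D <= d -> d <= tn n -> `|al n d * z n - 1| <= eta.
Proof.
move=> eta0; have e4 : 0 < eta / 4 by rewrite divr_gt0.
have e8 : 0 < eta / 8 by rewrite divr_gt0.
have [S S0 hS] := tail_small e4.
exists (Num.max 1 S); first by rewrite le_max lexx.
apply: filterS2 (filterI hS (near_tn_N e8))
  (filterI (near_N_ge (Num.max 1 S / (eta / 4))) near_N_gt1) => n [tS tN] [SN N1] d.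
rewrite ge_max => /andP[d1 dS] dt.
have N0 : 0 < (N n)%:R :> R by rewrite ltr0n ltnW.
have d0 : 0 <= d by rewrite (le_trans ler01).
have SN' : Num.max 1 S / (N n)%:R <= eta / 4.
  by rewrite ler_pdivrMr // mulrC -ler_pdivrMr.
have N1' : (N n)%:R^-1 <= eta / 4.
  apply: le_trans SN'; rewrite -[leLHS]mul1r ler_wpM2r ?invr_ge0 ?(ltW N0) //.
  by rewrite le_max lexx.
have SN'' : S / (N n)%:R <= eta / 4.
  apply: le_trans SN'; rewrite ler_wpM2r ?invr_ge0 ?(ltW N0) //.
  by rewrite le_max lexx orbT.
have dN : 2 * d / (N n)%:R <= eta / 4.
  have : d / (N n)%:R <= tn n / (N n)%:R by rewrite ler_wpM2r // invr_ge0 ltW.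
  lra.
have up := alpha_upper (hsym n) (htrans n) (hirr n) (hZ n) (x n) d0.
have lo := alpha_lower (hsym n) (htrans n) (hirr n) (hZ n) (x n) S0 d0.
have tail2 : tail n (2 * d) <= eta / 4.
  apply: le_trans tS; apply: (PZ_nonincr (hsym n) (htrans n) (hZ n)); lra.
have a0 := alpha_ge0 (hsym n) (htrans n) (x n) d0.
have a1 := alpha_le1 (hsym n) (htrans n) (x n) d0.
rewrite -/(tail n (2 * d)) -/(z n) -/(al n d) in up.
rewrite -/(tail n S) -/(z n) -/(al n d) in lo a0 a1.
have corr : al n d * (S / (N n)%:R + tail n S) <= eta / 2.
  have h0 : 0 <= S / (N n)%:R + tail n S.
    by rewrite addr_ge0 ?divr_ge0 ?(ltW N0) // PZ_diag_ge0.
  by apply: le_trans (ler_piMl h0 a1) _; lra.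
rewrite ler_norml; lra.
Qed.

(** alpha z is at least 1/2 at time t_n, and alpha is at most 1. *)
Lemma near_z_ge : \forall n \near \oo, 2^-1 <= z n.
Proof.
have h2 : 0 < 2^-1 :> R by rewrite invr_gt0.
have [D D1 hD] := near_alpha h2.
apply: filterS3 hD (near_tn_ge D) near_z_gt0 => n hn Dt z0.
have := hn _ Dt (lexx _); rewrite ler_norml => /andP[h _].
have t0 : 0 <= tn n by rewrite (le_trans _ Dt) // (le_trans ler01).
have a1 := alpha_le1 (hsym n) (htrans n) (x n) t0.
have : al n (tn n) * z n <= z n by rewrite ler_piMl // ltW.
lra.
Qed.

Lemma quartic_scale (A T : R) : 1 <= A -> A ^+ 4 <= T ->
  exists w, [/\ 0 < w, A <= w^-1 & T = (w ^+ 4)^-1].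
Proof.
move=> A1 AT; have A0 : 0 < A by rewrite (lt_le_trans ltr01).
have T0 : 0 <= T by rewrite (le_trans _ AT) // exprn_ge0 // ltW.
pose v := Num.sqrt (Num.sqrt T).
have v4 : v ^+ 4 = T by rewrite (exprM v 2 2) !sqr_sqrtr ?sqrtr_ge0.
have Av : A <= v.
  by rewrite -(@ler_pXn2r _ 4) ?nnegrE ?sqrtr_ge0 ?(ltW A0) // v4.
have v0 : 0 < v by rewrite (lt_le_trans A0).
by exists v^-1; rewrite invr_gt0 invrK exprVn invrK.
Qed.

Lemma occupation_limit : (fun n => tn n * rho (r n) (tn n) (x n) / z n) @ \oo --> (1 : R).
Proof.
apply/cvgrPdist_le => eps0 eps0_gt0.
pose eps := Num.min eps0 1.
have e0 : 0 < eps by rewrite lt_min eps0_gt0 ltr01.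
have e1 : eps <= 1 by rewrite ge_min lexx orbT.
have [C C1 hC] := near_z_le.
have C0 : 0 < C by rewrite (lt_le_trans ltr01).
pose delta := eps / 8.
have de0 : 0 < delta by rewrite divr_gt0.
pose Q := 2 * (48 * (C + 1)) ^+ 2.
have Q0 : 0 < Q by rewrite mulr_gt0 // exprn_gt0 // mulr_gt0 // addr_gt0.
(* The two added terms force C/K <= delta and Q/(delta K) <= delta, the errors of [occupation_lower]
   and [occupation_upper] that only a large K removes. *)
pose K := 1 + C / delta + Q / (delta * delta).
have dd0 : 0 < delta * delta by rewrite mulr_gt0.
have Cd0 : 0 <= C / delta by rewrite divr_ge0 // ltW.
have Qd0 : 0 <= Q / (delta * delta) by rewrite divr_ge0 // ltW.
have K1 : 1 <= K by rewrite /K; lra.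
have K0 : 0 < K by rewrite (lt_le_trans ltr01).
have CK : C / K <= delta.
  rewrite ler_pdivrMr // mulrC -ler_pdivrMr // /K; lra.
have QK : Q / (delta * K) <= delta.
  by rewrite ler_pdivrMr ?mulr_gt0 // mulrA mulrC -ler_pdivrMr // /K; lra.
have K30 : 0 < K ^+ 3 by rewrite exprn_gt0.
have K31 : 1 <= K ^+ 3 by rewrite exprn_ege1.
(* Chosen after K: with eta and w at most [kap], the error 8 K^3 (eta + w) is at most [delta]. *)
pose kap := eps / (128 * K ^+ 3).
have kap0 : 0 < kap by rewrite divr_gt0 // mulr_gt0.
have kapK : 8 * K ^+ 3 * (kap + kap) = delta.
  by rewrite /kap /delta; field; rewrite gt_eqF.
have kapd : 16 * kap <= delta.
  have := ler_wpM2r (ltW kap0) K31; rewrite -kapK; lra.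
have [D D1 hD] := near_alpha kap0.
pose A := Num.max (Num.max D K) kap^-1.
have AD : D <= A by rewrite !le_max lexx.
have AK : K <= A by rewrite !le_max lexx orbT.
have Akap : kap^-1 <= A by rewrite le_max lexx orbT.
have A1 : 1 <= A by rewrite (le_trans D1).
have A0 : 0 < A by rewrite (lt_le_trans ltr01).
have scale T : A ^+ 4 <= T -> exists w,
    [/\ 0 < w, w <= 1, w <= kap, T = (w ^+ 4)^-1 & [/\ K <= T, D <= (w ^+ 2)^-1 & (w ^+ 2)^-1 <= T]].
  move=> /(quartic_scale A1)[w [w0 Aw Tw]].
  have w1 : w <= 1.
    by rewrite -[w]invrK invf_le1 ?invr_gt0 // (le_trans A1).
  have v1 : 1 <= w^-1 by rewrite (le_trans A1).
  have pw m n : (m <= n)%N -> w^-1 ^+ m <= w^-1 ^+ n by move=> mn; rewrite ler_weXn2l.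
  exists w; split => //.
    by rewrite -[w]invrK -[kap]invrK lef_pV2 ?posrE ?invr_gt0 // (le_trans Akap).
  rewrite Tw -!exprVn; split.
  - by apply: le_trans (pw 1%N 4%N isT); rewrite expr1 (le_trans AK).
  - by apply: le_trans (pw 1%N 2%N isT); rewrite expr1 (le_trans AD).
  - exact: pw.
have tN1 := near_tn_N ltr01.
(* The lower bound is taken at scale T = t_n and the upper one at T = t_n / (1 + delta), whose
   extended time (1 + delta) T is again t_n; the factor keeps both scales above A^4. *)
have big := near_tn_ge ((1 + delta) * A ^+ 4).
apply: filterS2 (filterI hD tN1) (filterI big (filterI near_z_ge hC)) =>
  n [hal tN] [tbig [zge zle]].
have de1 : 0 < 1 + delta by rewrite addr_gt0.
have A4 : 0 < A ^+ 4 by rewrite exprn_gt0.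
have t1 : A ^+ 4 <= tn n.
  by apply: le_trans tbig; rewrite ler_peMl ?(ltW A4) // lerDl ltW.
have t2 : A ^+ 4 <= tn n / (1 + delta) by rewrite ler_pdivlMr // mulrC.
have tt : tn n / (1 + delta) <= tn n.
  rewrite ler_pdivrMr // ler_peMr ?lerDl ?(ltW de0) //.
  by rewrite (le_trans (ltW A4)).
have K8 : 0 <= 8 * K ^+ 3 by rewrite mulr_ge0 // ltW.
have kap1 : 2 * kap <= 1 by rewrite /delta in kapd; lra.
have lo : 1 - C / K - kap - 8 * K ^+ 3 * (kap + kap) <=
    tn n * rho (r n) (tn n) (x n) / z n.
  have [w [w0 w1 wk Tw [KT Dd dT]]] := scale _ t1.
  have := @occupation_lower R (N n) (r n) (hsym n) (htrans n) (Z n) (x n) w K C kap w0 w1 K1.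
  rewrite -Tw; move=> /(_ KT zge zle (ltW kap0) kap1 (hal _ Dd dT)).
  have dd : D <= tn n by rewrite (le_trans Dd).
  move=> /(_ (hal _ dd (lexx _))); apply: le_trans.
  by rewrite lerD2l lerN2 ler_wpM2l // lerD2l.
have up : tn n * rho (r n) (tn n) (x n) / z n <=
    (1 + delta) * (1 + 2 * kap + 8 * K ^+ 3 * (kap + kap) + Q / (delta * K)).
  have [w [w0 w1 wk Tw [KT Dd dT]]] := scale _ t2.
  have := @occupation_upper R (N n) (r n) (hsym n) (htrans n) (hirr n) (Z n) (hZ n) (x n)
    w K C kap w0 w1 K1.
  rewrite -Tw; move=> /(_ KT zge zle (ltW kap0) kap1 (hal _ Dd (le_trans dT tt))).
  have dd : D <= tn n / (1 + delta) by rewrite (le_trans Dd).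
  move=> /(_ (hal _ dd tt) delta de0).
  have -> : (1 + delta) * (tn n / (1 + delta)) = tn n by rewrite mulrC divfK ?gt_eqF.
  move=> /(_ tN) /le_trans; apply.
  rewrite ler_wpM2l ?(ltW de1) // lerD2r lerD2l.
  by rewrite ler_wpM2l // lerD2l.
rewrite kapK in lo up.
have ee : eps <= eps0 by rewrite ge_min lexx.
have lo' : 1 - eps <= tn n * rho (r n) (tn n) (x n) / z n.
  by apply: le_trans lo; rewrite /delta in CK kapd *; lra.
have up' : tn n * rho (r n) (tn n) (x n) / z n <= 1 + eps.
  apply: le_trans up _; apply: (@le_trans _ _ ((1 + delta) * (1 + 3 * delta))).
    by rewrite ler_wpM2l ?(ltW de1) //; lra.
  have : delta * eps <= delta by rewrite ler_piMr // ltW.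
  have -> : (1 + delta) * (1 + 3 * delta) = 1 + 4 * delta + 3 * (delta * delta) by ring.
  have -> : delta * eps = 8 * (delta * delta) by rewrite /delta; field.
  have -> : eps = 8 * delta by rewrite /delta; field.
  lra.
rewrite ler_norml; lra.
Qed.

Lemma alpha_limit : (fun n => al n (tn n) * z n) @ \oo --> (1 : R).
Proof.
apply/cvgrPdist_le => e e0; have [D _ hD] := near_alpha e0.
by apply: filterS2 hD (near_tn_ge D) => n hn Dt; rewrite distrC; exact: hn.
Qed.

End Limits.


Unset Implicit Arguments.

Theorem theorem1p11 (R : realType) (N : nat -> nat)
    (r : forall n, 'I_(N n) -> 'I_(N n) -> R)
    (hsym : forall n, symmetric_rates (r n))
    (hirr : forall n, irreducible (r n))
    (htrans : forall n, transitive_chain (r n))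
    (hUT : uniformly_transient r)
    (hN : (fun n => (N n)%:R : R) @ \oo --> +oo) :
  forall tn : nat -> R,
    tn @ \oo --> +oo ->
    (fun n => tn n / t_meet (r n)) @ \oo --> (0 : R) ->
    forall x : forall n, 'I_(N n),
      (fun n => (N n)%:R * tn n / (2 * t_meet (r n)) * P_occ (r n) (tn n) (x n))
        @ \oo --> (1 : R)
      /\
      (fun n => tn n * alpha (r n) (tn n) (x n) * P_occ (r n) (tn n) (x n))
        @ \oo --> (1 : R).
Proof.
move=> tn htn htm x.
have exZ n := cid (fundamental_exists (hsym n) (htrans n) (hirr n)).
pose Z n := projT1 (exZ n); have hZ n : fundamental (r n) (Z n) := projT2 (exZ n).
have lim1 := occupation_limit hsym hirr htrans hUT hN hZ x htn htm.
have lim2 := alpha_limit hsym hirr htrans hUT hN hZ x htn htm.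
have z_gt0 := near_z_gt0 hsym hirr htrans hN hZ x.
split.
  apply: cvg_trans lim1; apply: near_eq_cvg.
  apply: filterS z_gt0 => n z0.
  have N0 := card_pos R (x n).
  rewrite (t_meetE (hsym n) (htrans n) (hirr n) (hZ n) (x n)) /rho.
  by field; rewrite !gt_eqF.
(* Z(o,o) cancels between the two limits: alpha Z tends to 1 and t P / Z tends to 1. *)
have lim : (fun n => alpha (r n) (tn n) (x n) * Z n (x n) (x n) *
    (tn n * rho (r n) (tn n) (x n) / Z n (x n) (x n))) @ \oo --> (1 : R).
  by rewrite -[X in _ --> X]mulr1; exact: cvgM lim2 lim1.
apply: cvg_trans lim; apply: near_eq_cvg.
apply: filterS z_gt0 => n z0 /=; rewrite /rho.
by field; rewrite gt_eqF.
Qed.
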